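(* Let $(M,\omega)$ be a closed Kähler manifold of complex dimension $n\ge2$, let $2\le k\le n$, and let $\alpha_0,\dots,\alpha_{k-1}$ be real continuous functions on $M$ with $\alpha_i(z)\ge0$ for $0\le i\le k-2$ and $\sum_{l=0}^{k-2}\alpha_l(z)>0$ for all $z\in M$. Suppose that $\chi_0\in\Gamma_{k-1}(M)$ and that $\tau>0$ is a constant such that $\chi_0-\tau\omega\in\Gamma_{k-1}(M)$ and $\omega-\tau\chi_0\in\Gamma_{k-1}(M)$. If $u\in C^2(M)$ satisfies $\chi_u\in\Gamma_{k-1}(M)$, then the following pointwise inequalities hold: (1) for $0\le t\le1$ and $1\le l\le k-1$, $$\chi_{tu}^{l-1}\wedge\omega^{n-l}\ge(1-t)^{l-1}\tau^{l-1}\omega^{n-1};$$ (2) for $0<t\le1$ and $1\le l\le k-1$, $$\chi_u^l\wedge\omega^{n-l}\le\frac1{t^l}\chi_{tu}^l\wedge\omega^{n-l}.$$ Moreover, if $u$ is a solution of the equation $$\chi_u^k\wedge\omega^{n-k}=\sum_{l=0}^{k-1}\alpha_l(z)\chi_u^l\wedge\omega^{n-l}$$ and $\chi_0$ satisfies the cone condition for this equation (defined in the context), then there exists a uniform constant $C>0$ such that for $0\le t\le1$ $$k\chi_{tu}^{k-1}\wedge\omega^{n-k}-\sum_{l=1}^{k-1}l\alpha_l\chi_{tu}^{l-1}\wedge\omega^{n-l}>C(1-t)\,\chi_{tu}^{k-2}\wedge\omega^{n-k+1},$$ and consequently $$k\chi_{tu}^{k-1}\wedge\omega^{n-k}-\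sum_{l=1}^{k-1}l\alpha_l\chi_{tu}^{l-1}\wedge\omega^{n-l}>C\tau^{k-2}(1-t)^{k-1}\omega^{n-1}.$$
   Context: For a real $C^2$ function $v$ on $M$, $\chi_v=\chi_0+\frac{\sqrt{-1}}2\partial\overline\partial v$; so $\chi_{tu}=\chi_0+t\frac{\sqrt{-1}}2\partial\overline\partial u$. For a real $(1,1)$-form $\chi$, $\sigma_j(\chi)=\binom nj\frac{\chi^j\wedge\omega^{n-j}}{\omega^n}$ (the $j$-th elementary symmetric function of the eigenvalues of $\chi$ with respect to $\omega$), and $\chi\in\Gamma_j(M)$ means $\sigma_i(\chi)>0$ on $M$ for all $1\le i\le j$. Put $[\chi_0]=\{\chi_0+\frac{\sqrt{-1}}2\partial\overline\partial v: v\in C^2(M)\}$. The form $\chi_0$ satisfies the cone condition if there exists $\overline\chi\in[\chi_0]\cap\Gamma_{k-1}(M)$ such that $$k\overline\chi^{k-1}\wedge\omega^{n-k}>\sum_{l=1}^{k-1}l\alpha_l\overline\chi^{l-1}\wedge\omega^{n-l}.$$ Inequalities between real $(n-1,n-1)$-forms mean that the difference is a positive (strictly positive for $>$) form at every point; inequalities between $(n,n)$-forms are with respect to the orientation given by $\omega^n$.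
   Formalization: The cone condition is required of χ₀ itself (χ̄=χ₀) rather than of some χ̄ in [χ₀]∩Γ_{k-1}; with the latter the estimate fails at t=0 (e.g. on a flat 2-torus), and whenever a solution u exists the conclusion at t=0 forces the cone inequality for χ₀. *)

(* Defs.v *)
From HB Require Import structures.
From mathcomp Require Export all_boot all_order all_algebra.
From mathcomp Require Import complex.
From mathcomp Require Export all_classical all_reals all_analysis.
Export Order.TTheory GRing.Theory Num.Theory numFieldNormedType.Exports.

Set Implicit Arguments.
Unset Strict Implicit.
Unset Printing Implicit Defensive.

Local Open Scope classical_set_scope.
Local Open Scope ring_scope.

(* R[i], sealed behind a numClosedFieldType so that its canonical topology
   and the normed-module structure of 'rV_n over it are inferred.
   In this type 0 <= c means that c is real and nonnegative. *)
Definition Cplx (R : realType) : numClosedFieldType := R[i].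

Definition rc (R : realType) (x : R) : Cplx R := complex.Complex x 0.

(** * Exterior algebra of the complexified cotangent space of C^n *)

(* An exterior form at a point is the family of its coefficients in the basis
   of ordered monomials in the 2n generators
     dz_0 < ... < dz_(n-1) < dzbar_0 < ... < dzbar_(n-1);
   the monomial indexed by S is the increasing wedge product over S. *)
Notation extform R n := {ffun {set 'I_(n + n)} -> Cplx R}.

Section ExteriorAlgebra.
Variables (R : realType) (n : nat).
Local Notation C := (Cplx R).
Local Notation ext := (extform R n).

Definition escale (c : C) (eta : ext) : ext := [ffun S => c * eta S].

(* e_A /\ e_B = (-1) ^ (inversions A B) e_(A u B) for disjoint A and B. *)
Definition inversions (A B : {set 'I_(n + n)}) : nat :=
  #|[set p : 'I_(n + n) * 'I_(n + n)
      | [&& p.1 \in A, p.2 \in B & (p.2 < p.1)%N]]|.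

Definition wedge (eta theta : ext) : ext :=
  [ffun S : {set 'I_(n + n)} =>
     \sum_(A : {set 'I_(n + n)} | A \subset S)
       (-1) ^+ inversions A (S :\: A) * eta A * theta (S :\: A)].

Definition eone : ext := [ffun S => (S == finset.set0)%:R].

Definition wpow (eta : ext) (p : nat) : ext := iter p (wedge eta) eone.

Definition dz (a : 'I_n) : ext := [ffun S => (S == [set lshift n a]%SET)%:R].
Definition dzbar (a : 'I_n) : ext := [ffun S => (S == [set rshift n a]%SET)%:R].

(* The (1,1)-form (sqrt(-1)/2) sum_(a,b) H_ab dz_a /\ dzbar_b; it is real
   exactly when H is Hermitian. *)
Definition form11 (H : 'M[C]_n) : ext :=
  escale ('i / 2) (\sum_(a < n) \sum_(b < n) escale (H a b) (wedge (dz a) (dzbar b))).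

(* chi^p /\ omega^q, for the forms with coefficient matrices chi and omega *)
Definition mixed (chi omega : 'M[C]_n) (p q : nat) : ext :=
  wedge (wpow (form11 chi) p) (wpow (form11 omega) q).

(* The quotient eta / omega^n of (n,n)-forms *)
Definition over_volume (omega : 'M[C]_n) (eta : ext) : C :=
  eta [set: 'I_(n + n)]%SET / wpow (form11 omega) n [set: 'I_(n + n)]%SET.

Definition sigma (j : nat) (omega chi : 'M[C]_n) : C :=
  'C(n, j)%:R * over_volume omega (mixed chi omega j (n - j)).

Definition top_ge0 (omega : 'M[C]_n) (eta : ext) : Prop :=
  0 <= over_volume omega eta.

(* (sqrt(-1)/2) xi /\ xibar for the (1,0)-covector xi = sum_a xi_a dz_a *)
Definition sqr10 (xi : 'rV[C]_n) : ext := form11 (xi^T *m map_mx Num.conj xi).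

(* Positivity of a real (n-1,n-1)-form: its wedge product with every
   sqrt(-1) xi /\ xibar is a nonnegative (n,n)-form. *)
Definition form_ge0 (omega : 'M[C]_n) (eta : ext) : Prop :=
  forall xi : 'rV[C]_n, 0 <= over_volume omega (wedge eta (sqr10 xi)).

Definition form_gt0 (omega : 'M[C]_n) (eta : ext) : Prop :=
  forall xi : 'rV[C]_n, xi != 0 -> 0 < over_volume omega (wedge eta (sqr10 xi)).

(* k chi^(k-1) /\ omega^(n-k)
     - sum_(1 <= l <= k-1) l a_l chi^(l-1) /\ omega^(n-l) *)
Definition cone_form (k : nat) (a : nat -> R) (omega chi : 'M[C]_n) : ext :=
  escale k%:R (mixed chi omega k.-1 (n - k))
  - \sum_(1 <= l < k) escale (l%:R * rc (a l)) (mixed chi omega l.-1 (n - l)).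

End ExteriorAlgebra.

(** * Differential calculus on open subsets of C^n *)

Section Calculus.
Variables (R : realType) (n : nat).
Local Notation C := (Cplx R).
Local Notation E := 'rV[Cplx R]_n.

Definition along (f : E -> R) (x v : E) : R -> R := fun t => f (x + rc t *: v).

Definition rderive (v : E) (f : E -> R) : E -> R := fun x => derive1 (along f x v) 0.

(* C^k in the real sense. All real directions v are used instead of the 2n
   coordinate directions, which gives the same class on open sets. *)
Fixpoint Ck (k : nat) (U : set E) (f : E -> R) : Prop :=
  (forall x, U x -> {for x, continuous f}) /\
  (if k is k'.+1 then
     forall v, (forall x, U x -> derivable (along f x v) 0 1)
               /\ Ck k' U (rderive v f)
   else True).

Definition cderive (v : E) (f : E -> C) : E -> C := fun x =>
  rc (rderive v (fun y => complex.Re (f y)) x)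
  + 'i * rc (rderive v (fun y => complex.Im (f y)) x).

Definition d_z (a : 'I_n) (f : E -> C) : E -> C := fun x =>
  (cderive (delta_mx 0 a) f x - 'i * cderive ('i *: delta_mx 0 a) f x) / 2.
Definition d_zbar (a : 'I_n) (f : E -> C) : E -> C := fun x =>
  (cderive (delta_mx 0 a) f x + 'i * cderive ('i *: delta_mx 0 a) f x) / 2.

Definition exterior_d (eta : E -> extform R n) : E -> extform R n := fun x =>
  \sum_(a < n)
    (wedge (dz R a) [ffun S => d_z a (fun y => eta y S) x]
     + wedge (dzbar R a) [ffun S => d_zbar a (fun y => eta y S) x]).

(* (sqrt(-1)/2) ddbar f = form11 (chess f) *)
Definition chess (f : E -> R) (x : E) : 'M[C]_n :=
  \matrix_(a, b) d_z a (d_zbar b (fun y => rc (f y))) x.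

End Calculus.

(** * Complex manifolds and real (1,1)-forms *)

(* Differentiability is over the field Cplx R, so that the transition maps,
   which are defined on open sets, are holomorphic. *)
Record complex_atlas (R : realType) (n : nat) (M : topologicalType) := {
  chart : Type;
  dom : chart -> set M;
  coord : chart -> M -> 'rV[Cplx R]_n;
  param : chart -> 'rV[Cplx R]_n -> M;
  dom_open : forall i, open (dom i);
  dom_cover : forall z, exists i, dom i z;
  image_open : forall i, open (coord i @` dom i);
  coordK : forall i z, dom i z -> param i (coord i z) = z;
  coord_continuous : forall i z, dom i z -> {for z, continuous (coord i)};
  param_continuous : forall i z, dom i z -> {for coord i z, continuous (param i)};
  transition_holomorphic : forall i j z, dom i z -> dom j z ->
    differentiable (coord j \o param i) (coord i z)
}.
Arguments dom {R n M} c i _.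
Arguments coord {R n M} c i _.
Arguments param {R n M} c i _.

Section Manifold.
Variables (R : realType) (n : nat) (M : topologicalType).
Variable X : complex_atlas R n M.
Local Notation C := (Cplx R).

(* omega i z is the coefficient matrix at z, in the chart i, of a (1,1)-form;
   it is meaningful only when z is in the domain of i. *)
Definition field11 := chart X -> M -> 'M[C]_n.

(* Continuity is the only regularity required; the last clause is invariance
   under change of coordinates: with w = coord j as a function of the
   coordinates of the chart i, dw_b = sum_a J_ab dz_a. *)
Definition real_form11 (chi : field11) : Prop :=
  [/\ forall i z, dom X i z -> chi i z \is hermsymmx,
      forall i z (a b : 'I_n), dom X i z ->
        {for z, continuous (fun y => chi i y a b)}
    & forall i j z, dom X i z -> dom X j z ->
        let J := jacobian (coord X j \o param X i) (coord X i z) in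
        chi i z = J *m chi j z *m (map_mx Num.conj J)^T].

Definition kahler_form (omega : field11) : Prop :=
  [/\ real_form11 omega,
      forall i z (v : 'rV[C]_n), dom X i z -> v != 0 ->
        0 < (v *m omega i z *m (map_mx Num.conj v)^T) 0 0,
      forall i (a b : 'I_n) m,
        Ck m (coord X i @` dom X i)
             (fun x => complex.Re (omega i (param X i x) a b))
        /\ Ck m (coord X i @` dom X i)
             (fun x => complex.Im (omega i (param X i x) a b))
    & forall i x, (coord X i @` dom X i) x ->
        exterior_d (fun y => form11 (omega i (param X i y))) x = 0].

Definition C2 (v : M -> R) : Prop :=
  forall i, Ck 2 (coord X i @` dom X i) (v \o param X i).

(* chi_v = chi_0 + (sqrt(-1)/2) ddbar v *)
Definition deform (chi0 : field11) (v : M -> R) : field11 := fun i z =>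
  chi0 i z + chess (v \o param X i) (coord X i z).

Definition Gamma (omega : field11) (m : nat) (chi : field11) : Prop :=
  forall i z, dom X i z ->
    forall j, (1 <= j <= m)%N -> 0 < sigma j (omega i z) (chi i z).

Definition in_class (chi0 chi : field11) : Prop :=
  exists v, C2 v /\ forall i z, dom X i z -> chi i z = deform chi0 v i z.

(* chibar witnesses the cone condition for the class [chi0]: it belongs to
   [chi0], to Gamma_(k-1), and satisfies the cone inequality.
   The class [chi0] satisfies the cone condition when it has a witness. Along
   the path chi_(tu) starting at chi0 the relevant condition is that chi0
   itself is a witness: a witness elsewhere in the class gives no information
   at t = 0, where the asserted estimate implies the cone inequality for
   chi0. *)
Definition cone_witness (omega : field11) (k : nat) (alpha : nat -> M -> R)
    (chi0 chibar : field11) : Prop :=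
  [/\ in_class chi0 chibar, Gamma omega k.-1 chibar
    & forall i z, dom X i z ->
        form_gt0 (omega i z) (cone_form k (alpha^~ z) (omega i z) (chibar i z))].

Definition solution (omega : field11) (k : nat) (alpha : nat -> M -> R)
    (chi0 : field11) (u : M -> R) : Prop :=
  forall i z, dom X i z ->
    mixed (deform chi0 u i z) (omega i z) k (n - k)
    = \sum_(0 <= l < k)
        escale (rc (alpha l z)) (mixed (deform chi0 u i z) (omega i z) l (n - l)).

End Manifold.

(* Main.v *)
Require Import Defs.
From HB Require Import structures.
From mathcomp Require Import fingroup perm spectral complex.
From mathcomp Require Import zify ring lra.

Set Implicit Arguments.
Unset Strict Implicit.
Unset Printing Implicit Defensive.

Local Open Scope ring_scope.
Local Open Scope sesquilinear_scope.

(* Everything but the uniformity of the constant C is linear algebra at a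
   point. A frame G with G omega G^* = 1 turns chi into a Hermitian matrix X;
   the functions sigma_j(chi) become the coefficients of det (1 + s X), and
   wedging chi^j /\ omega^(n-1-j) with i xi /\ conj xi gives the coefficients of
   conj xi adj(1 + s X) xi^T, that is the sigma_j of the compression of X to the
   hyperplane orthogonal to xi.
   For vectors, sigma_(m+1) / sigma_m is superadditive on Gamma_m, by induction
   on m from the recursion removing one coordinate, so Gamma_m is a convex cone.
   This passes to Hermitian matrices by diagonalising the sum and pinching.
   Since chi_tu = (1-t) chi_0 + t chi_u, part (1) is the binomial expansion around
   (1-t) tau omega and part (2) is the monotonicity of sigma_l along Gamma_(k-1).
   Divided by chi^(k-2), the cone expression is concave in chi: the quotients
   sigma_(l-1) / sigma_(k-2) are reciprocals of products of positive concave
   functions, hence convex. It is positive at chi_u by ellipticity (Newton's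
   inequalities) and at chi_0 by hypothesis, there uniformly because M is
   compact. *)

(** * Elementary symmetric functions *)

Section ElementarySymmetric.
Variables (R : realFieldType) (I : finType).
Implicit Types (x y : I -> R) (A : {set I}).

(** The denominator chi^(k-2) is dictated by alpha_(k-1), which has no sign: its term in the cone
    expression is a multiple of chi^(k-2), so division turns it into a constant along the segment,
    and only the nonnegative alpha_l with l <= k-2 have to meet a convex quotient. The constant C is
    read off at chi_0 alone. At chi_u only strict positivity is used, whose size is not controlled
    in terms of u; concavity weights the two ends by 1-t and t, so the bound keeps the factor 1-t
    and C does not depend on u. The main obstacle is concavity of sigma_(m+1) / sigma_m on Hermitian
    matrices that do not commute. It is reached without differentiating eigenvalues: statements are
    made about low-order coefficients of generating polynomials, prod (1 + x_i s) for vectors and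
    det (1 + s X) for matrices. A further linear factor 1 + d s amounts to adjoining a 1 x 1 block
    d; positivity of the coefficients of such products survives pinching, and a suitable d turns it
    into concavity of the quotient. *)

Definition epol x A : {poly R} := \prod_(i in A) (1 + x i *: 'X).
Definition esf x A j : R := (epol x A)`_j.
(** Including j = 0, where the value is 1, makes every quotient e_(j+1) / e_j with j <= m have a
    positive denominator, e_0 being no exception. *)
Definition gam x m A := forall j, (j <= m)%N -> 0 < esf x A j.

Lemma epolD1 x A i : i \in A -> epol x A = (1 + x i *: 'X) * epol x (A :\ i).
Proof. by move=> iA; rewrite /epol (big_setD1 i). Qed.

Lemma esf0 x A : esf x A 0 = 1.
Proof.
rewrite /esf /epol -horner_coef0 horner_prod big1 // => i _.
by rewrite hornerD hornerZ hornerX mulr0 addr0 hornerC.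
Qed.

Lemma esfS x A i j : i \in A ->
  esf x A j.+1 = esf x (A :\ i) j.+1 + x i * esf x (A :\ i) j.
Proof.
by move=> iA; rewrite /esf (epolD1 x iA) mulrDl mul1r -scalerAl coefD coefZ coefXM.
Qed.

(** Since x_i X = (1 + x_i X) - 1, the term of X p' that differentiates the factor i is p minus the
    product without that factor. *)
Lemma sum_epolD1 x A :
  \sum_(i in A) epol x (A :\ i) = epol x A *+ #|A| - 'X * (epol x A)^`().
Proof.
have [n] := ubnP #|A|; elim: n A => // n IH A ltAn.
have [->|[i iA]] := set_0Vmem A.
  by rewrite big_set0 cards0 /epol big_set0 derivC mulr0 subr0 mulr0n.
have cA : #|A| = #|A :\ i|.+1 by rewrite (cardsD1 i) iA.
rewrite (big_setD1 i) //= (epolD1 x iA).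
have -> : \sum_(k in A :\ i) epol x (A :\ k)
    = (1 + x i *: 'X) * \sum_(k in A :\ i) epol x (A :\ i :\ k).
  rewrite mulr_sumr; apply: eq_bigr => k; rewrite !inE => /andP[ki kA].
  have iAk : i \in A :\ k by rewrite !inE eq_sym ki.
  by rewrite (epolD1 x iAk); congr (_ * epol x _); apply/setP=> l; rewrite !inE andbCA.
rewrite IH; last by rewrite -ltnS -cA.
have dp : (1 + x i *: 'X)^`() = (x i)%:P :> {poly R}.
  by rewrite derivD derivZ derivX -alg_polyC -[1%R in X in X + _]polyC1 derivC add0r.
rewrite derivM dp cA mulrS -mul_polyC.
move: (epol x _) ((epol x _)^`()) => p p'.
rewrite -mulrnAr; move: (p *+ _) (x i)%:P => q c; ring.
Qed.

Lemma sum_esfD1 x A j :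
  \sum_(i in A) esf x (A :\ i) j = (#|A|%:R - j%:R) * esf x A j.
Proof.
rewrite /esf -coef_sum sum_epolD1 coefB coefMn coefXM mulrBl !mulr_natl.
by case: j => [|j] /=; rewrite ?mulr0n // coef_deriv.
Qed.

Lemma sum_mul_esfD1 x A j :
  \sum_(i in A) x i * esf x (A :\ i) j = j.+1%:R * esf x A j.+1.
Proof.
have -> : \sum_(i in A) x i * esf x (A :\ i) j =
          \sum_(i in A) (esf x A j.+1 - esf x (A :\ i) j.+1).
  by apply: eq_bigr => i iA; rewrite (esfS x j iA) addrC addKr.
rewrite sumrB sum_esfD1 sumr_const -[in LHS]mulr_natl; ring.
Qed.

Lemma esf_gt_card x A j : (#|A| < j)%N -> esf x A j = 0.
Proof.
have [n] := ubnP #|A|; elim: n A j => // n IH A j ltAn.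
have [->|[i iA]] := set_0Vmem A.
  by rewrite cards0 /esf /epol big_set0 coef1; case: j.
have cA : #|A| = #|A :\ i|.+1 by rewrite (cardsD1 i) iA.
have ltn' : (#|A :\ i| < n)%N by rewrite -ltnS -cA.
case: j => // j; rewrite cA ltnS => lt.
by rewrite (esfS x j iA) !IH ?mulr0 ?addr0 // (ltn_trans lt).
Qed.

(* Summing N_k(A \ i) = e_k(A) e_k(A \ i) - e_(k+1)(A) e_(k-1)(A \ i) over i,
   where N_k = e_k^2 - e_(k-1) e_(k+1), gives
   (n - k) e_k^2 - (n - k + 1) e_(k+1) e_(k-1). *)
Lemma esf_newton_aux x A k :
  (k.+1 < #|A|)%N ->
  (#|A|%:R - k%:R) * (esf x A k * esf x A k.+2)
    <= (#|A|%:R - k.+1%:R) * esf x A k.+1 ^+ 2.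
Proof.
have [n] := ubnP #|A|; elim: n A k => // n IH A k ltAn ltkA.
rewrite -subr_ge0.
have -> : (#|A|%:R - k.+1%:R) * esf x A k.+1 ^+ 2
    - (#|A|%:R - k%:R) * (esf x A k * esf x A k.+2)
  = \sum_(i in A) (esf x (A :\ i) k.+1 ^+ 2
                   - esf x (A :\ i) k * esf x (A :\ i) k.+2).
  transitivity (\sum_(i in A) (esf x A k.+1 * esf x (A :\ i) k.+1
                   - esf x A k.+2 * esf x (A :\ i) k)).
    by rewrite sumrB -!mulr_sumr !sum_esfD1; ring.
  by apply: eq_bigr => i iA; rewrite (esfS x k iA) (esfS x k.+1 iA); ring.
apply: sumr_ge0 => i iA.
have cA : #|A| = #|A :\ i|.+1 by rewrite (cardsD1 i) iA.
have ltn' : (#|A :\ i| < n)%N by rewrite -ltnS -cA.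
have [lt|le] := ltnP k.+1 #|A :\ i|; last by rewrite (@esf_gt_card _ _ k.+2) // mulr0 subr0 sqr_ge0.
have h : 0 < #|A :\ i|%:R - k.+1%:R :> R by rewrite subr_gt0 ltr_nat.
have := IH _ _ ltn' lt; rewrite subr_ge0.
have -> : #|A :\ i|%:R - k%:R = #|A :\ i|%:R - k.+1%:R + 1 :> R.
  by rewrite -natr1; ring.
move: h (sqr_ge0 (esf x (A :\ i) k.+1)); set a := _ ^+ 2; set b := esf _ _ _ * _.
by move: (_ - _) => N; nra.
Qed.

(** The integer weight on the left of [esf_newton_aux] exceeds the one on the right, which leaves
    room for strictness as soon as e_(k+1) is nonzero. *)
Lemma esf_newton_lt x A k : esf x A k.+1 != 0 ->
  esf x A k * esf x A k.+2 < esf x A k.+1 ^+ 2.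
Proof.
move=> nz; have p : 0 < esf x A k.+1 ^+ 2 by rewrite exprn_even_gt0.
have [lt|le] := ltnP k.+1 #|A|; last by rewrite (@esf_gt_card _ _ k.+2) // mulr0.
have := esf_newton_aux x lt.
have h : 0 < #|A|%:R - k.+1%:R :> R by rewrite subr_gt0 ltr_nat.
have -> : #|A|%:R - k%:R = #|A|%:R - k.+1%:R + 1 :> R.
  by rewrite -natr1; ring.
move: h p; set a := _ ^+ 2; set b := esf _ _ _ * _.
by move: (_ - _) => N; nra.
Qed.

Lemma esf_newton x A k : esf x A k * esf x A k.+2 <= esf x A k.+1 ^+ 2.
Proof.
have [e0|nz] := eqVneq (esf x A k.+1) 0; last by rewrite ltW // esf_newton_lt.
have [lt|le] := ltnP k.+1 #|A|; last by rewrite (@esf_gt_card _ _ k.+2) // mulr0 sqr_ge0.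
have := esf_newton_aux x lt; rewrite e0 expr0n /= mulr0 pmulr_rle0 //.
by rewrite subr_gt0 ltr_nat ltnW.
Qed.

Lemma gam_le x m m' A : (m' <= m)%N -> gam x m A -> gam x m' A.
Proof. by move=> le g j lej; apply: g; apply: leq_trans le. Qed.

Lemma gam0 x A : gam x 0 A.
Proof. by case=> // _; rewrite esf0. Qed.

Lemma gamS x m A : gam x m A -> 0 < esf x A m.+1 -> gam x m.+1 A.
Proof. by move=> g p j; rewrite leq_eqVlt => /orP[/eqP->|/g]. Qed.

(** If e_(m+1) of the remaining coordinates were nonpositive, positivity of e_(m+1) and e_(m+2) on A
    would force e_m e_(m+2) > e_(m+1)^2 on A without i, against Newton. *)
Lemma gamD1 x m A i : i \in A -> gam x m.+1 A -> gam x m (A :\ i).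
Proof.
move=> iA; elim: m => [|m IH] g; first exact: gam0.
have gm := IH (gam_le (leqnSn _) g).
apply: gamS => //; have := g m.+1 (leqnSn _); have := g m.+2 (leqnn _).
rewrite !(esfS x _ iA); have := gm m (leqnn _); have := esf_newton x (A :\ i) m.
set s := esf x _ m; set s1 := esf x _ m.+1; set s2 := esf x _ m.+2; set a := x i.
move=> N s0 h2 h1; rewrite ltNge; apply/negP => s1le.
suff : s1 ^+ 2 < s * s2 by rewrite ltNge N.
nra.
Qed.

(** Newton's inequality, chained, makes the quotients e_(j+1) / e_j strictly decreasing. The last
    numerator e_(p+1) may have any sign, since only e_0, ..., e_p occur as denominators. *)
Lemma esf_ratio_lt x A p l : (l < p)%N -> gam x p A ->
  esf x A p.+1 * esf x A l < esf x A p * esf x A l.+1.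
Proof.
elim: p => // p IH; rewrite ltnS leq_eqVlt => /orP[/eqP-> g|lt g].
  by have := esf_newton_lt (lt0r_neq0 (g p.+1 (leqnn _))); rewrite expr2 mulrC.
have lp := ltnW lt.
have := IH lt (gam_le (leqnSn _) g).
have := esf_newton_lt (lt0r_neq0 (g p.+1 (leqnn _))).
have := g p (leqnSn _); have := g p.+1 (leqnn _).
have := g l (leq_trans lp (leqnSn _)); have := g l.+1 (leqW lt).
set a := esf x A p; set b := esf x A p.+1; set c := esf x A p.+2.
set d := esf x A l; set e := esf x A l.+1 => he hd hb ha N h.
rewrite -(ltr_pM2l ha) mulrA; apply: (@lt_trans _ _ (b ^+ 2 * d)).
  by rewrite ltr_pM2r.
by rewrite expr2 -mulrA [ltRHS]mulrCA ltr_pM2l.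
Qed.

Lemma esf_ratio x A p l : (l <= p)%N -> gam x p A ->
  esf x A p.+1 * esf x A l <= esf x A p * esf x A l.+1.
Proof.
rewrite leq_eqVlt => /orP[/eqP-> _|lt g]; first by rewrite mulrC.
exact/ltW/esf_ratio_lt.
Qed.

End ElementarySymmetric.

(** The function ab / (a + b) is superadditive where the sums are positive, the gap being a multiple
    of (ad - bc)^2, and nondecreasing in b, with derivative a^2 / (a + b)^2. Single entries may be
    negative, as coordinates of a vector in the cone may be. *)
Lemma harmonic_superadd (R : realFieldType) (a b c d G : R) :
  0 < a + b -> 0 < c + d -> b + d <= G ->
  a * b / (a + b) + c * d / (c + d) <= (a + c) * G / (a + c + G).
Proof.
move=> ab cd bdG.
have p : 0 < a + c + (b + d) by lra.
have q : 0 < a + c + G by lra.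
apply: (@le_trans _ _ ((a + c) * (b + d) / (a + c + (b + d)))).
  rewrite -subr_ge0.
  have -> : (a + c) * (b + d) / (a + c + (b + d)) - (a * b / (a + b) + c * d / (c + d))
     = (a * d - b * c) ^+ 2 / ((a + b) * (c + d) * (a + c + (b + d))).
    by field; rewrite !gt_eqF.
  by rewrite divr_ge0 ?sqr_ge0 // ltW // !mulr_gt0.
rewrite ler_pdivrMr // mulrAC ler_pdivlMr // -subr_ge0.
have -> : (a + c) * G * (a + c + (b + d)) - (a + c) * (b + d) * (a + c + G)
  = (a + c) ^+ 2 * (G - (b + d)) by ring.
by rewrite mulr_ge0 ?sqr_ge0 // subr_ge0.
Qed.

(** * Superadditivity of the quotients e_(m+1) / e_m *)

Section Superadditivity.
Variables (R : realFieldType) (I : finType).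
Implicit Types (x y : I -> R) (A : {set I}).

(** Both conclusions go through one induction: the inequality at level m makes e_(m+1) of the sum
    positive, and this is the denominator at level m + 1. *)
Lemma esf_superadd x y m A : gam x m A -> gam y m A ->
  gam (fun i => x i + y i) m A /\
  esf x A m.+1 / esf x A m + esf y A m.+1 / esf y A m
  <= esf (fun i => x i + y i) A m.+1 / esf (fun i => x i + y i) A m.
Proof.
elim: m A => [|m IH] A gx gy.
  split; first exact: gam0.
  rewrite !esf0 !divr1.
  have e1 z : esf z A 1 = \sum_(i in A) z i.
    have := sum_mul_esfD1 z A 0; rewrite mul1r => <-.
    by apply: eq_bigr => i _; rewrite esf0 mulr1.
  by rewrite !e1 big_split.
set z := fun i => x i + y i.
have [gz le] := IH A (gam_le (leqnSn _) gx) (gam_le (leqnSn _) gy).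
have gz1 : gam z m.+1 A.
  apply: gamS => //.
  have : 0 < esf z A m.+1 / esf z A m.
    by apply: lt_le_trans le; rewrite addr_gt0 ?divr_gt0 ?gx ?gy.
  by rewrite pmulr_lgt0 // invr_gt0 gz.
split => //.
(* With F_i the quotient of level m without coordinate i, e_(m+1)(A) = e_m(A - i) (w_i + F_i). Hence
   (m+2) e_(m+2) / e_(m+1) is the sum of w_i F_i / (w_i + F_i), to which [harmonic_superadd]
   applies, the induction hypothesis bounding F_i. *)
pose F w i : R := esf w (A :\ i) m.+1 / esf w (A :\ i) m.
have pos w i : gam w m.+1 A -> i \in A -> 0 < w i + F w i.
  move=> gw iA; have := gw m.+1 (leqnn _); rewrite (esfS w _ iA).
  have p := gamD1 iA gw (leqnn m).
  move=> q; rewrite /F; apply: etrans (divr_gt0 q p); congr (0 < _).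
  by field; rewrite gt_eqF.
have eF w : gam w m.+1 A -> m.+2%:R * (esf w A m.+2 / esf w A m.+1)
    = \sum_(i in A) w i * F w i / (w i + F w i).
  move=> gw; rewrite mulrA -sum_mul_esfD1 mulr_suml; apply: eq_bigr => i iA.
  have p := gamD1 iA gw (leqnn m).
  have p1 := pos _ _ gw iA.
  have := gw m.+1 (leqnn _).
  rewrite (esfS w _ iA) /F in p1 *.
  move: p p1; set s := esf _ _ m; set s1 := esf _ _ m.+1 => p p1 q.
  by field; rewrite !gt_eqF //= addrC.
rewrite -(ler_pM2l (ltr0Sn R m.+1)) mulrDr !eF // -big_split /=.
apply: ler_sum => i iA; apply: harmonic_superadd; [exact: pos|exact: pos|].
by have [] := IH (A :\ i) (gamD1 iA gx) (gamD1 iA gy).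
Qed.

End Superadditivity.

(** * Hermitian matrices *)

Section RealEmbedding.
Variable R : realType.

Lemma rc_is_additive : additive (@rc R).
Proof. by move=> x y; exact: (rmorphB (real_complex R)). Qed.
Lemma rc_is_multiplicative : multiplicative (@rc R).
Proof. by split=> [x y|]; [exact: (rmorphM (real_complex R))|exact: (rmorph1 (real_complex R))]. Qed.
HB.instance Definition _ := GRing.isAdditive.Build R (Cplx R) (@rc R) rc_is_additive.
HB.instance Definition _ := GRing.isMultiplicative.Build R (Cplx R) (@rc R) rc_is_multiplicative.

Lemma rc_le (x y : R) : (rc x <= rc y) = (x <= y). Proof. exact: lecR. Qed.
Lemma rc_lt (x y : R) : (rc x < rc y) = (x < y). Proof. exact: ltcR. Qed.
Lemma rc_ge0 (x : R) : (0 <= rc x) = (0 <= x). Proof. by rewrite -rc_le rmorph0. Qed.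
Lemma rc_gt0 (x : R) : (0 < rc x) = (0 < x). Proof. by rewrite -rc_lt rmorph0. Qed.
Lemma real_rc (z : Cplx R) : z \is Num.real -> z = rc (complex.Re z).
Proof. by move=> /RRe_real/esym. Qed.
Lemma rc_real (x : R) : rc x \is Num.real.
Proof. by rewrite realE rc_ge0 -(rmorph0 (@rc R)) rc_le le_total. Qed.
Lemma conj_rc (x : R) : (rc x)^* = rc x.
Proof. exact/CrealP/rc_real. Qed.
Lemma rc_inj : injective (@rc R).
Proof. by move=> x y []. Qed.

End RealEmbedding.

(** * Bordered determinants and rank-one updates *)

Section Determinants.
Variables (D : idomainType) (n : nat).

Lemma det_border (a : 'M[D]_1) (v : 'rV_n) (u : 'cV_n) (M : 'M[D]_n) : \det M != 0 ->
  \det (block_mx a v u M) = a 0 0 * \det M - (v *m \adj M *m u) 0 0.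
Proof.
move=> nz; apply: (mulIf nz).
(* The second factor clears the lower left block using the adjugate instead of an inverse of M,
   which need not exist over the ring; its determinant det M is cancelled at the end. *)
have e : block_mx a v u M *m block_mx (\det M)%:M 0 (- (\adj M *m u)) 1%:M
   = block_mx (a *m (\det M)%:M - v *m (\adj M *m u)) v 0 M.
  rewrite mulmx_block !mulmx0 !mulmx1 !add0r !mulmxN.
  by rewrite [M *m (_ *m _)]mulmxA mul_mx_adj mul_scalar_mx -[u *m _]/(u *m _) (mul_mx_scalar _ u) subrr.
have := congr1 (fun A => \det A) e; rewrite /= det_mulmx det_lblock det_scalar1 det1 mulr1.
by rewrite det_ublock det_mx11 mulmxA mul_mx_scalar !mxE [a 0 0 * _]mulrC.
Qed.

(** Both sides are the determinant of the matrix M bordered by v, -u and the corner 1. The adjugate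
    form is the one that makes sense for matrices of polynomials. *)
Lemma det_add_rank1 (v : 'rV[D]_n) (u : 'cV_n) (M : 'M[D]_n) : \det M != 0 ->
  \det (M + u *m v) = \det M + (v *m \adj M *m u) 0 0.
Proof.
move=> nz.
have := det_border 1%:M v (- u) nz; rewrite mulmxN !mxE mul1r opprK => <-.
have e : block_mx 1%:M v (- u) M *m block_mx 1%:M (- v) 0 1%:M
   = block_mx 1%:M 0 (- u) (M + u *m v).
  rewrite mulmx_block !mulmx0 !mulmx1 !mul1mx !addr0 ?addNr mulNmx mulmxN opprK.
  by rewrite addrC.
have := congr1 (fun A => \det A) e.
by rewrite /= det_mulmx det_ublock !det1 !mulr1 det_lblock det1 mul1r.
Qed.

Lemma adj_diag (d : 'rV[D]_n) : (forall i, d 0 i != 0) ->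
  \adj (diag_mx d) = diag_mx (\row_i \prod_(j | j != i) d 0 j).
Proof.
move=> nz; have := mul_mx_adj (diag_mx d); rewrite det_diag => e.
apply/matrixP=> i j; apply: (mulfI (nz i)).
have := congr1 (fun A : 'M[D]_n => A i j) e.
rewrite /= mul_diag_mx !mxE => ->; rewrite (bigD1 i) //= mulrnAr.
by have [->|] := eqVneq i j.
Qed.

End Determinants.

Lemma linear_factor_neq0 (D : idomainType) (c : D) : 1 + c *: 'X != 0.
Proof.
apply/eqP => e; have := congr1 (fun p : {poly D} => p`_0) e.
by rewrite coefD coef1 coefZ coefX mulr0 addr0 coef0 => /eqP; rewrite oner_eq0.
Qed.

(** * The pencil 1 + s X and its adjugate form *)

Section Pencil.
Variable R : realType.
Local Notation C := (Cplx R).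

Definition pencil n (X : 'M[C]_n) : 'M[{poly C}]_n := 1%:M + 'X *: map_mx polyC X.
Definition pencil_det n (X : 'M[C]_n) : {poly C} := \det (pencil X).
(** The conjugate stands on the left because the (1,1)-form of xi has matrix xi^T conj(xi), whose
    row factor comes first in [det_add_rank1]. *)
Definition pencil_adj n (X : 'M[C]_n) (xi : 'rV[C]_n) : {poly C} :=
  (map_mx polyC (map_mx Num.conj xi) *m \adj (pencil X) *m map_mx polyC xi^T) 0 0.

Lemma pencil_det0 n (X : 'M[C]_n) : (pencil_det X)`_0 = 1.
Proof.
rewrite -horner_coef0 -horner_evalE -det_map_mx map_mxD map_mxZ /= map_mx1.
by rewrite horner_evalE hornerX scale0r addr0 det1.
Qed.

Lemma pencil_det_neq0 n (X : 'M[C]_n) : \det (pencil X) != 0.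
Proof. by apply/eqP => e; have := pencil_det0 X; rewrite /pencil_det e coef0 => /eqP; rewrite eq_sym oner_eq0. Qed.

Lemma det_pencil_rank1 n (X : 'M[C]_n) xi :
  \det (pencil X + map_mx polyC (xi^T *m map_mx Num.conj xi)) = pencil_det X + pencil_adj X xi.
Proof. by rewrite map_mxM det_add_rank1 // pencil_det_neq0. Qed.

Lemma pencil_unitary n (U X : 'M[C]_n) : U \is unitarymx ->
  pencil (U *m X *m U^t*) = map_mx polyC U *m pencil X *m map_mx polyC (U^t*).
Proof.
move=> /unitarymxP h.
rewrite /pencil mulmxDr mulmxDl mulmx1 -map_mxM h map_mx1; congr (_ + _).
by rewrite -scalemxAr -scalemxAl !map_mxM.
Qed.

Lemma det_unitary n (U : 'M[C]_n) (A : 'M[{poly C}]_n) : U \is unitarymx ->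
  \det (map_mx polyC U *m A *m map_mx polyC (U^t*)) = \det A.
Proof.
move=> /unitarymxP h; rewrite !det_mulmx mulrAC -det_mulmx -map_mxM h map_mx1.
by rewrite det1 mul1r.
Qed.

Lemma pencil_det_unitary n (U X : 'M[C]_n) : U \is unitarymx -> pencil_det (U *m X *m U^t*) = pencil_det X.
Proof. by move=> hU; rewrite /pencil_det pencil_unitary // det_unitary. Qed.

(** Writing the adjugate form as a difference of two determinants reduces its invariance to that of
    determinants; the covector moves by U^T so that its rank-one matrix is conjugated along with
    X. *)
Lemma pencil_adj_unitary n (U X : 'M[C]_n) xi : U \is unitarymx ->
  pencil_adj (U *m X *m U^t*) (xi *m U^T) = pencil_adj X xi.
Proof.
move=> hU; apply: (addrI (pencil_det X)); rewrite -{1}(pencil_det_unitary _ hU) -!det_pencil_rank1.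
rewrite -[RHS](det_unitary _ hU) mulmxDr mulmxDl -pencil_unitary //; congr (\det (_ + _)).
by rewrite -!map_mxM trmx_mul trmxK (map_mxM Num.conj) !mulmxA.
Qed.

Lemma spectral_herm n (X : 'M[C]_n) : X^t* = X ->
  exists2 U, U \is unitarymx & exists l : 'I_n -> R,
    U *m X *m U^t* = diag_mx (\row_i rc (l i)).
Proof.
move=> hX; have hX' : X \is hermsymmx by apply/is_hermitianmxP; rewrite expr0 scale1r hX.
have /orthomx_spectralP e := hermitian_normalmx hX'.
have hU := spectral_unitarymx X.
exists (spectralmx X) => //; exists (fun i => complex.Re (spectral_diag X 0 i)).
rewrite {2}e invmx_unitary // !mulmxA (unitarymxP hU) mul1mx -mulmxA (unitarymxP hU) mulmx1.
congr diag_mx; apply/rowP => i; rewrite mxE -real_rc //.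
by have /mxOverP/(_ 0 i) := hermitian_spectral_diag_real hX'.
Qed.

Lemma pencil_diag n (l : 'I_n -> C) :
  pencil (diag_mx (\row_i l i)) = diag_mx (\row_i (1 + l i *: 'X)).
Proof.
apply/matrixP=> i j; rewrite !mxE; have [_|_] := eqVneq i j.
  by rewrite !mulr1n mulrC mul_polyC.
by rewrite !mulr0n rmorph0 mulr0 addr0.
Qed.

Lemma map_epol (I : finType) (l : I -> R) A :
  map_poly (@rc R) (epol l A) = \prod_(i in A) (1 + rc (l i) *: 'X).
Proof.
rewrite /epol rmorph_prod; apply: eq_bigr => i _.
by rewrite /= rmorphD rmorph1 /= map_polyZ map_polyX.
Qed.

Lemma pencil_det_diag n (l : 'I_n -> R) :
  pencil_det (diag_mx (\row_i rc (l i))) = map_poly (@rc R) (epol l [set: _]).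
Proof.
rewrite /pencil_det pencil_diag det_diag map_epol.
by apply: eq_big => [i|i _]; rewrite ?inE ?mxE.
Qed.

Lemma pencil_adj_diag n (l : 'I_n -> R) xi :
  pencil_adj (diag_mx (\row_i rc (l i))) xi =
  \sum_a (`|xi 0 a| ^+ 2) *: map_poly (@rc R) (epol l ([set: _] :\ a)).
Proof.
rewrite /pencil_adj pencil_diag adj_diag; last first.
  by move=> i; rewrite mxE linear_factor_neq0.
rewrite mxE; apply: eq_bigr => a _.
rewrite mul_mx_diag !mxE map_epol normCK mulrAC -rmorphM mul_polyC.
rewrite mulrC; congr (_ *: _).
by apply: eq_big => [i|i _]; rewrite ?inE ?mxE ?andbT.
Qed.

Lemma pencil_adj_delta n (X : 'M[C]_n.+1) i (a : C) :
  pencil_adj X (a *: delta_mx 0 i) = (`|a| ^+ 2) *: pencil_det (row' i (col' i X)).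
Proof.
rewrite /pencil_adj mxE (bigD1 i) //= [X in _ + X]big1 ?addr0; last first.
  by move=> k ki; rewrite !mxE (negbTE ki) andbF mulr0 rmorph0 mulr0.
rewrite mxE (bigD1 i) //= [X in _ + X]big1 ?addr0; last first.
  by move=> k ki; rewrite !mxE (negbTE ki) andbF mulr0 rmorph0 rmorph0 mul0r.
rewrite !mxE !eqxx !mulr1 mulrAC -rmorphM mul_polyC normCK mulrC; congr (_ *: _).
rewrite /cofactor -signr_odd addnn odd_double expr0 mul1r /pencil_det; congr (\det _).
apply/matrixP=> j k; rewrite !mxE; congr (_ *+ _ + _).
by rewrite (inj_eq lift_inj).
Qed.

(** Each off-diagonal block of the pencil carries one factor X, hence the square. The row enters
    conjugated because [pencil_adj] conjugates its covector on the left. *)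
Lemma pencil_det_border n (X : 'M[C]_(1 + n)) : X^t* = X ->
  pencil_det X = (1 + X 0 0 *: 'X) * pencil_det (drsubmx X)
           - 'X^2 * pencil_adj (drsubmx X) (map_mx Num.conj (ursubmx X)).
Proof.
move=> hX; rewrite /pencil_det.
have -> : pencil X = block_mx (1%:M + 'X *: map_mx polyC (ulsubmx X))
   ('X *: map_mx polyC (ursubmx X)) ('X *: map_mx polyC (dlsubmx X)) (pencil (drsubmx X)).
  rewrite -{1}[X]submxK /pencil map_block_mx scale_block_mx (scalar_mx_block 1).
  by rewrite add_block_mx !add0r.
rewrite (@det_border _ n) ?pencil_det_neq0 //; congr (_ * _ - _).
  by rewrite !mxE eqxx mulrC mul_polyC lshift0.
have -> : dlsubmx X = (map_mx Num.conj (ursubmx X))^T.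
  by rewrite -{1}hX map_trmx; apply/matrixP=> i j; rewrite !mxE.
rewrite /pencil_adj.
have -> : map_mx Num.conj (map_mx Num.conj (ursubmx X)) = ursubmx X.
  by rewrite map_mxCK.
by rewrite -scalemxAl -scalemxAl -scalemxAr !mxE mulrA -expr2.
Qed.

End Pencil.

Definition coef_pos (K : numDomainType) m (p : {poly K}) :=
  forall j, (j <= m)%N -> 0 < p`_j.

(** * Products of linear factors *)

Section LinearFactors.
Variable R : realFieldType.

(** Lists allow a diagonal entry split off from a matrix to join the factors already collected, and
    eigenvalues to be merged with them, without transporting finite index types. *)
Definition lpol (s : seq R) : {poly R} := \prod_(x <- s) (1 + x *: 'X).

Lemma lpol_epol (s : seq R) : lpol s = epol (fun i : 'I_(size s) => s`_i) [set: _].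
Proof.
rewrite /lpol /epol (big_nth 0) big_mkord.
by apply: eq_bigl => i; rewrite inE.
Qed.

Lemma epol_lpol (I : finType) (l : I -> R) (A : {set I}) :
  epol l A = lpol [seq l i | i <- enum A].
Proof. by rewrite /lpol big_map big_enum. Qed.

Lemma lpol_cat s t : lpol (s ++ t) = lpol s * lpol t.
Proof. exact: big_cat. Qed.

Lemma lpol_cons x t : lpol (x :: t) = (1 + x *: 'X) * lpol t.
Proof. exact: big_cons. Qed.

Lemma coef_pos_tail m x s : coef_pos m.+1 (lpol (x :: s)) -> coef_pos m (lpol s).
Proof.
rewrite lpol_epol => h; have := gamD1 (finset.in_setT (ord0 : 'I_(size s).+1)) h.
suff -> : lpol s = epol (fun i : 'I_(size s).+1 => (x :: s)`_i) ([set: _] :\ ord0) by [].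
apply: (@mulfI _ (1 + x *: 'X)).
  apply/eqP => e; have := congr1 (fun p : {poly R} => p`_0) e.
  by rewrite coefD coef1 coefZ coefX mulr0 addr0 coef0 => /eqP; rewrite oner_eq0.
by rewrite -lpol_cons lpol_epol (epolD1 _ (finset.in_setT ord0)).
Qed.

Lemma coef_pos_mul_epolD1 m s (I : finType) (l : I -> R) a :
  coef_pos m.+1 (lpol s * epol l [set: I]) ->
  coef_pos m (lpol s * epol l ([set: I] :\ a)).
Proof.
rewrite (epolD1 _ (finset.in_setT a)) epol_lpol mulrCA -lpol_cat -lpol_cons.
exact: coef_pos_tail.
Qed.

Definition cons_fun n (d : R) (f : 'I_n -> R) (i : 'I_n.+1) : R :=
  if unlift ord0 i is Some j then f j else d.

Lemma epol_cons_fun n d (f : 'I_n -> R) :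
  epol (cons_fun d f) [set: _] = (1 + d *: 'X) * epol f [set: _].
Proof.
rewrite /epol; under eq_bigl do rewrite inE.
rewrite big_ord_recl /cons_fun unlift_none; congr (_ * _).
by apply: eq_big => [i|i _]; rewrite ?inE ?liftK.
Qed.

End LinearFactors.

(** * Pinching and convexity of the cone of Hermitian matrices *)

Section HermitianCone.
Variable R : realType.
Local Notation C := (Cplx R).
Local Notation mrc := (map_poly (@rc R)).

Lemma coef_pos_rc m (p : {poly R}) : coef_pos m (mrc p) <-> coef_pos m p.
Proof. by split=> h j /h; rewrite coef_map /= rc_gt0. Qed.

Lemma unitary_rv_neq0 n (U : 'M[C]_n) (xi : 'rV[C]_n) : U \is unitarymx ->
  xi != 0 -> xi *m U^T != 0.
Proof.
move=> hU; apply: contra => /eqP e; rewrite -[xi]mulmx1.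
have := hU; rewrite -trmx_unitary => /unitarymx_unit h.
by rewrite -(mulmxV h) mulmxA e mul0mx.
Qed.

(** In an eigenbasis of X the adjugate form is a combination, with nonnegative weights not all zero,
    of the polynomials with one eigenvalue removed, and each removal costs one order. The spectator
    factor [lpol d] holds the diagonal entries that pinching has already split off. *)
Lemma pencil_adj_pos n (X : 'M[C]_n) xi m d : X^t* = X -> xi != 0 ->
  coef_pos m.+1 (mrc (lpol d) * pencil_det X) -> coef_pos m (mrc (lpol d) * pencil_adj X xi).
Proof.
move=> hX xi0; have [U hU [l e]] := spectral_herm hX.
rewrite -(pencil_det_unitary X hU) -(pencil_adj_unitary X xi hU) e pencil_det_diag pencil_adj_diag.
have := unitary_rv_neq0 hU xi0; move: (xi *m U^T) => {xi xi0} xi xi0.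
rewrite -rmorphM => /coef_pos_rc h j jm.
rewrite mulr_sumr coef_sum.
have pos a : 0 < (mrc (lpol d * epol l ([set: 'I_n] :\ a)))`_j.
  by apply/coef_pos_rc: j jm; exact: coef_pos_mul_epolD1.
have [a xa] : exists a, xi 0 a != 0.
  apply/existsP; apply: contraNT xi0; rewrite negb_exists => /forallP z.
  by apply/eqP/rowP => a; rewrite mxE; apply/eqP; rewrite -[_ == _]negbK.
rewrite (bigD1 a) //= ltr_pwDl //.
  rewrite -scalerAr coefZ -rmorphM; apply: mulr_gt0; last exact: pos.
  by apply: exprn_gt0; rewrite normr_gt0.
apply: sumr_ge0 => b _; rewrite -scalerAr coefZ -rmorphM.
by apply: mulr_ge0; [apply: exprn_ge0|apply/ltW/pos].
Qed.

Lemma pencil_adj_ge0 n (X : 'M[C]_n) xi m d : X^t* = X ->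
  coef_pos m.+1 (mrc (lpol d) * pencil_det X) ->
  forall j, (j <= m)%N -> 0 <= (mrc (lpol d) * pencil_adj X xi)`_j.
Proof.
move=> hX h j jm; have [->|xi0] := eqVneq xi 0; last exact/ltW/(pencil_adj_pos hX xi0 h).
by rewrite /pencil_adj trmx0 !map_mx0 mulmx0 mxE mulr0 coef0.
Qed.

Lemma diag_herm n (X : 'M[C]_n) i : X^t* = X -> X i i = rc (complex.Re (X i i)).
Proof.
move=> hX; rewrite -real_rc //; apply/CrealP.
by rewrite -{2}hX !mxE.
Qed.

(* Pinching: replacing the off-diagonal part of the first row and column by 0
   only increases the coefficients, since they lose the term
   'X^2 * pencil_adj Y v of pencil_det_border. *)
Lemma schur_coef_pos m n (X : 'M[C]_n) d : X^t* = X ->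
  coef_pos m (mrc (lpol d) * pencil_det X) ->
  coef_pos m (lpol d * epol (fun i => complex.Re (X i i)) [set: _]).
Proof.
elim: n m X d => [|n IH] m X d hX hpos.
  have -> : epol (fun i => complex.Re (X i i)) [set: _] = 1.
    by rewrite /epol big1 // => -[].
  have -> : lpol d * 1 = lpol d by rewrite mulr1.
  by move: hpos; rewrite /pencil_det det_mx00 mulr1 => /coef_pos_rc.
pose Y : 'M[C]_n := drsubmx (X : 'M[C]_(1 + n)).
pose v : 'rV[C]_n := map_mx Num.conj (ursubmx (X : 'M[C]_(1 + n))).
have hY : Y^t* = Y by apply/matrixP=> i j; rewrite -[in RHS]/Y /Y -{2}hX !mxE.
pose x := complex.Re (X 0 0).
have eX : X 0 0 = rc x by exact: diag_herm.
have eY : pencil_adj X (1 *: delta_mx 0 0) = pencil_det Y.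
  rewrite pencil_adj_delta normr1 expr1n scale1r; congr pencil_det.
  by apply/matrixP=> i j; rewrite !mxE !rshift1.
have nz : 1 *: delta_mx 0 0 != 0 :> 'rV[C]_n.+1.
  rewrite scale1r; apply/eqP => /rowP/(_ 0); rewrite !mxE => /eqP.
  by rewrite oner_eq0.
have eb : pencil_det X = (1 + rc x *: 'X) * pencil_det Y - 'X^2 * pencil_adj Y v.
  by rewrite -eX; exact: (@pencil_det_border R n X hX).
have ed : mrc (lpol (x :: d)) * pencil_det Y = mrc (lpol d) * ((1 + rc x *: 'X) * pencil_det Y).
  rewrite lpol_cons rmorphM /= rmorphD /= rmorph1 map_polyZ map_polyX.
  by rewrite mulrAC mulrA mulrC mulrA mulrAC -!mulrA.
have hpos' : coef_pos m (mrc (lpol (x :: d)) * pencil_det Y).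
  rewrite ed => j jm; have := hpos j jm; rewrite eb mulrBr coefB [_ * ('X^2 * _)]mulrCA.
  rewrite coefXnM; case: ltnP => [_|j2]; rewrite ?subr0 // subr_gt0.
  apply: le_lt_trans; move: j2 jm; case: m hpos => [|[|m]] hpos.
  - by case: j.
  - by case: j => [|[]].
  (* One order is lost in passing from X to its minor Y and one more in passing from Y to its
     adjugate form; the factor X^2 in front of that form makes up for both. *)
  move=> _ jm; apply: (@pencil_adj_ge0 _ _ _ m) => //; last by rewrite leq_subLR.
  by rewrite -eY; exact: pencil_adj_pos.
have := IH m Y (x :: d) hY hpos'.
rewrite lpol_cons -mulrA mulrCA; congr coef_pos; congr (_ * _).
rewrite /epol; under [RHS]eq_bigl do rewrite inE.
rewrite big_ord_recl; congr (_ * _).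
by apply: eq_big => [i|i _]; rewrite ?inE // !mxE !rshift1.
Qed.

(** In an eigenbasis of X + Y the diagonals of X and Y, kept in the cone by pinching, add up to the
    eigenvalues of the sum, so the vector case applies. The entries [d1] and [d2] form one more
    coordinate, the 1 x 1 block that later yields concavity of quotients. *)
Lemma coef_posD n m (X Y : 'M[C]_n) d1 d2 : X^t* = X -> Y^t* = Y ->
  coef_pos m (mrc (1 + d1 *: 'X) * pencil_det X) ->
  coef_pos m (mrc (1 + d2 *: 'X) * pencil_det Y) ->
  coef_pos m (mrc (1 + (d1 + d2) *: 'X) * pencil_det (X + Y)).
Proof.
move=> hX hY pX pY.
have hZ : (X + Y)^t* = X + Y by rewrite linearD map_mxD /= hX hY.
have [U hU [l e]] := spectral_herm hZ.
have conjH (A : 'M[C]_n) : A^t* = A -> (U *m A *m U^t*)^t* = U *m A *m U^t*.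
  by move=> hA; rewrite !trmx_mul !map_mxM /= trmxCK hA !mulmxA.
have step (A : 'M[C]_n) d : A^t* = A -> coef_pos m (mrc (1 + d *: 'X) * pencil_det A) ->
  gam (cons_fun d (fun i => complex.Re ((U *m A *m U^t*) i i))) m [set: _].
  move=> hA pA j jm; rewrite /esf epol_cons_fun.
  have e1 : lpol [:: d] = 1 + d *: 'X by rewrite /lpol big_seq1.
  have pA' : coef_pos m (mrc (lpol [:: d]) * pencil_det (U *m A *m U^t*)).
    by rewrite e1 (pencil_det_unitary A hU).
  by have := schur_coef_pos (conjH A hA) pA' jm; rewrite e1.
have [g _] := esf_superadd (step _ _ hX pX) (step _ _ hY pY).
rewrite -(pencil_det_unitary _ hU) e pencil_det_diag -rmorphM; apply/coef_pos_rc => j jm.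
have := g j jm; rewrite /esf.
have -> : epol (fun i => cons_fun d1 (fun i => complex.Re ((U *m X *m U^t*) i i)) i
    + cons_fun d2 (fun i => complex.Re ((U *m Y *m U^t*) i i)) i) [set: 'I_n.+1]
    = epol (cons_fun (d1 + d2) l) [set: _].
  apply: eq_bigr => i _; rewrite /cons_fun; case: unliftP => // k _.
  have := congr1 (fun A : 'M[C]_n => complex.Re (A k k)) e.
  by rewrite mulmxDr mulmxDl !mxE eqxx mulr1n /= => <-; rewrite -raddfD.
by rewrite epol_cons_fun.
Qed.

End HermitianCone.

Lemma numerator_le (K : realFieldType) (x x1 y y1 z z1 : K) :
  0 < x -> 0 < x1 -> 0 < y -> 0 < y1 -> 0 < z -> x <= z ->
  x1 / x + y1 / y <= z1 / z -> x1 <= z1.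
Proof.
move=> x0 x10 y0 y10 z0 xz h.
have {}h : x1 / x <= z1 / z by apply: le_trans h; rewrite lerDl divr_ge0 // ltW.
rewrite ler_pdivrMr // mulrAC ler_pdivlMr // in h.
by rewrite -(ler_pM2r x0); apply: le_trans h; rewrite ler_pM2l.
Qed.

(** * Monotonicity and concavity of sigma quotients on Hermitian matrices *)

Section HermitianSigma.
Variable R : realType.
Local Notation C := (Cplx R).
Local Notation mrc := (map_poly (@rc R)).

Definition hsig n (X : 'M[C]_n) j : R := complex.Re (pencil_det X)`_j.
Definition hgam m n (X : 'M[C]_n) := forall j, (j <= m)%N -> 0 < hsig X j.

Lemma pencil_det_esf n (X : 'M[C]_n) : X^t* = X ->
  exists l : 'I_n -> R, pencil_det X = mrc (epol l [set: _]).
Proof.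
move=> hX; have [U hU [l e]] := spectral_herm hX.
by exists l; rewrite -(pencil_det_unitary X hU) e pencil_det_diag.
Qed.

Lemma hsigE n (X : 'M[C]_n) j : X^t* = X -> (pencil_det X)`_j = rc (hsig X j).
Proof. by move=> /pencil_det_esf[l e]; rewrite /hsig e coef_map. Qed.

Lemma hsig0 n (X : 'M[C]_n) : hsig X 0 = 1.
Proof. by rewrite /hsig pencil_det0. Qed.

Lemma hgamP m n (X : 'M[C]_n) : X^t* = X -> hgam m X <-> coef_pos m (pencil_det X).
Proof.
by move=> hX; split=> h j /h; rewrite hsigE // rc_gt0.
Qed.

Lemma hgam_le m m' n (X : 'M[C]_n) : (m' <= m)%N -> hgam m X -> hgam m' X.
Proof. by move=> le g j lej; apply: g; apply: leq_trans le. Qed.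

Lemma hsig_ratio n (X : 'M[C]_n) p l : X^t* = X -> (l <= p)%N -> hgam p X ->
  hsig X p.+1 * hsig X l <= hsig X p * hsig X l.+1.
Proof.
move=> /pencil_det_esf[x e]; rewrite /hgam /hsig e => lp h; rewrite !coef_map /=.
by apply: esf_ratio => // j /h; rewrite coef_map.
Qed.

Lemma herm_add n (X Y : 'M[C]_n) : X^t* = X -> Y^t* = Y -> (X + Y)^t* = X + Y.
Proof. by move=> hX hY; rewrite linearD map_mxD /= hX hY. Qed.

Lemma herm_scale n (X : 'M[C]_n) t : X^t* = X -> (rc t *: X)^t* = rc t *: X.
Proof. by move=> hX; rewrite linearZ /= map_mxZ /= hX conj_rc. Qed.

Lemma hgam_add m n (X Y : 'M[C]_n) : X^t* = X -> Y^t* = Y ->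
  hgam m X -> hgam m Y -> hgam m (X + Y).
Proof.
move=> hX hY /(hgamP _ hX) gX /(hgamP _ hY) gY; apply/hgamP; first exact: herm_add.
have e : mrc (1 + 0 *: 'X) = 1 by rewrite scale0r addr0 rmorph1.
have := @coef_posD R n m X Y 0 0 hX hY.
by rewrite addr0 e !mul1r; apply.
Qed.

Lemma hsig_scale n (X : 'M[C]_n) t j : hsig (rc t *: X) j = t ^+ j * hsig X j.
Proof.
rewrite /hsig.
have -> : pencil_det (rc t *: X) = pencil_det X \Po (rc t *: 'X).
  rewrite /pencil_det -[RHS]/(comp_poly (rc t *: 'X) (\det (pencil X))) -det_map_mx; congr (\det _).
  apply/matrixP => a b; rewrite !mxE -[RHS]/((_ + _) \Po _) linearD /= comp_polyM comp_polyX comp_polyC.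
  rewrite raddfMn /= -polyC1 comp_polyC; congr (_ + _).
  by rewrite -mul_polyC polyCM; ring.
rewrite comp_polyE.
under eq_bigr => i _ do rewrite exprZn scalerA.
rewrite -(poly_def _ (fun i => (pencil_det X)`_i * rc t ^+ i)) coef_poly; case: ltnP => [_|le].
  by rewrite -rmorphXn mulrC; case: (pencil_det X)`_j => a b /=; rewrite mul0r subr0.
by rewrite nth_default // mulr0.
Qed.

Lemma hgam_scale m n (X : 'M[C]_n) t : 0 < t -> hgam m X -> hgam m (rc t *: X).
Proof. by move=> t0 h j /h hj; rewrite hsig_scale mulr_gt0 // exprn_gt0. Qed.

Lemma hgam_convex m n (X Y : 'M[C]_n) t : X^t* = X -> Y^t* = Y -> 0 <= t <= 1 ->
  hgam m X -> hgam m Y -> hgam m (rc (1 - t) *: X + rc t *: Y).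
Proof.
move=> hX hY /andP[]; rewrite le_eqVlt => /orP[/eqP <- _ gX _|t0].
  by rewrite subr0 rmorph0 rmorph1 scale0r scale1r addr0.
rewrite le_eqVlt => /orP[/eqP -> _ gY|t1 gX gY].
  by rewrite subrr rmorph0 rmorph1 scale0r scale1r add0r.
have t1' : 0 < 1 - t by rewrite subr_gt0.
exact: (hgam_add (herm_scale _ hX) (herm_scale _ hY) (hgam_scale t1' gX) (hgam_scale t0 gY)).
Qed.

(* Concavity of s_(m+1) / s_m is convexity of the cone Gamma_(m+1) for the
   block matrices X (+) d, since s_(m+1) (X (+) d) = s_(m+1) X + d s_m X. *)
Lemma hsig_superadd m n (X Y : 'M[C]_n) : X^t* = X -> Y^t* = Y ->
  hgam m X -> hgam m Y ->
  hsig X m.+1 / hsig X m + hsig Y m.+1 / hsig Y m <= hsig (X + Y) m.+1 / hsig (X + Y) m.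
Proof.
move=> hX hY gX gY; apply/ler_addgt0Pr => e e0.
have hZ := herm_add hX hY; have gZ := hgam_add hX hY gX gY.
have cE (A : 'M[C]_n) d j : A^t* = A ->
  (mrc (1 + d *: 'X) * pencil_det A)`_j.+1 = rc (hsig A j.+1 + d * hsig A j).
  move=> hA; rewrite rmorphD rmorph1 /= map_polyZ map_polyX mulrDl mul1r -scalerAl.
  by rewrite coefD coefZ coefXM /= !hsigE // rmorphD rmorphM.
(* This value of d gives s_(m+1) of A (+) d the value (e / 2) s_m(A): the block matrix is placed
   barely inside the cone. Adding two of them and letting e tend to 0 gives the inequality. *)
have pos (A : 'M[C]_n) : A^t* = A -> hgam m A ->
    coef_pos m.+1 (mrc (1 + (e / 2 - hsig A m.+1 / hsig A m) *: 'X) * pencil_det A).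
  move=> hA gA [_|j jm].
    by rewrite coefM big_ord1 pencil_det0 mulr1 coef_map coefD coef1 coefZ coefX mulr0 addr0 rmorph1.
  rewrite ltnS in jm; rewrite cE // rc_gt0.
  have := hsig_ratio hA jm gA; have := gA m (leqnn _); have := gA j jm.
  set a := hsig A j; set b := hsig A m; set a1 := hsig A j.+1; set b1 := hsig A m.+1 => a0 b0 le.
  have -> : a1 + (e / 2 - b1 / b) * a = e / 2 * a + (b * a1 - b1 * a) / b.
    by field; rewrite gt_eqF.
  rewrite ltr_wpDr ?mulr_gt0 ?divr_gt0 // divr_ge0 ?(ltW b0) // subr_ge0 //.
have := coef_posD hX hY (pos X hX gX) (pos Y hY gY) (leqnn _).
rewrite cE // rc_gt0.
have := gZ m (leqnn _); set z := hsig _ m; set z1 := hsig _ m.+1 => z0 h.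
rewrite -subr_ge0; set fx := _ / hsig X m in h *; set fy := _ / hsig Y m in h *.
have -> : z1 / z + e - (fx + fy) = (z1 + (e / 2 - fx + (e / 2 - fy)) * z) / z.
  by field; rewrite gt_eqF.
by rewrite ltW // divr_gt0.
Qed.

(** The quotient is homogeneous of degree one, so superadditivity is concavity. The endpoints are
    separate because scaling within the cone needs a positive factor. *)
Lemma hsig_quot_concave m n (X Y : 'M[C]_n) t : X^t* = X -> Y^t* = Y -> 0 <= t <= 1 ->
  hgam m X -> hgam m Y ->
  (1 - t) * (hsig X m.+1 / hsig X m) + t * (hsig Y m.+1 / hsig Y m) <=
  hsig (rc (1 - t) *: X + rc t *: Y) m.+1 / hsig (rc (1 - t) *: X + rc t *: Y) m.
Proof.
move=> hX hY /andP[]; rewrite le_eqVlt => /orP[/eqP <- _ gX _|t0].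
  by rewrite subr0 rmorph0 rmorph1 scale0r scale1r addr0 mul0r addr0 mul1r.
rewrite le_eqVlt => /orP[/eqP -> _ gY|t1 gX gY].
  by rewrite subrr rmorph0 rmorph1 scale0r scale1r add0r mul0r add0r mul1r.
have t1' : 0 < 1 - t by rewrite subr_gt0.
have econst (A : 'M[C]_n) s : 0 < s -> hgam m A ->
  s * (hsig A m.+1 / hsig A m) = hsig (rc s *: A) m.+1 / hsig (rc s *: A) m.
  move=> s0 gA; rewrite !hsig_scale exprS; field.
  by rewrite (gt_eqF (gA m (leqnn _))) expf_neq0 // gt_eqF.
rewrite (econst X _ t1' gX) (econst Y _ t0 gY).
exact: (hsig_superadd (herm_scale _ hX) (herm_scale _ hY) (hgam_scale t1' gX) (hgam_scale t0 gY)).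
Qed.

(** Dropping the positive quotient of Y from superadditivity shows that each s_(l+1) / s_l grows
    from X to X + Y; multiplying these up from s_0 = 1 gives the claim. *)
Lemma hsig_mono m n (X Y : 'M[C]_n) l : X^t* = X -> Y^t* = Y -> (l <= m)%N ->
  hgam m X -> hgam m Y -> hsig X l <= hsig (X + Y) l.
Proof.
move=> hX hY lm gX gY; have gZ := hgam_add hX hY gX gY.
elim: l lm => [|l IH] lm; first by rewrite !hsig0.
have lm' := ltnW lm.
exact: (numerator_le (gX l lm') (gX l.+1 lm) (gY l lm') (gY l.+1 lm) (gZ l lm') (IH lm')
  (hsig_superadd hX hY (hgam_le lm' gX) (hgam_le lm' gY))).
Qed.

End HermitianSigma.

(* AM-GM in tangent form: prod (x_i / z_i)^-1 >= 1 + sum (1 - x_i / z_i), and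
   the convex combination of the right-hand sides is at least 1. *)
Lemma prod_inv_convex (R : realType) (I : Type) (r : seq I) (P : pred I)
  (x y z : I -> R) t :
  0 <= t <= 1 ->
  (forall i, P i -> 0 < x i) -> (forall i, P i -> 0 < y i) ->
  (forall i, P i -> (1 - t) * x i + t * y i <= z i) ->
  \prod_(i <- r | P i) (z i)^-1 <=
  (1 - t) * \prod_(i <- r | P i) (x i)^-1 + t * \prod_(i <- r | P i) (y i)^-1.
Proof.
move=> /andP[t0 t1] x0 y0 le.
have z0 i : P i -> 0 < z i.
  move=> Pi; apply: lt_le_trans (le i Pi).
  have := x0 i Pi; have := y0 i Pi; nra.
(* Both halves come from 1 + y <= exp y: once for the sum of the 1 - w_i / z_i, and factor by factor
   with y = w_i / z_i - 1 to bound exp (1 - w_i / z_i) by z_i / w_i. *)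
have tangent (w : I -> R) : (forall i, P i -> 0 < w i) ->
    1 + \sum_(i <- r | P i) (1 - w i / z i)
    <= (\prod_(i <- r | P i) z i) * \prod_(i <- r | P i) (w i)^-1.
  move=> w0; apply: le_trans (expR_ge1Dx _) _.
  rewrite expR_sum -big_split /=; apply: ler_prod => i Pi.
  rewrite expR_ge0 /=; set u := w i / z i.
  have u0 : 0 < u by rewrite divr_gt0 ?w0 ?z0.
  have -> : z i / w i = u^-1 by rewrite invf_div.
  have := expR_ge1Dx (u - 1); rewrite addrC subrK => h.
  rewrite -(ler_pM2r u0) mulVf ?gt_eqF //.
  apply: (@le_trans _ _ (expR (1 - u) * expR (u - 1))).
    by rewrite ler_pM2l ?expR_gt0.
  by rewrite -expRD -[u - 1]opprB subrr expR0.
have pz : 0 < \prod_(i <- r | P i) z i by apply: prodr_gt0.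
rewrite -(ler_pM2l pz) prodfV mulfV ?gt_eqF // mulrDr.
rewrite (mulrCA _ (1 - t)) (mulrCA _ t).
apply: (@le_trans _ _ ((1 - t) * (1 + \sum_(i <- r | P i) (1 - x i / z i))
                       + t * (1 + \sum_(i <- r | P i) (1 - y i / z i)))); last first.
  by rewrite lerD // ler_wpM2l ?subr_ge0 ?tangent.
have -> : (1 - t) * (1 + \sum_(i <- r | P i) (1 - x i / z i))
        + t * (1 + \sum_(i <- r | P i) (1 - y i / z i))
  = 1 + \sum_(i <- r | P i) (1 - ((1 - t) * x i + t * y i) / z i).
  rewrite !mulrDr !mulr1 !mulr_sumr addrACA subrK -big_split /=; congr (_ + _).
  by apply: eq_bigr => i _; ring.
rewrite lerDl; apply: sumr_ge0 => i Pi.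
by rewrite subr_ge0 ler_pdivrMr ?z0 // mul1r le.
Qed.

Lemma psumr_mul_gt0 (R : realFieldType) n (a D : 'I_n -> R) :
  (forall i, 0 <= a i) -> (forall i, 0 < D i) -> 0 < \sum_i a i -> 0 < \sum_i a i * D i.
Proof.
move=> a0 D0 s0.
have ge0 i : 0 <= a i * D i by rewrite mulr_ge0 // ltW.
rewrite lt_def sumr_ge0 // andbT; apply/negP; rewrite psumr_eq0 // => /allP z.
move: s0; rewrite big1 ?ltxx // => i _.
by have := z i (mem_index_enum _); rewrite mulf_eq0 (gt_eqF (D0 i)) orbF => /eqP.
Qed.

(** * Compressions, ellipticity and concavity of the cone expression *)

Section Pointwise.
Variable R : realType.
Local Notation C := (Cplx R).
Local Notation mrc := (map_poly (@rc R)).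

Lemma Re_rcM (x : R) (z : C) : complex.Re (rc x * z) = x * complex.Re z.
Proof. by case: z => a b; rewrite /= mul0r subr0. Qed.

Definition hsig1 n (X : 'M[C]_n) xi j : R := complex.Re (pencil_adj X xi)`_j.

Lemma spectral_pencil_adj n (X : 'M[C]_n) : X^t* = X ->
  exists2 U, U \is unitarymx & exists2 l : 'I_n -> R,
    pencil_det X = mrc (epol l [set: _]) &
    forall xi j, (pencil_adj X xi)`_j =
      \sum_a `|(xi *m U^T) 0 a| ^+ 2 * rc (esf l ([set: _] :\ a) j).
Proof.
move=> hX; have [U hU [l e]] := spectral_herm hX.
exists U => //; exists l; first by rewrite -(pencil_det_unitary X hU) e pencil_det_diag.
move=> xi j; rewrite -(pencil_adj_unitary X xi hU) e pencil_adj_diag coef_sum.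
by apply: eq_bigr => a _; rewrite coefZ coef_map.
Qed.

Lemma norm_sqr_rc (z : C) : `|z| ^+ 2 = rc (complex.Re (`|z| ^+ 2)).
Proof. by apply/real_rc/realX/normr_real. Qed.

Lemma hsig1E n (X : 'M[C]_n) xi j : X^t* = X -> (pencil_adj X xi)`_j = rc (hsig1 X xi j).
Proof.
move=> /spectral_pencil_adj[U _ [l _ e]]; apply: real_rc; rewrite e.
by apply: rpred_sum => a _; rewrite rpredM ?rc_real ?realX ?normr_real.
Qed.

(** One eigenbasis and one family of weights serve all j at once, so an expression linear in the
    sequence [hsig1 X xi] may be tested on the eigenvalues with a single one removed. *)
Lemma hsig1_decomp n (X : 'M[C]_n) xi : X^t* = X -> xi != 0 ->
  exists l w : 'I_n -> R,
    [/\ forall j, hsig X j = esf l [set: _] j, forall a, 0 <= w a, 0 < \sum_a w a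
      & forall j, hsig1 X xi j = \sum_a w a * esf l ([set: _] :\ a) j].
Proof.
move=> hX xi0; have [U hU [l e1 e2]] := spectral_pencil_adj hX.
have := unitary_rv_neq0 hU xi0.
exists l, (fun a => complex.Re (`|(xi *m U^T) 0 a| ^+ 2)).
have w0 a : 0 <= complex.Re (`|(xi *m U^T) 0 a| ^+ 2).
  by rewrite -rc_ge0 -norm_sqr_rc exprn_ge0.
split=> //.
- by move=> j; rewrite /hsig e1 coef_map.
- rewrite lt_def sumr_ge0 // andbT; apply: contraNneq H => /eqP.
  rewrite psumr_eq0 // => /allP z; apply/eqP/rowP => a; rewrite [RHS]mxE.
  have /eqP := z a (mem_index_enum _).
  by move/(congr1 (@rc R)); rewrite -norm_sqr_rc rmorph0 => /eqP; rewrite expf_eq0 normr_eq0 /= => /eqP.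
move=> j; rewrite /hsig1 e2.
under eq_bigr => a _ do rewrite norm_sqr_rc -rmorphM.
by rewrite -rmorph_sum.
Qed.

Lemma hsig1_gt0 n m (X : 'M[C]_n) xi j : X^t* = X -> xi != 0 -> hgam m.+1 X ->
  (j <= m)%N -> 0 < hsig1 X xi j.
Proof.
move=> hX xi0 /(hgamP _ hX) h jm.
have := @pencil_adj_pos R n X xi m [::] hX xi0.
have -> : lpol ([::] : seq R) = 1 by rewrite /lpol big_nil.
by rewrite rmorph1 !mul1r => /(_ h j jm); rewrite hsig1E // rc_gt0.
Qed.

(* Up to the factor c = |xi|^2, [hsig1 _ xi] is [hsig] of the compression of the
   matrix to the hyperplane orthogonal to xi. *)
Lemma compression n (xi : 'rV[C]_n.+1) : xi != 0 ->
  exists c : R, 0 < c /\ exists f : 'M[C]_n.+1 -> 'M[C]_n,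
    [/\ forall X, X^t* = X -> (f X)^t* = f X,
        forall X j, hsig1 X xi j = c * hsig (f X) j
      & forall (s t : R) X Y, f (rc s *: X + rc t *: Y) = rc s *: f X + rc t *: f Y].
Proof.
move=> xi0; pose E := xi^T *m map_mx Num.conj xi.
have hE : E^t* = E.
  by rewrite /E trmx_mul map_mxM trmxK map_trmx map_mxCK.
have [U hU [l e]] := spectral_herm hE.
have [z zE] : exists z, z = xi *m U^T by exists (xi *m U^T).
have z0 : z != 0 by rewrite zE unitary_rv_neq0.
have eE : z^T *m map_mx Num.conj z = diag_mx (\row_i rc (l i)).
  by rewrite -e /E zE trmx_mul trmxK map_mxM -map_trmx !mulmxA.
have [i zi] : exists i, z 0 i != 0.
  apply/existsP; apply: contraNT z0; rewrite negb_exists => /forallP h.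
  by apply/eqP/rowP => a; rewrite mxE; apply/eqP; rewrite -[_ == _]negbK.
(* The rank-one matrix of z is diagonal, so its off-diagonal entries vanish and z has no component
   besides the i-th. *)
have ez : z = z 0 i *: delta_mx 0 i.
  apply/rowP => j; rewrite !mxE eqxx /=; have [->|ji] := eqVneq j i; first by rewrite mulr1.
  rewrite mulr0; have := congr1 (fun A : 'M[C]_n.+1 => A i j) eE.
  rewrite !mxE big_ord1 !mxE eq_sym (negbTE ji) mulr0n => /eqP.
  by rewrite mulf_eq0 (negbTE zi) conjC_eq0 => /eqP.
have c0 : 0 < `|z 0 i| ^+ 2 by rewrite exprn_gt0 // normr_gt0.
exists (complex.Re (`|z 0 i| ^+ 2)); split; first by rewrite -rc_gt0 -norm_sqr_rc.
exists (fun X => row' i (col' i (U *m X *m U^t*))); split.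
- move=> X hX.
  have hX' : (U *m X *m U^t*)^t* = U *m X *m U^t*.
    by rewrite !trmx_mul !map_mxM /= trmxCK hX !mulmxA.
  move: (U *m X *m U^t* ) hX' => Y hY; apply/matrixP=> a b.
  by rewrite -[Y in RHS]hY !mxE.
- move=> X j; rewrite /hsig1 -(pencil_adj_unitary X xi hU) -zE [in pencil_adj _ _]ez pencil_adj_delta coefZ.
  by rewrite norm_sqr_rc Re_rcM.
move=> s t X Y; rewrite mulmxDr mulmxDl -!scalemxAr -!scalemxAl.
move: (U *m X *m _) (U *m Y *m _) => X' Y'.
by apply/matrixP => a b; rewrite !mxE.
Qed.

(** This is the cone form paired with a covector, as a linear function of the sequence p of [hsig1]
    values. The factors l are absorbed by l / (n 'C(n-1, l-1)) = 1 / 'C(n, l). *)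
Definition Lval n k (al : nat -> R) (p : nat -> R) : R :=
  p k.-1 / 'C(n, k)%:R - \sum_(1 <= l < k) al l * p l.-1 / 'C(n, l)%:R.

Lemma LvalE n K al p : Lval n K.+2 al p =
  p K.+1 / 'C(n, K.+2)%:R - \sum_(i < K.+1) al i.+1 * p i / 'C(n, i.+1)%:R.
Proof. by rewrite /Lval big_add1 /= big_mkord. Qed.

Lemma Lval_sum (I : finType) n k al (w : I -> R) (p : I -> nat -> R) :
  Lval n k al (fun j => \sum_a w a * p a j) = \sum_a w a * Lval n k al (p a).
Proof.
rewrite /Lval mulr_suml.
under [RHS]eq_bigr => a _ do rewrite mulrBr mulr_sumr mulrA.
rewrite sumrB; congr (_ - _); rewrite exchange_big /=; apply: eq_bigr => l _.
by rewrite mulr_sumr mulr_suml; apply: eq_bigr => a _; rewrite mulrCA !mulrA.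
Qed.

(** Let G be the defect of the equation, so that [Lval] is the derivative of G in x_a. As G = 0,
    [Lval] times e_(K+1) equals Lval e_(K+1) - G s_K, that is e_(K+1)^2 times the derivative of G /
    e_(K+1). In it the term of alpha_(K+1), whose sign is unknown, cancels; the leading term is
    nonnegative by Newton, and the strict decrease of quotients together with the positive sum of
    the other alpha_l gives strictness. *)
Lemma Lval_esf_gt0 n K (al : nat -> R) (x : 'I_n -> R) a :
  (K.+2 <= n)%N -> gam x K.+1 [set: _] ->
  (forall l, (l <= K)%N -> 0 <= al l) -> 0 < \sum_(0 <= l < K.+1) al l ->
  esf x [set: _] K.+2 / 'C(n, K.+2)%:R =
    \sum_(0 <= l < K.+2) al l * esf x [set: _] l / 'C(n, l)%:R ->
  0 < Lval n K.+2 al (esf x ([set: _] :\ a)).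
Proof.
move=> Kn g al0; rewrite big_mkord => als.
set e := esf x [set: _]; set s := esf x _.
have eS j : e j.+1 = s j.+1 + x a * s j by rewrite /e (esfS x _ (finset.in_setT a)).
have gs : gam x K ([set: _] :\ a) by apply: gamD1 g; rewrite inE.
have e1 : 0 < e K.+1 by apply: g.
have Cp l : (l <= n)%N -> 0 < 'C(n, l)%:R^-1 :> R by move=> ln; rewrite invr_gt0 ltr0n bin_gt0.
rewrite big_mkord big_ord_recr /= => eqn.
(* [D i] is the coefficient of alpha_i in that expansion; at i = 0 the absent s_(-1) counts as 0. *)
pose D (i : 'I_K.+1) : R := (if i : nat is i'.+1 then e i * s K - s i' * e K.+1 else s K) / 'C(n, i)%:R.
have D0 i : 0 < D i.
  rewrite /D; apply: mulr_gt0; last first.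
    by apply: Cp; apply: leq_trans (ltnW (ltn_ord i)) (leq_trans (leqnSn _) Kn).
  case: i => [[|i] /=]; first by move=> _; apply: gs.
  rewrite ltnS => iK; have := esf_ratio_lt iK gs; rewrite -/s !eS => h.
  have -> : (s i.+1 + x a * s i) * s K - s i * (s K.+1 + x a * s K)
    = s K * s i.+1 - s K.+1 * s i by ring.
  by rewrite subr_gt0.
have pos := psumr_mul_gt0 (fun i : 'I_K.+1 => al0 i (ltn_ord i)) D0 als.
have N : 0 <= (s K.+1 * e K.+1 - s K * e K.+2) / 'C(n, K.+2)%:R.
  rewrite mulr_ge0 ?(ltW (Cp _ Kn)) //.
  have := esf_newton x ([set: _] :\ a) K; rewrite -/s !eS => h.
  have -> : s K.+1 * (s K.+1 + x a * s K) - s K * (s K.+2 + x a * s K.+1)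
     = s K.+1 ^+ 2 - s K * s K.+2 by ring.
  by rewrite subr_ge0.
rewrite -(pmulr_lgt0 _ e1).
suff -> : Lval n K.+2 al s * e K.+1 = (s K.+1 * e K.+1 - s K * e K.+2) / 'C(n, K.+2)%:R
   + \sum_(i < K.+1) al i * D i by rewrite ltr_wpDl.
rewrite LvalE big_ord_recr /= mulrBl mulrDl.
have e0 : e 0%N = 1 by rewrite /e esf0.
rewrite big_ord_recl in eqn; rewrite [in RHS]big_ord_recl.
have -> : D ord0 = s K by rewrite /D bin0 divr1.
have -> : \sum_(i < K) al (lift ord0 i) * D (lift ord0 i)
   = s K * (\sum_(i < K) al (lift ord0 i) * e (lift ord0 i) / 'C(n, lift ord0 i)%:R)
     - (\sum_(i < K) al i.+1 * s i / 'C(n, i.+1)%:R) * e K.+1.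
  rewrite mulr_sumr mulr_suml -sumrB; apply: eq_bigr => i _.
  by rewrite /D !lift0; ring.
move: eqn; rewrite e0; set S1 := \sum_(i < K) _; set S2 := \sum_(i < K) _.
rewrite bin0 !divr1 mulr1; set A := _ / 'C(n, K.+2)%:R => eqn.
have -> : (s K.+1 * e K.+1 - s K * e K.+2) / 'C(n, K.+2)%:R
   = s K.+1 / 'C(n, K.+2)%:R * e K.+1 - s K * A by rewrite /A; ring.
by rewrite eqn; ring.
Qed.

Lemma ellipticity n K (al : nat -> R) (X : 'M[C]_n) xi :
  (K.+2 <= n)%N -> X^t* = X -> hgam K.+1 X ->
  (forall l, (l <= K)%N -> 0 <= al l) -> 0 < \sum_(0 <= l < K.+1) al l ->
  hsig X K.+2 / 'C(n, K.+2)%:R = \sum_(0 <= l < K.+2) al l * hsig X l / 'C(n, l)%:R ->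
  xi != 0 -> 0 < Lval n K.+2 al (hsig1 X xi).
Proof.
move=> Kn hX gX al0 als eqn xi0.
have [x [w [es w0 ws ep]]] := hsig1_decomp hX xi0.
have -> : hsig1 X xi = fun j => \sum_a w a * esf x ([set: _] :\ a) j by apply/funext.
rewrite Lval_sum; apply: psumr_mul_gt0 => // a; apply: Lval_esf_gt0 => //.
  by move=> j jK; rewrite -es; apply: gX.
rewrite -es eqn; apply: eq_bigr => l _; by rewrite es.
Qed.

Lemma le_convex_eq (t a b c a' b' c' : R) : a = a' -> b = b' -> c = c' ->
  (1 - t) * a' + t * b' <= c' -> (1 - t) * a + t * b <= c.
Proof. by move=> -> -> ->. Qed.

Lemma convex_le_eq (t a b c a' b' c' : R) : a = a' -> b = b' -> c = c' ->
  c' <= (1 - t) * a' + t * b' -> c <= (1 - t) * a + t * b.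
Proof. by move=> -> -> ->. Qed.

Lemma concave_combination (t x y w S1 S2 S3 a b : R) : 0 <= b ->
  S3 <= (1 - t) * S1 + t * S2 -> (1 - t) * x + t * y <= w ->
  (1 - t) * (b * x - a - S1) + t * (b * y - a - S2) <= b * w - a - S3.
Proof. by move=> b0 hS h; have := ler_wpM2l b0 h; lra. Qed.

Lemma hsig_quot_convex n K (X Y : 'M[C]_n) t i (Z := rc (1 - t) *: X + rc t *: Y) : X^t* = X -> Y^t* = Y -> 0 <= t <= 1 ->
  (i <= K)%N -> hgam K X -> hgam K Y ->
  hsig Z i / hsig Z K <= (1 - t) * (hsig X i / hsig X K) + t * (hsig Y i / hsig Y K).
Proof.
move=> hX hY t01 iK gX gY; have eZ : Z = rc (1 - t) *: X + rc t *: Y by [].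
clearbody Z; have gZ : hgam K Z by rewrite eZ; apply: hgam_convex.
have quot (A : 'M[C]_n) : hgam K A ->
    hsig A i / hsig A K = \prod_(j < K | (i <= j)%N) (hsig A j.+1 / hsig A j)^-1.
  move=> gA; rewrite -[LHS]invf_div; rewrite prodfV; congr (_^-1).
  have -> : \prod_(j < K | (i <= j)%N) (hsig A j.+1 / hsig A j)
          = \prod_(i <= j < K) (hsig A j.+1 / hsig A j).
    by rewrite (big_nat_widenl i 0) //= big_mkord.
  move: iK; rewrite leq_eqVlt => /orP[/eqP->|iK].
    by rewrite big_geq // divff // gt_eqF // gA.
  rewrite telescope_prodf // => j /andP[_ jK].
  by rewrite gt_eqF // gA // ltnW.
apply: (convex_le_eq (quot X gX) (quot Y gY) (quot Z gZ)).
have pos (A : 'M[C]_n) : hgam K A -> forall j : 'I_K, (i <= j)%N -> 0 < hsig A j.+1 / hsig A j.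
  by move=> gA j _; rewrite divr_gt0 // gA // ltnW.
apply: prod_inv_convex => //; [exact: pos|exact: pos|move=> j _].
by rewrite eZ; apply: hsig_quot_concave => //; apply: hgam_le (ltnW (ltn_ord j)) _.
Qed.

(** Compression replaces numerator and denominator by [hsig] of matrices depending linearly on the
    argument, one order lower in the cone, and the factor c cancels. The term of [al K.+1] becomes
    the constant subtracted in [quot]; the other coefficients are nonnegative and multiply convex
    quotients. *)
Lemma Lval_concave n K (al : nat -> R) (X Y : 'M[C]_n) t xi
    (Z := rc (1 - t) *: X + rc t *: Y) :
  (K.+2 <= n)%N -> X^t* = X -> Y^t* = Y -> 0 <= t <= 1 -> hgam K.+1 X -> hgam K.+1 Y ->
  (forall l, (l <= K)%N -> 0 <= al l) -> xi != 0 ->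
  (1 - t) * (Lval n K.+2 al (hsig1 X xi) / hsig1 X xi K)
  + t * (Lval n K.+2 al (hsig1 Y xi) / hsig1 Y xi K)
  <= Lval n K.+2 al (hsig1 Z xi) / hsig1 Z xi K.
Proof.
move: @Z; case: n X Y xi => [|n] X Y xi Z Kn hX hY t01 gX gY al0 xi0.
  by move: xi0; rewrite [xi]thinmx0 eqxx.
have eZ : Z = rc (1 - t) *: X + rc t *: Y by [].
clearbody Z; have hZ : Z^t* = Z by rewrite eZ herm_add // herm_scale.
have gZ : hgam K.+1 Z by rewrite eZ; apply: hgam_convex.
have [c [c0 [f [fh fp flin]]]] := compression xi0.
have gf (A : 'M[C]_n.+1) : A^t* = A -> hgam K.+1 A -> hgam K (f A).
  by move=> hA gA j jK; have := hsig1_gt0 hA xi0 gA jK; rewrite fp pmulr_rgt0.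
have quot (A : 'M[C]_n.+1) : A^t* = A -> hgam K.+1 A ->
    Lval n.+1 K.+2 al (hsig1 A xi) / hsig1 A xi K =
    'C(n.+1, K.+2)%:R^-1 * (hsig (f A) K.+1 / hsig (f A) K) - al K.+1 / 'C(n.+1, K.+1)%:R
    - \sum_(i < K) al i.+1 / 'C(n.+1, i.+1)%:R * (hsig (f A) i / hsig (f A) K).
  move=> hA gA; have p := gf A hA gA K (leqnn _).
  have Cn0 l : (l <= K.+1)%N -> 'C(n.+1, l)%:R != 0 :> R.
    move=> lK; rewrite pnatr_eq0 -lt0n bin_gt0.
    by apply: leq_trans lK _; apply: leq_trans (leqnSn _) Kn.
  rewrite LvalE big_ord_recr /= !fp.
  have -> : \sum_(i < K) al i.+1 * hsig1 A xi i / 'C(n.+1, i.+1)%:R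
     = c * hsig (f A) K * \sum_(i < K) al i.+1 / 'C(n.+1, i.+1)%:R * (hsig (f A) i / hsig (f A) K).
    rewrite mulr_sumr; apply: eq_bigr => i _; rewrite fp; field.
    by rewrite Cn0 ?gt_eqF // ltnS ltnW.
  move: (\sum_(i < K) _) => S; field.
  by rewrite !gt_eqF //= ltr0n bin_gt0 // ltnW.
apply: (le_convex_eq (quot X hX gX) (quot Y hY gY) (quot Z hZ gZ)).
rewrite eZ flin.
have h1 := hsig_quot_concave (fh _ hX) (fh _ hY) t01 (gf _ hX gX) (gf _ hY gY).
have h2 i iK := hsig_quot_convex (fh _ hX) (fh _ hY) t01 (i := i) iK (gf _ hX gX) (gf _ hY gY).
move: (f X) (f Y) h1 h2 => fX fY; move: (rc (1 - t) *: fX + _) => W h1 h2.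
apply: (concave_combination _ _ _ h1); first by rewrite invr_ge0.
rewrite !mulr_sumr -big_split /=; apply: ler_sum => i _.
have a0 : 0 <= al i.+1 / 'C(n.+1, i.+1)%:R by rewrite mulr_ge0 // al0.
apply: le_trans (ler_wpM2l a0 (h2 i (ltnW (ltn_ord i)))) _.
by rewrite mulrDr (mulrCA _ (1 - t)) (mulrCA _ t).
Qed.

End Pointwise.

(** * Exterior algebra *)

Section ExteriorRing.
Variables (R : realType) (n : nat).
Local Notation C := (Cplx R).
Local Notation ext := (extform R n).
Local Notation idx := 'I_(n + n).
Implicit Types (A B S T : {set idx}) (x y z : ext).

Lemma inversionsE A B : inversions A B = (\sum_(a in A) \sum_(b in B) (b < a))%N.
Proof.
rewrite /inversions -sum1_card pair_big_dep /= [LHS]big_mkcond [RHS]big_mkcond /=.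
apply: eq_bigr => -[a b] _.
have -> : ((a, b) \in [set p : idx * idx | [&& p.1 \in A, p.2 \in B & (p.2 < p.1)%N]]%classic)
    = [&& a \in A, b \in B & (b < a)%N] by apply/idP/idP; rewrite in_setE.
by rewrite /=; case: (a \in A); case: (b \in B); case: ltnP.
Qed.

Lemma sumn_setU A B (F : idx -> nat) : [disjoint A & B] ->
  (\sum_(a in (A :|: B)%SET) F a = \sum_(a in A) F a + \sum_(a in B) F a)%N.
Proof.
by move=> d; rewrite -bigU //=; apply: eq_bigl => a; rewrite finset.in_setU.
Qed.

Lemma inversionsUl A B T : [disjoint A & B] ->
  inversions (A :|: B)%SET T = (inversions A T + inversions B T)%N.
Proof. by move=> d; rewrite !inversionsE sumn_setU. Qed.

Lemma inversionsUr A B T : [disjoint A & B] ->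
  inversions T (A :|: B)%SET = (inversions T A + inversions T B)%N.
Proof.
by move=> d; rewrite !inversionsE -big_split /=; apply: eq_bigr => a _; rewrite sumn_setU.
Qed.

Lemma inversionsC A B : [disjoint A & B] ->
  (inversions A B + inversions B A = #|A| * #|B|)%N.
Proof.
move=> d; rewrite !inversionsE [in X in (_ + X)%N]exchange_big -big_split /=.
rewrite -sum_nat_const; apply: eq_bigr => a aA.
rewrite -big_split /= -sum1_card; apply: eq_bigr => b bB.
have : a != b.
  by apply: contraTneq bB => <-; rewrite (disjointFr d aA).
by rewrite -val_eqE /=; case: ltngtP.
Qed.

Lemma setUD_sub A S : A \subset S -> (A :|: (S :\: A))%SET = S.
Proof.
move=> /fintype.subsetP AS; apply/setP => i; rewrite !finset.inE.
by have := AS i; case: (i \in A) => //= ->.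
Qed.

Lemma setUDK A B : [disjoint A & B] -> ((A :|: B) :\: A)%SET = B.
Proof.
move=> d; apply/setP => i; rewrite !finset.inE.
by case: (boolP (i \in A)) => //= /(disjointFr d) ->.
Qed.

Lemma subset_setD A B S : A \subset S ->
  (B \subset (S :\: A)%SET) =
  [&& (A :|: B)%SET \subset S, A \subset (A :|: B)%SET & ((A :|: B) :\: A)%SET == B].
Proof.
move=> AS; rewrite finset.subUset AS finset.subsetUl finset.subsetD /=; congr (_ && _).
apply/idP/eqP => [d|<-]; first by rewrite setUDK // fintype.disjoint_sym.
by rewrite finset.disjoints_subset; apply/fintype.subsetP => i; rewrite !finset.inE => /andP[->].
Qed.

(** A set D between A and S corresponds to B = D minus A inside S minus A, and the signs match
    because inversions are additive in each argument over disjoint unions. *)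
Lemma wedgeA x y z : wedge x (wedge y z) = wedge (wedge x y) z.
Proof.
apply/ffunP => S; rewrite !ffunE.
under [RHS]eq_bigr => D _ do rewrite ffunE mulr_sumr mulr_suml.
rewrite (exchange_big_dep (fun A => A \subset S)) /=; last first.
  by move=> D A DS AD; apply: fintype.subset_trans AD DS.
apply: eq_bigr => A AS; rewrite ffunE mulr_sumr.
rewrite [RHS](reindex_onto (fun B => A :|: B)%SET (fun D => D :\: A)%SET) /=; last first.
  by move=> D /andP[_ AD]; rewrite setUD_sub.
apply: eq_big => [B|B BS]; first by rewrite -andbA subset_setD.
have dAB : [disjoint A & B].
  by rewrite fintype.disjoint_sym; move: BS; rewrite finset.subsetD => /andP[].
have e2 : (S :\: (A :|: B))%SET = (S :\: A :\: B)%SET by rewrite finset.setDDl.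
rewrite setUDK // e2 -{1}(setUD_sub BS) inversionsUl // inversionsUr; last first.
  by rewrite fintype.disjoint_sym finset.disjoints_subset finset.subsetDr.
rewrite !exprD; ring.
Qed.

Lemma wedge1x x : wedge (eone R n) x = x.
Proof.
apply/ffunP => S; rewrite ffunE (bigD1 finset.set0) ?finset.sub0set //= big1 => [|A /andP[_ A0]].
  rewrite ffunE eqxx mulr1 finset.setD0 inversionsE big1 ?expr0 ?mul1r ?addr0 // => a.
  by rewrite finset.inE.
by rewrite ffunE (negbTE A0) mulr0 mul0r.
Qed.

Lemma wedgex1 x : wedge x (eone R n) = x.
Proof.
apply/ffunP => S; rewrite ffunE (bigD1 S) //= big1 => [|A /andP[AS AneS]].
  rewrite ffunE finset.setDv eqxx mulr1 inversionsE big1 ?expr0 ?mul1r ?addr0 // => a _.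
  by rewrite big1 // => b; rewrite finset.inE.
rewrite ffunE finset.setD_eq0; suff /negbTE -> : ~~ (S \subset A) by rewrite mulr0.
by apply: contra AneS => SA; rewrite finset.eqEsubset AS.
Qed.

Lemma wedgeDl x y z : wedge (x + y) z = wedge x z + wedge y z.
Proof.
apply/ffunP => S; rewrite !ffunE -big_split; apply: eq_bigr => A _.
by rewrite ffunE mulrDr mulrDl.
Qed.

Lemma wedgeDr x y z : wedge x (y + z) = wedge x y + wedge x z.
Proof.
by apply/ffunP => S; rewrite !ffunE -big_split; apply: eq_bigr => A _; rewrite ffunE mulrDr.
Qed.

(** Forms of even degree make up a commutative subring containing the scalars and the (1,1)-forms;
    there the binomial theorem and unordered products are available. *)
Definition even_form x := [forall S : {set idx}, odd #|S| ==> (x S == 0)].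

Lemma even_formP x : reflect (forall S : {set idx}, odd #|S| -> x S = 0) (even_form x).
Proof.
by apply: (iffP forallP) => h S; [move/(implyP (h S))/eqP | apply/implyP => /h ->].
Qed.

Lemma wedge_evenC x y : even_form x -> wedge x y = wedge y x.
Proof.
move=> /even_formP ex; apply/ffunP => S; rewrite !ffunE.
rewrite [RHS](reindex_onto (fun A => S :\: A)%SET (fun A => S :\: A)%SET) /=; last first.
  by move=> A AS; rewrite finset.setDDr finset.setDv finset.set0U; apply/finset.setIidPr.
apply: eq_big => [A|A AS].
  rewrite finset.subsetDl /= finset.setDDr finset.setDv finset.set0U.
  by apply/idP/eqP => [/finset.setIidPr|/finset.setIidPr].
have -> : (S :\: (S :\: A))%SET = A.
  by rewrite finset.setDDr finset.setDv finset.set0U; apply/finset.setIidPr.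
have [odA|evA] := boolP (odd #|A|); first by rewrite ex // !(mulr0, mul0r).
have d : [disjoint A & (S :\: A)%SET].
  by rewrite fintype.disjoint_sym finset.disjoints_subset finset.subsetDr.
have -> : (-1) ^+ inversions A (S :\: A)%SET = (-1) ^+ inversions (S :\: A)%SET A :> C.
  have := congr1 odd (inversionsC d); rewrite oddM (negbTE evA) oddD => h.
  by rewrite -[LHS]signr_odd -[RHS]signr_odd; move: h; case: odd; case: odd.
by rewrite mulrAC.
Qed.

Lemma wedge_even x y : even_form x -> even_form y -> even_form (wedge x y).
Proof.
move=> /even_formP ex /even_formP ey; apply/even_formP => S oS; rewrite ffunE big1 // => A AS.
have [odA|evA] := boolP (odd #|A|); first by rewrite ex // mulr0 mul0r.
rewrite (ey (S :\: A)%SET) ?mulr0 // finset.cardsD.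
rewrite (finset.setIidPr AS) oddB ?oS ?(negbTE evA) //.
exact: subset_leq_card.
Qed.

End ExteriorRing.

(** A synonym whose product is the wedge product, kept apart from any coefficientwise product of
    finite functions. *)
Definition ealg (R : realType) n : Type := extform R n.
HB.instance Definition _ R n := GRing.Zmodule.copy (ealg R n) (extform R n).
HB.instance Definition _ R n := GRing.Zmodule_isPzRing.Build (ealg R n)
  (@wedgeA R n) (@wedge1x R n) (@wedgex1 R n) (@wedgeDl R n) (@wedgeDr R n).

Lemma even_form_subring R n : subring_closed (@even_form R n : pred (ealg R n)).
Proof.
split.
- apply/even_formP => S oS; rewrite ffunE; case: eqP oS => // ->.
  by rewrite finset.cards0.
- move=> x y /even_formP ex /even_formP ey; apply/even_formP => S oS.
  by rewrite !ffunE ex // ey // subrr.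
by move=> x y; apply: wedge_even.
Qed.

Record eform (R : realType) n := EForm { eval : ealg R n; _ : even_form eval }.
HB.instance Definition _ R n := [isSub for @eval R n].
HB.instance Definition _ R n := [Choice of eform R n by <:].
HB.instance Definition _ R n :=
  GRing.SubChoice_isSubPzRing.Build (ealg R n) (@even_form R n) (eform R n) (@even_form_subring R n).

Lemma eform_mulC R n : commutative (@GRing.mul (eform R n)).
Proof. by move=> x y; apply: val_inj; rewrite !rmorphM; apply: wedge_evenC; case: x. Qed.
HB.instance Definition _ R n := GRing.PzRing_hasCommutativeMul.Build (eform R n) (@eform_mulC R n).

Lemma evalM R n (x y : eform R n) : eval (x * y) = eval x * eval y.
Proof. exact: (rmorphM val). Qed.
Lemma evalD R n (x y : eform R n) : eval (x + y) = eval x + eval y.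
Proof. exact: (rmorphD val). Qed.
Lemma evalN R n (x : eform R n) : eval (- x) = - eval x.
Proof. exact: (rmorphN val). Qed.
Lemma eval0 R n : eval (0 : eform R n) = 0.
Proof. exact: (rmorph0 val). Qed.
Lemma eval1 R n : eval (1 : eform R n) = eone R n.
Proof. exact: (rmorph1 val). Qed.
Lemma eval_sum R n (I : Type) (r : seq I) (P : pred I) (F : I -> eform R n) :
  eval (\sum_(i <- r | P i) F i) = \sum_(i <- r | P i) eval (F i).
Proof. exact: (rmorph_sum val). Qed.
Lemma eval_inj R n : injective (@eval R n).
Proof. exact: val_inj. Qed.

(** * Monomials, scalars and products of (1,1)-forms *)

Section TopForm.
Variables (R : realType) (n : nat).
Local Notation C := (Cplx R).
Local Notation ext := (extform R n).
Local Notation idx := 'I_(n + n).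
Implicit Types (A B S T : {set idx}).

Definition emono A : ealg R n := [ffun S => (S == A)%:R].

Lemma wedge_monl A (x : ext) S :
  wedge (emono A) x S =
  if A \subset S then (-1) ^+ inversions A (S :\: A)%SET * x (S :\: A)%SET else 0.
Proof.
rewrite ffunE; case: ifP => AS; last first.
  rewrite big1 // => D DS; rewrite ffunE; case: eqP => [DA|_]; last by rewrite mulr0 mul0r.
  by rewrite -DA DS in AS.
rewrite (bigD1 A) //= big1 => [|D /andP[_ DA]]; last by rewrite ffunE (negbTE DA) mulr0 mul0r.
by rewrite ffunE eqxx mulr1 addr0.
Qed.

Lemma wedge_emono A B : [disjoint A & B] ->
  wedge (emono A) (emono B) = escale ((-1) ^+ inversions A B) (emono (A :|: B)%SET).
Proof.
move=> d; apply/ffunP => S; rewrite wedge_monl !ffunE.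
have [->|neS] := eqVneq S (A :|: B)%SET.
  by rewrite finset.subsetUl setUDK // eqxx.
rewrite mulr0; case: ifP => // AS; case: eqP => [e|_]; last by rewrite mulr0.
by case/eqP: neS; rewrite -e setUD_sub.
Qed.

Lemma emono1C i j : emono [set i]%SET * emono [set j]%SET = - (emono [set j]%SET * emono [set i]%SET).
Proof.
have [->|ij] := eqVneq i j.
  suff -> : emono [set j]%SET * emono [set j]%SET = 0 by rewrite oppr0.
  apply/ffunP => S; rewrite -[_ * _]/(wedge _ _) wedge_monl !ffunE.
  case: ifP => // jS; case: eqP => [e|_]; rewrite ?mulr0 //.
  have : j \in (S :\: [set j])%SET by rewrite e finset.in_set1.
  by rewrite !finset.inE eqxx.
have d (a b : idx) : a != b -> [disjoint [set a]%SET & [set b]%SET].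
  by move=> ab; rewrite finset.disjoints1 finset.in_set1.
have ji : j != i by rewrite eq_sym.
rewrite -![_ * _]/(wedge _ _) (wedge_emono (d _ _ ij)) (wedge_emono (d _ _ ji)) finset.setUC.
apply/ffunP => S; rewrite !ffunE -mulNr; congr (_ * _).
have := inversionsC (d _ _ ij); rewrite !finset.cards1 muln1.
by case: inversions => [|[|?]]; case: inversions => [|[|?]] //= _; rewrite ?expr0 ?expr1 ?opprK.
Qed.

Lemma dz_dzbar (a b : 'I_n) :
  wedge (dz R a) (dzbar R b) = emono ([set lshift n a; rshift n b])%SET.
Proof.
have d : [disjoint [set lshift n a]%SET & [set rshift n b]%SET].
  by rewrite finset.disjoints1 finset.in_set1 eq_lrshift.
rewrite -[dz R a]/(emono _) -[dzbar R b]/(emono _) wedge_emono // inversionsE.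
rewrite finset.big_set1 finset.big_set1 /= ltnNge (leq_trans (ltnW (ltn_ord a)) (leq_addr _ _)).
by apply/ffunP => S; rewrite !ffunE expr0 mul1r.
Qed.

Lemma dz_dzbar_even (a b : 'I_n) : even_form (wedge (dz R a) (dzbar R b)).
Proof.
apply/even_formP => S; rewrite dz_dzbar ffunE; case: eqP => // ->.
by rewrite finset.cards2 eq_lrshift.
Qed.

Lemma escale_wedge (c : C) (x : ext) : escale c x = wedge (escale c (eone R n)) x.
Proof.
apply/ffunP => S; rewrite !ffunE (bigD1 finset.set0) ?finset.sub0set //= big1 => [|A /andP[_ A0]].
  by rewrite !ffunE eqxx mulr1 finset.setD0 inversionsE finset.big_set0 expr0 mul1r addr0.
by rewrite !ffunE (negbTE A0) !(mulr0, mul0r).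
Qed.

Lemma escale_even c : even_form (escale c (eone R n)).
Proof.
apply/even_formP => S oS; rewrite !ffunE; case: eqP oS => [->|_]; last by rewrite mulr0.
by rewrite finset.cards0.
Qed.

Definition econst (c : C) : eform R n := EForm (escale_even c).
Definition dzdzbar (a b : 'I_n) : eform R n := EForm (dz_dzbar_even a b).

Lemma econst_additive : additive econst.
Proof.
move=> c d; apply: val_inj; rewrite rmorphB; apply/ffunP => S.
by rewrite !ffunE mulrBl.
Qed.
Lemma econst_multiplicative : multiplicative econst.
Proof.
split=> [c d|]; apply: val_inj; rewrite ?rmorphM ?rmorph1.
  rewrite -[RHS]/(wedge (escale c (eone R n)) (escale d (eone R n))) -escale_wedge.
  by apply/ffunP => S; rewrite !ffunE mulrA.
by apply/ffunP => S; rewrite !ffunE mul1r.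
Qed.
HB.instance Definition _ := GRing.isAdditive.Build C (eform R n) econst econst_additive.
HB.instance Definition _ := GRing.isMultiplicative.Build C (eform R n) econst econst_multiplicative.

Lemma eval_scM c x : eval (econst c * x) = escale c (eval x).
Proof. by rewrite escale_wedge evalM. Qed.

Lemma anticomm4 (x p q r : ealg R n) : p * q = - (q * p) -> r * q = - (q * r) ->
  p * r = - (r * p) -> x * p * (q * r) = - (x * r * (q * p)).
Proof.
move=> pq rq pr; rewrite -!mulrA (mulrA p) pq (mulrA r) rq !mulNr !mulrN opprK -!mulrA.
by rewrite pr !mulrN opprK.
Qed.

Lemma dzdzbar_swap a b c d : dzdzbar a b * dzdzbar c d = - (dzdzbar a d * dzdzbar c b).
Proof.
apply: eval_inj; rewrite evalN !evalM.
exact: (anticomm4 _ (emono1C (rshift n b) (lshift n c)) (emono1C (rshift n d) (lshift n c))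
  (emono1C (rshift n b) (rshift n d))).
Qed.

Lemma eform_neg_eq0 (x : eform R n) : x = - x -> x = 0.
Proof.
move=> /eqP; rewrite -addr_eq0 => /eqP h.
have : econst (2^-1) * (econst 2 * x) = 0.
  suff -> : econst 2 * x = 0 by rewrite mulr0.
  by rewrite rmorphMn rmorph1 mulr_natl mulr2n h.
by rewrite mulrA -rmorphM mulVf ?pnatr_eq0 // rmorph1 mul1r.
Qed.

Lemma dzdzbar_row a b c : dzdzbar a b * dzdzbar a c = 0.
Proof. by apply: eform_neg_eq0; rewrite {1}dzdzbar_swap mulrC. Qed.

(** All terms of this row contain dz_a, so it squares to zero, and the n-th power of the sum of the
    n rows is n! times their product. *)
Definition rho (H : 'M[C]_n) a : eform R n := \sum_b econst (H a b) * dzdzbar a b.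
Definition eF (H : 'M[C]_n) : eform R n := econst ('i / 2) * \sum_a rho H a.

Lemma eval_eF H : eval (eF H) = form11 H.
Proof.
rewrite eval_scM; congr escale; rewrite eval_sum.
apply: eq_bigr => a _; rewrite eval_sum; apply: eq_bigr => b _.
exact: eval_scM.
Qed.

Lemma eval_eF_exp H p : eval (eF H ^+ p) = wpow (form11 H) p.
Proof.
elim: p => [|p IH]; first by rewrite expr0 eval1.
by rewrite exprS evalM eval_eF IH.
Qed.

Lemma eF_add H K : eF (H + K) = eF H + eF K.
Proof.
rewrite /eF -mulrDr -big_split; congr (_ * _); apply: eq_bigr => a _.
rewrite -big_split; apply: eq_bigr => b _.
by rewrite mxE rmorphD mulrDl.
Qed.

Lemma eF_scale c H : eF (c *: H) = econst c * eF H.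
Proof.
rewrite /eF mulrCA; congr (_ * _); rewrite mulr_sumr; apply: eq_bigr => a _.
by rewrite mulr_sumr; apply: eq_bigr => b _; rewrite mxE rmorphM mulrA.
Qed.

Lemma rho_sqr H a : rho H a * rho H a = 0.
Proof.
rewrite /rho mulr_suml big1 // => b _; rewrite mulr_sumr big1 // => c _.
by rewrite mulrACA dzdzbar_row mulr0.
Qed.

Lemma expr_sqr0D (x y : eform R n) m : x * x = 0 ->
  (x + y) ^+ m.+1 = y ^+ m.+1 + x * y ^+ m *+ m.+1.
Proof.
move=> xx; elim: m => [|m IH]; first by rewrite !expr1 expr0 mulr1 addrC.
rewrite exprS IH mulrDl !mulrDr !mulrnAr [x * (x * _)]mulrA xx mul0r mul0rn addr0.
by rewrite (mulrCA y x) -!exprS [in RHS]mulrS addrCA.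
Qed.

Lemma sum_sqr0_exp (I : Type) (f : I -> eform R n) (s : seq I) :
  (forall i, f i * f i = 0) ->
  (\sum_(i <- s) f i) ^+ size s = (\prod_(i <- s) f i) *+ (size s)`! /\
  (\sum_(i <- s) f i) ^+ (size s).+1 = 0.
Proof.
move=> f0; elim: s => [|a s [IH1 IH2]]; first by rewrite !big_nil expr0 expr1.
rewrite !big_cons /= !expr_sqr0D // IH2 add0r; split.
  by rewrite IH1 mulrnAr -mulrnA factS mulnC.
by rewrite exprSr IH2 mul0r mulr0 mul0rn addr0.
Qed.

Definition dzdzbar_prod (phi : 'I_n -> 'I_n) : eform R n := \prod_a dzdzbar a (phi a).

Lemma dzdzbar_prod_tperm phi i j : i != j -> dzdzbar_prod (phi \o tperm i j) = - dzdzbar_prod phi.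
Proof.
move=> ij; rewrite /dzdzbar_prod (bigD1 i) //= (bigD1 j) /=; last by rewrite eq_sym.
rewrite [in RHS](bigD1 i) //= [in RHS](bigD1 j) /=; last by rewrite eq_sym.
rewrite tpermL tpermR !mulrA dzdzbar_swap mulNr; congr (- (_ * _)).
apply: eq_bigr => a /andP[ai aj]; rewrite tpermD // eq_sym //.
Qed.

Lemma dzdzbar_prod_perm (s : 'S_n) : dzdzbar_prod s = econst ((-1) ^+ s) * dzdzbar_prod id.
Proof.
have [ts -> /allP h] := prod_tpermP s; elim: ts h => [|t ts IH] h.
  rewrite big_nil odd_perm1 expr0 rmorph1 mul1r.
  by apply: eq_bigr => a _; rewrite perm1.
have td : t.1 != t.2 by apply: h; rewrite inE eqxx.
rewrite big_cons odd_permM odd_tperm td signr_addb expr1 mulN1r rmorphN mulNr.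
rewrite -IH => [|u us]; last by apply: h; rewrite inE us orbT.
rewrite -(dzdzbar_prod_tperm _ td); apply: eq_bigr => a _ /=.
by rewrite permM.
Qed.

Lemma dzdzbar_prod_noninj phi : ~ injective phi -> dzdzbar_prod phi = 0.
Proof.
move=> /injectiveP; case/boolP: (injectiveb phi) => // /injectivePn[i [j ij e]] _.
apply: eform_neg_eq0; rewrite -(dzdzbar_prod_tperm _ ij); apply: eq_bigr => a _ /=.
by case: tpermP => [->|->|] //; rewrite e.
Qed.

(** Distributing the product gives one term for each map from rows to columns. A map that is not
    injective repeats some dzbar_b and contributes nothing, a permutation contributes its sign: this
    is the Leibniz formula. *)
Lemma prod_rho H : \prod_a rho H a = econst (\det H) * dzdzbar_prod id.
Proof.
rewrite /rho bigA_distr_bigA /= /determinant rmorph_sum mulr_suml.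
rewrite (bigID (fun f : {ffun 'I_n -> 'I_n} => injectiveb f)) /= [X in _ + X]big1 ?addr0; last first.
  move=> f /injectiveP nf; rewrite big_split /=.
  by rewrite -/(dzdzbar_prod f) dzdzbar_prod_noninj ?mulr0.
rewrite (reindex (@pval _)) /=; last first.
  pose in_Sn := insubd (1%g : 'S_n).
  by exists in_Sn => /= f Uf; first apply: val_inj; apply: insubdK.
apply: eq_big => [s|s _]; first by rewrite (valP s).
rewrite big_split /= rmorphM rmorph_prod [RHS]mulrAC -dzdzbar_prod_perm [RHS]mulrC.
by congr (_ * _); apply: eq_bigr => a _; rewrite pvalE.
Qed.

End TopForm.

Lemma poly_eq_horner (F : numFieldType) (p q : {poly F}) :
  (forall s, p.[s] = q.[s]) -> p = q.
Proof.
move=> h; apply/eqP; rewrite -subr_eq0; apply/eqP.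
apply: (@roots_geq_poly_eq0 _ _ [seq i%:R | i <- iota 0 (size (p - q))]).
- by apply/allP => x /mapP[i _ ->]; rewrite /root hornerD hornerN h subrr.
- by rewrite map_inj_uniq ?iota_uniq // => i j /eqP; rewrite eqr_nat => /eqP.
by rewrite size_map size_iota.
Qed.

(** * Top coefficients as determinants *)

Section Top.
Variables (R : realType) (n : nat).
Local Notation C := (Cplx R).
Local Notation idx := 'I_(n + n).

Definition top (x : eform R n) : C := eval x [set: idx]%SET.

Lemma topD x y : top (x + y) = top x + top y.
Proof. by rewrite /top evalD ffunE. Qed.

Lemma topMn x m : top (x *+ m) = top x *+ m.
Proof.
elim: m => [|m IH]; first by rewrite !mulr0n /top eval0 ffunE.
by rewrite !mulrS topD IH.
Qed.

Lemma top_sum (I : Type) (r : seq I) (P : pred I) (F : I -> eform R n) :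
  top (\sum_(i <- r | P i) F i) = \sum_(i <- r | P i) top (F i).
Proof.
elim/big_rec2: _ => [|i a b _ <-]; first by rewrite /top eval0 ffunE.
exact: topD.
Qed.

Lemma top_scM c x : top (econst n c * x) = c * top x.
Proof. by rewrite /top eval_scM ffunE. Qed.

Lemma prod_dzdzbar_emono (s : seq 'I_n) : uniq s ->
  exists2 e : C, e != 0 &
    eval (\prod_(a <- s) dzdzbar R a a) =
    escale e (emono R (\bigcup_(a <- s) [set lshift n a; rshift n a])%SET).
Proof.
elim: s => [_|a s IH /andP[nas /IH[e e0 eq]]].
  exists 1; rewrite ?oner_eq0 // !big_nil eval1.
  by apply/ffunP => S; rewrite !ffunE mul1r.
set B := (\bigcup_(b <- s) _)%SET in eq.
have d : [disjoint [set lshift n a; rshift n a]%SET & B].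
  rewrite finset.disjoints_subset; apply/fintype.subsetP => i ia; rewrite finset.in_setC.
  apply: contra nas; rewrite /B finset.bigcup_seq => /finset.bigcupP[b bs].
  move: ia; rewrite !finset.in_set2 => /orP[]/eqP->; rewrite ?eq_lshift ?eq_rshift ?eq_lrshift ?eq_rlshift.
    by rewrite orbF => /eqP->.
  by move=> /= /eqP->.
exists ((-1) ^+ inversions [set lshift n a; rshift n a]%SET B * e).
  by rewrite mulf_neq0 // signr_eq0.
have wesc (x : extform R n) y : wedge x (escale e y) = escale e (wedge x y).
  rewrite (escale_wedge e y) (escale_wedge e (wedge x y)) !wedgeA; congr wedge.
  by rewrite [RHS]wedge_evenC // escale_even.
rewrite !big_cons evalM eq -[LHS]/(wedge (wedge (dz R a) (dzbar R a)) _) dz_dzbar.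
rewrite wesc wedge_emono // -/B.
by apply/ffunP => S; rewrite !ffunE mulrA [e * _]mulrC.
Qed.

Lemma top_dzdzbar_prod_id : top (dzdzbar_prod R (@id 'I_n)) != 0.
Proof.
have [e e0 eq] := prod_dzdzbar_emono (index_enum_uniq 'I_n).
rewrite /top /dzdzbar_prod eq !ffunE.
have -> : (\bigcup_(a : 'I_n) [set lshift n a; rshift n a])%SET = [set: idx]%SET.
  apply/setP => i; rewrite finset.in_setT; apply/finset.bigcupP.
  by case: (split_ordP i) => a ->; exists a => //; rewrite finset.in_set2 eqxx ?orbT.
by rewrite eqxx mulr1.
Qed.

(** The normalisation of the volume form. Only its being nonzero matters, since it cancels in every
    [over_volume]; the sign from reordering the monomials is therefore left unevaluated. *)
Definition kappa : C := ('i / 2) ^+ n * n`!%:R * top (dzdzbar_prod R (@id 'I_n)).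

Lemma kappa_neq0 : kappa != 0.
Proof.
rewrite !mulf_neq0 ?top_dzdzbar_prod_id ?expf_neq0 ?pnatr_eq0 -?lt0n ?fact_gt0 //.
by rewrite mulf_neq0 ?neq0Ci // invr_eq0 pnatr_eq0.
Qed.

Lemma top_eF_exp H : top (eF H ^+ n) = kappa * \det H.
Proof.
rewrite /eF exprMn -rmorphXn top_scM.
have [e _] := sum_sqr0_exp (index_enum 'I_n) (rho_sqr H).
have sz : size (index_enum 'I_n) = n by rewrite /index_enum -enumT size_enum_ord.
rewrite sz in e; rewrite e prod_rho topMn top_scM /kappa -mulr_natl; ring.
Qed.

(** A rank-one (1,1)-form is a product of two 1-forms, and its square contains the factor built from
    t twice. In coordinates the double sum over the dzbar indices is antisymmetric. *)
Lemma eF_rank1_sqr0 (s t : 'rV[C]_n) : eF (s^T *m t) * eF (s^T *m t) = 0.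
Proof.
pose tau a : eform R n := \sum_b econst n (t 0 b) * dzdzbar R a b.
have alt (u : 'I_n -> 'I_n -> eform R n) : (forall b d, u b d = - u d b) ->
    \sum_b \sum_d u b d = 0.
  move=> h; apply: eform_neg_eq0; rewrite {1}exchange_big -sumrN; apply: eq_bigr => b _.
  by rewrite -sumrN; apply: eq_bigr => d _; exact: h.
have tt a c : tau a * tau c = 0.
  rewrite /tau mulr_suml -[RHS](alt (fun b d => (econst n (t 0 b) * dzdzbar R a b) * (econst n (t 0 d) * dzdzbar R c d))).
    by apply: eq_bigr => b _; rewrite mulr_sumr.
  move=> b d; rewrite mulrACA dzdzbar_swap mulrN; congr (- _).
  by rewrite [RHS]mulrACA; congr (_ * _); exact: mulrC.
have e : eF (s^T *m t) = econst n ('i / 2) * \sum_a econst n (s 0 a) * tau a.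
  congr (_ * _); apply: eq_bigr => a _; rewrite /rho /tau mulr_sumr.
  by apply: eq_bigr => b _; rewrite mxE big_ord1 mxE rmorphM mulrA.
rewrite e mulrACA [X in _ * X]mulr_suml [X in _ * X]big1 ?mulr0 // => a _.
by rewrite mulr_sumr big1 // => c _; rewrite mulrACA tt mulr0.
Qed.

Lemma top_eF_rank1 H (s t : 'rV[C]_n) : (0 < n)%N ->
  n%:R * top (eF H ^+ n.-1 * eF (s^T *m t)) = kappa * (\det (H + s^T *m t) - \det H).
Proof.
move=> n0; rewrite mulrBr -!top_eF_exp eF_add [eF H + _]addrC.
have := expr_sqr0D (eF H) n.-1 (eF_rank1_sqr0 s t); rewrite prednK // => ->.
by rewrite topD addrAC subrr add0r topMn mulr_natl mulrC.
Qed.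

Definition detpoly (W X : 'M[C]_n) : {poly C} :=
  \det (map_mx polyC W + 'X *: map_mx polyC X).

Lemma horner_detpoly (W X : 'M[C]_n) s : (detpoly W X).[s] = \det (W + s *: X).
Proof.
rewrite -horner_evalE -det_map_mx; congr (\det _); apply/matrixP => i j.
by rewrite !mxE /= !horner_evalE hornerD hornerM hornerX !hornerC.
Qed.

Lemma coef_sumX (m : nat) (f : nat -> C) j :
  (j <= m)%N -> (\sum_(i < m.+1) f i *: 'X^i)`_j = f j.
Proof. by move=> jm; rewrite -(poly_def _ f) coef_poly ltnS jm. Qed.

Lemma horner_sumX (m : nat) (f : nat -> C) s :
  (\sum_(i < m.+1) f i *: 'X^i).[s] = \sum_(i < m.+1) f i * s ^+ i.
Proof. by rewrite horner_sum; apply: eq_bigr => i _; rewrite hornerZ hornerXn. Qed.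

Lemma eF_expand (W X : 'M[C]_n) s m (z : eform R n) :
  top (eF (W + s *: X) ^+ m * z)
  = \sum_(i < m.+1) ('C(m, i)%:R * top (eF X ^+ i * eF W ^+ (m - i) * z)) * s ^+ i.
Proof.
rewrite eF_add eF_scale exprDn mulr_suml top_sum; apply: eq_bigr => i _.
have -> : (eF W ^+ (m - i) * (econst n s * eF X) ^+ i) *+ 'C(m, i) * z
    = econst n (s ^+ i) * (eF X ^+ i * eF W ^+ (m - i) * z) *+ 'C(m, i).
  move: (eF W) (eF X) => w x.
  rewrite exprMn -rmorphXn mulrnAl; congr (_ *+ _); rewrite -!mulrA.
  by rewrite [LHS]mulrCA [w ^+ _ * (_ * _)]mulrCA.
by rewrite topMn top_scM -[LHS]mulr_natl mulrCA mulrC.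
Qed.

(** Both sides are the coefficient of s^j in the top power of the form of W + s X, expanded once by
    the binomial theorem and once as a determinant. *)
Lemma top_mixed W X j : (j <= n)%N ->
  'C(n, j)%:R * top (eF X ^+ j * eF W ^+ (n - j)) = kappa * (detpoly W X)`_j.
Proof.
move=> jn; rewrite -coefZ.
have -> : kappa *: detpoly W X
    = \sum_(i < n.+1) ('C(n, i)%:R * top (eF X ^+ i * eF W ^+ (n - i))) *: 'X^i.
  apply: poly_eq_horner => s; rewrite hornerZ horner_detpoly -top_eF_exp.
  rewrite (horner_sumX _ (fun i => 'C(n, i)%:R * top (eF X ^+ i * eF W ^+ (n - i)))).
  rewrite -[eF _ ^+ n]mulr1 eF_expand; apply: eq_bigr => i _; by rewrite mulr1.
by rewrite (coef_sumX (fun i => 'C(n, i)%:R * top (eF X ^+ i * eF W ^+ (n - i)))).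
Qed.

(** The same comparison of coefficients, with the determinant replaced by its increment under a
    rank-one matrix: as the rank-one form squares to zero, the increment of the n-th power is linear
    in it. *)
Lemma top_mixed_rank1 W X (s t : 'rV[C]_n) j : (0 < n)%N -> (j <= n.-1)%N ->
  n%:R * 'C(n.-1, j)%:R * top (eF X ^+ j * eF W ^+ (n.-1 - j) * eF (s^T *m t))
  = kappa * (detpoly (W + s^T *m t) X - detpoly W X)`_j.
Proof.
move=> n0 jn; rewrite -coefZ -mulrA.
have -> : kappa *: (detpoly (W + s^T *m t) X - detpoly W X)
    = \sum_(i < n.-1.+1) (n%:R * ('C(n.-1, i)%:R *
        top (eF X ^+ i * eF W ^+ (n.-1 - i) * eF (s^T *m t)))) *: 'X^i.
  apply: poly_eq_horner => c; rewrite hornerZ hornerD hornerN !horner_detpoly.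
  rewrite (horner_sumX _ (fun i => n%:R * ('C(n.-1, i)%:R *
        top (eF X ^+ i * eF W ^+ (n.-1 - i) * eF (s^T *m t))))).
  rewrite addrAC -top_eF_rank1 // eF_expand mulr_sumr.
  by apply: eq_bigr => i _; rewrite mulrA.
by rewrite (coef_sumX (fun i => n%:R * ('C(n.-1, i)%:R *
        top (eF X ^+ i * eF W ^+ (n.-1 - i) * eF (s^T *m t))))).
Qed.

Lemma eval_top x : eval x [set: idx]%SET = top x. Proof. by []. Qed.

Lemma mixed_eval (X W : 'M[C]_n) p q : mixed X W p q = eval (eF X ^+ p * eF W ^+ q).
Proof. by rewrite evalM !eval_eF_exp. Qed.

Lemma wedge_mixed_eval (X W E : 'M[C]_n) p q :
  wedge (mixed X W p q) (form11 E) = eval (eF X ^+ p * eF W ^+ q * eF E).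
Proof. by rewrite evalM -mixed_eval eval_eF. Qed.

Lemma over_volume_eval (W : 'M[C]_n) x : over_volume W (eval x) = top x / (kappa * \det W).
Proof. by rewrite /over_volume -eval_eF_exp !eval_top top_eF_exp. Qed.

Section Frame.
Variables (W G : 'M[C]_n).
Hypothesis GW : G *m W *m G^t* = 1%:M.

Lemma det_frame : \det G * \det W * \det (G^t* ) = 1.
Proof. by rewrite -!det_mulmx GW det1. Qed.

Lemma det_frame_neq0 : \det W != 0.
Proof.
by apply: contra_eq_neq det_frame => ->; rewrite mulr0 mul0r eq_sym oner_eq0.
Qed.

Lemma det_frame_mul (A : 'M[{poly C}]_n) :
  \det A = \det W *: \det (map_mx polyC G *m A *m map_mx polyC (G^t* )).
Proof.
have dC (M : 'M[C]_n) : \det (map_mx polyC M) = (\det M)%:P by exact: det_map_mx.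
rewrite !det_mulmx !dC -mul_polyC.
have : (\det G)%:P * (\det W)%:P * (\det (G^t* ))%:P = 1 :> {poly C}.
  by rewrite -!polyCM det_frame.
move: (\det A) (\det G)%:P (\det W)%:P (\det (G^t* ))%:P => a g w h e.
by rewrite -[LHS]mul1r -e; ring.
Qed.

Lemma frame_pencil X :
  map_mx polyC G *m (map_mx polyC W + 'X *: map_mx polyC X) *m map_mx polyC (G^t* )
  = pencil (G *m X *m G^t*).
Proof.
by rewrite mulmxDr mulmxDl -!map_mxM GW map_mx1 -scalemxAr -scalemxAl -!map_mxM.
Qed.

Lemma detpoly_frame X : detpoly W X = \det W *: pencil_det (G *m X *m G^t*).
Proof. by rewrite /detpoly det_frame_mul frame_pencil. Qed.

Lemma detpoly_frame_rank1 X xi :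
  detpoly (W + xi^T *m map_mx Num.conj xi) X - detpoly W X
  = \det W *: pencil_adj (G *m X *m G^t*) (xi *m G^T).
Proof.
apply/eqP; rewrite subr_eq detpoly_frame -scalerDr [pencil_adj _ _ + _]addrC -det_pencil_rank1; apply/eqP.
rewrite /detpoly det_frame_mul map_mxD addrAC mulmxDr mulmxDl frame_pencil.
congr (_ *: \det (_ + _)).
by rewrite -!map_mxM trmx_mul trmxK (map_mxM Num.conj) !mulmxA.
Qed.

Lemma over_volume_mixed X j : (j <= n)%N ->
  over_volume W (mixed X W j (n - j)) = (pencil_det (G *m X *m G^t*))`_j / 'C(n, j)%:R.
Proof.
move=> jn; rewrite mixed_eval over_volume_eval.
have := top_mixed W X jn; rewrite detpoly_frame coefZ.
have C0 : 'C(n, j)%:R != 0 :> C by rewrite pnatr_eq0 -lt0n bin_gt0.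
have := kappa_neq0; have := det_frame_neq0.
move: (top _) (pencil_det _)`_j (\det W) kappa ('C(n, j)%:R) C0 => t c d k b b0 d0 k0 e.
have -> : t = k * (d * c) / b by rewrite -e mulrC mulKf.
by field; rewrite b0 d0 k0.
Qed.

Lemma over_volume_sqr10 X xi j : (j <= n.-1)%N -> (0 < n)%N ->
  over_volume W (wedge (mixed X W j (n.-1 - j)) (sqr10 xi))
  = (pencil_adj (G *m X *m G^t*) (xi *m G^T))`_j / (n%:R * 'C(n.-1, j)%:R).
Proof.
move=> jn n0; rewrite wedge_mixed_eval over_volume_eval.
have := top_mixed_rank1 W X xi (map_mx Num.conj xi) n0 jn.
rewrite detpoly_frame_rank1 coefZ.
have C0 : n%:R * 'C(n.-1, j)%:R != 0 :> C.
  by rewrite mulf_neq0 // pnatr_eq0 -lt0n // bin_gt0.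
have := kappa_neq0; have := det_frame_neq0.
move: (top _) (pencil_adj _ _)`_j (\det W) kappa (n%:R * _) C0 => t c d k b b0 d0 k0 e.
have -> : t = k * (d * c) / b by rewrite -e mulrC mulKf.
by field; rewrite b0 d0 k0.
Qed.

End Frame.

Lemma frame_exists (W : 'M[C]_n) : W^t* = W ->
  (forall v : 'rV[C]_n, v != 0 -> 0 < (v *m W *m v^t*) 0 0) ->
  exists2 G : 'M[C]_n, G *m W *m G^t* = 1%:M & G \in unitmx.
Proof.
move=> hW pos; have [U hU [l e]] := spectral_herm hW.
have lp i : 0 < l i.
  have d0 : 'e_i *m U != 0 :> 'rV[C]_n.
    apply/eqP => z; have := congr1 (mulmx^~ (U^t* )) z.
    rewrite -mulmxA (unitarymxP hU) mulmx1 mul0mx => /rowP/(_ i); rewrite !mxE !eqxx => /eqP.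
    by rewrite oner_eq0.
  have := pos _ d0; rewrite trmx_mul map_mxM !mulmxA -[_ *m U *m W]mulmxA.
  rewrite -[_ *m (U *m W) *m _]mulmxA e -rowE.
  by rewrite mxE (bigD1 i) //= big1 ?addr0 => [|k ki]; rewrite !mxE ?eqxx ?(negbTE ki) //= ?rmorph0 ?mulr0 // ?mulr1n ?rmorph1 mulr1 rc_gt0.
pose D : 'M[C]_n := diag_mx (\row_i rc (Num.sqrt (l i))^-1).
have hD : D^t* = D.
  rewrite /D tr_diag_mx map_diag_mx; congr diag_mx.
  by apply/rowP => i; rewrite !mxE /= conj_rc.
have GW : (D *m U) *m W *m (D *m U)^t* = 1%:M.
  rewrite trmx_mul map_mxM hD !mulmxA -[D *m U *m W]mulmxA -[D *m (U *m W) *m _]mulmxA e.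
  rewrite /D !mulmx_diag -diag_const_mx; congr diag_mx; apply/rowP => i; rewrite !mxE.
  rewrite -!rmorphM -(rmorph1 (@rc R)); congr rc.
  rewrite -{2}[l i]sqr_sqrtr ?ltW // expr2.
  by field; rewrite gt_eqF // sqrtr_gt0.
exists (D *m U) => //; rewrite -mulmxA in GW.
by have [] := mulmx1_unit GW.
Qed.

End Top.

(** * Pointwise inequalities of forms *)

Section OverVolume.
Variables (R : realType) (n : nat).
Local Notation C := (Cplx R).
Implicit Types (W X : 'M[C]_n) (eta theta : extform R n).

Lemma over_volumeB W eta theta :
  over_volume W (eta - theta) = over_volume W eta - over_volume W theta.
Proof. by rewrite /over_volume !ffunE mulrBl. Qed.

Lemma over_volume0 W : over_volume W 0 = 0.
Proof. by rewrite /over_volume ffunE mul0r. Qed.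

Lemma over_volumeD W eta theta :
  over_volume W (eta + theta) = over_volume W eta + over_volume W theta.
Proof. by rewrite /over_volume !ffunE mulrDl. Qed.

Lemma over_volume_sum W (I : Type) (r : seq I) (P : pred I) (F : I -> extform R n) :
  over_volume W (\sum_(i <- r | P i) F i) = \sum_(i <- r | P i) over_volume W (F i).
Proof. by apply: (big_morph _ (over_volumeD W) (over_volume0 W)). Qed.

Lemma over_volumeZ W c eta : over_volume W (escale c eta) = c * over_volume W eta.
Proof. by rewrite /over_volume !ffunE mulrA. Qed.

Lemma wedgeBl (x y z : extform R n) : wedge (x - y) z = wedge x z - wedge y z.
Proof. exact: (mulrBl (z : ealg R n)). Qed.

Lemma wedge_suml (I : Type) (r : seq I) (P : pred I) (F : I -> extform R n) z :
  wedge (\sum_(i <- r | P i) F i) z = \sum_(i <- r | P i) wedge (F i) z.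
Proof. exact: (mulr_suml (R := ealg R n)). Qed.

Lemma wedgeZl c (x z : extform R n) : wedge (escale c x) z = escale c (wedge x z).
Proof. by rewrite escale_wedge [RHS]escale_wedge wedgeA. Qed.

End OverVolume.

Definition posdef (R : realType) n (W : 'M[Cplx R]_n) :=
  forall v : 'rV[Cplx R]_n, v != 0 -> 0 < (v *m W *m v^t*) 0 0.

Definition pt_Gamma (R : realType) n m (W X : 'M[Cplx R]_n) :=
  forall j, (1 <= j <= m)%N -> 0 < sigma j W X.

(** * Mixed forms read in a frame *)

Section Frame.
Variables (R : realType) (n : nat).
Local Notation C := (Cplx R).
Variables (W G : 'M[C]_n).
Hypothesis GW : G *m W *m G^t* = 1%:M.
Hypothesis n0 : (0 < n)%N.
Local Notation fr X := (G *m X *m G^t*).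

Lemma frame_herm (X : 'M[C]_n) : X^t* = X -> (fr X)^t* = fr X.
Proof. by move=> hX; rewrite !trmx_mul !map_mxM /= trmxCK hX !mulmxA. Qed.

Lemma frame_lin (s t : C) (X Y : 'M[C]_n) :
  fr (s *: X + t *: Y) = s *: fr X + t *: fr Y.
Proof. by rewrite mulmxDr mulmxDl -!scalemxAr -!scalemxAl. Qed.

Lemma frame_unit : G \in unitmx.
Proof. by have := GW; rewrite -mulmxA => /mulmx1_unit[]. Qed.

Lemma frame_xi_neq0 (xi : 'rV[C]_n) : xi != 0 -> xi *m G^T != 0.
Proof.
apply: contra => /eqP e; rewrite -[xi]mulmx1.
have h : G^T \in unitmx by rewrite unitmx_tr frame_unit.
by rewrite -(mulmxV h) mulmxA e mul0mx.
Qed.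

Lemma sigma_frame (X : 'M[C]_n) j : X^t* = X -> (j <= n)%N ->
  sigma j W X = rc (hsig (fr X) j).
Proof.
move=> hX jn; rewrite /sigma (over_volume_mixed GW) // hsigE ?frame_herm //.
by rewrite mulrC divfK // pnatr_eq0 -lt0n bin_gt0.
Qed.

Lemma over_volume_mixed_hsig (X : 'M[C]_n) j : X^t* = X -> (j <= n)%N ->
  over_volume W (mixed X W j (n - j)) = rc (hsig (fr X) j / 'C(n, j)%:R).
Proof.
move=> hX jn; rewrite (over_volume_mixed GW) // hsigE ?frame_herm //.
by rewrite rmorphM fmorphV rmorph_nat.
Qed.

Lemma pt_GammaP (X : 'M[C]_n) m : X^t* = X -> (m <= n)%N ->
  pt_Gamma m W X <-> hgam m (fr X).
Proof.
move=> hX mn; split=> h [|j] jm; first by rewrite hsig0.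
- have := h j.+1; rewrite sigma_frame ?rc_gt0; last exact: leq_trans mn.
  + by apply.
  + by [].
- by [].
rewrite sigma_frame ?rc_gt0 //; first by apply: h; case/andP: jm.
by apply: leq_trans mn; case/andP: jm.
Qed.

Lemma over_volume_sqr10_hsig1 (X : 'M[C]_n) xi j : X^t* = X -> (j <= n.-1)%N ->
  over_volume W (wedge (mixed X W j (n.-1 - j)) (sqr10 xi))
  = rc (hsig1 (fr X) (xi *m G^T) j / (n%:R * 'C(n.-1, j)%:R)).
Proof.
move=> hX jn; rewrite (over_volume_sqr10 GW) // hsig1E ?frame_herm //.
by rewrite rmorphM fmorphV rmorphM !rmorph_nat.
Qed.

Lemma over_volume_cone (X : 'M[C]_n) (a : nat -> R) k xi : X^t* = X -> (1 < k <= n)%N ->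
  over_volume W (wedge (cone_form k a W X) (sqr10 xi))
  = rc (Lval n k a (hsig1 (fr X) (xi *m G^T))).
Proof.
move=> hX /andP[k1 kn].
have binE l : (0 < l <= n)%N ->
    l%:R / (n%:R * 'C(n.-1, l.-1)%:R) = 'C(n, l)%:R^-1 :> R.
  case: l => // l /andP[_ ln]; have := mul_bin_diag n l => /(congr1 (fun m => m%:R : R)).
  rewrite !natrM /= => ->; rewrite invfM mulrA divff ?mul1r // pnatr_eq0 //.
have e l : (0 < l <= n)%N -> (n - l = n.-1 - l.-1)%N by lia.
rewrite /cone_form wedgeBl wedge_suml over_volumeB over_volume_sum wedgeZl over_volumeZ.
rewrite e ?(ltnW k1) // over_volume_sqr10_hsig1 //; last by rewrite -!subn1 leq_sub2r.
rewrite /Lval rmorphB /= rmorph_sum; congr (_ - _).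
  rewrite -(rmorph_nat (@rc R)) -rmorphM; congr rc.
  by rewrite -(binE k) ?(ltnW k1) // mulrA [k%:R * _]mulrC -mulrA.
rewrite !big_nat; apply: eq_bigr => l /andP[l1 lk].
have ln : (0 < l <= n)%N by rewrite l1 (leq_trans (ltnW lk) kn).
rewrite wedgeZl over_volumeZ e // over_volume_sqr10_hsig1 //; last by lia.
rewrite -(rmorph_nat (@rc R)) -!(rmorphM (@rc R)); congr rc.
by rewrite -(binE l) //; move: (_^-1) (hsig1 _ _ _) (l%:R) => d p c; ring.
Qed.

End Frame.

(** The endpoint A carries the constant c, while B contributes a positive quotient with weight t. At
    t = 1, where the bound is zero, strictness comes from B alone. *)
Lemma convex_quot_gt (R : realFieldType) (c d t LA LB LZ pA pB pZ : R) :
  0 <= t <= 1 -> 0 < d -> 0 < pA -> 0 < pB -> 0 < pZ ->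
  c * (pA / d) < LA -> 0 < LB ->
  (1 - t) * (LA / pA) + t * (LB / pB) <= LZ / pZ -> c * (1 - t) * (pZ / d) < LZ.
Proof.
move=> /andP[t0 t1] d0 pA0 pB0 pZ0 cA cB h.
have {}h : c / d * (1 - t) < LZ / pZ.
  apply: lt_le_trans h.
  have hA1 : c / d < LA / pA by rewrite ltr_pdivlMr // mulrAC -mulrA.
  have hB1 : 0 < LB / pB by rewrite divr_gt0.
  move: (c / d) (LA / pA) (LB / pB) hA1 hB1 => x a b xa b0.
  have [->|t1'] := eqVneq t 1; first by lra.
  have : 0 < 1 - t by rewrite subr_gt0 lt_neqAle t1'.
  by move=> s0; nra.
move: h; rewrite ltr_pdivlMr // => h; apply: le_lt_trans h.
by rewrite le_eqVlt; apply/orP; left; apply/eqP; ring.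
Qed.

Section PointwiseForms.
Variables (R : realType) (n : nat).
Local Notation C := (Cplx R).
Variables (W G : 'M[C]_n).
Hypothesis GW : G *m W *m G^t* = 1%:M.
Hypothesis n0 : (0 < n)%N.
Hypothesis hW : W^t* = W.
Local Notation fr X := (G *m X *m G^t*).

Lemma pt_Gamma_convex m (X Y : 'M[C]_n) t : X^t* = X -> Y^t* = Y -> (m <= n)%N ->
  0 <= t <= 1 -> pt_Gamma m W X -> pt_Gamma m W Y ->
  pt_Gamma m W (rc (1 - t) *: X + rc t *: Y).
Proof.
move=> hX hY mn t01 /(pt_GammaP GW hX mn) gX /(pt_GammaP GW hY mn) gY.
apply/(pt_GammaP GW _ mn); first by rewrite herm_add // herm_scale.
rewrite frame_lin; apply: hgam_convex => //; exact: frame_herm.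
Qed.

Lemma form_mixed_ge0 (X : 'M[C]_n) m j xi : X^t* = X -> (m < n)%N -> (j <= m)%N ->
  pt_Gamma m.+1 W X ->
  0 <= over_volume W (wedge (mixed X W j (n.-1 - j)) (sqr10 xi)).
Proof.
move=> hX mn jm /(pt_GammaP GW hX mn) gX.
have jn : (j <= n.-1)%N by lia.
rewrite (over_volume_sqr10_hsig1 GW) // rc_ge0 divr_ge0 ?mulr_ge0 //.
have [->|xi0] := eqVneq xi 0.
  by rewrite mul0mx /hsig1 /pencil_adj trmx0 !map_mx0 mulmx0 mxE coef0 /= lexx.
apply/ltW/(hsig1_gt0 (m := m)) => //; [exact: frame_herm|exact: (frame_xi_neq0 GW)].
Qed.

Lemma mixed_shift_ge (X : 'M[C]_n) (h : R) m p : X^t* = X -> (m < n)%N -> (p <= m)%N ->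
  0 <= h -> pt_Gamma m.+1 W X ->
  form_ge0 W (mixed (X + rc h *: W) W p (n.-1 - p)
              - escale (rc (h ^+ p)) (wpow (form11 W) n.-1)).
Proof.
move=> hX mn pm h0 gX xi.
have pn : (p <= n.-1)%N by lia.
have eq : wedge (mixed (X + rc h *: W) W p (n.-1 - p)) (sqr10 xi) =
  \sum_(i < p.+1) escale (rc (h ^+ i) * 'C(p, i)%:R)
     (wedge (mixed X W (p - i) (n.-1 - (p - i))) (sqr10 xi)).
  rewrite wedge_mixed_eval eF_add eF_scale exprDn.
  rewrite !mulr_suml eval_sum; apply: eq_bigr => i _; rewrite wedge_mixed_eval -eval_scM.
  congr eval; have -> : (n.-1 - (p - i) = i + (n.-1 - p))%N by have := ltn_ord i; lia.
  rewrite rmorphM rmorph_nat exprD; move: (eF X) (eF W) (eF _) => x w z.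
  rewrite exprMn -rmorphXn -rmorphXn -[_ *+ 'C(p, i)]mulr_natl.
  rewrite -!mulrA [RHS]mulrCA; congr (_ * _).
  by rewrite [LHS]mulrCA.
rewrite wedgeBl over_volumeB eq over_volume_sum big_ord_recr /= subnn subn0.
rewrite binn mulr1 wedgeZl.
have -> : mixed X W 0 n.-1 = wpow (form11 W) n.-1 by exact: wedge1x.
rewrite addrK; apply: sumr_ge0 => i _; rewrite over_volumeZ mulr_ge0 //.
  by rewrite mulr_ge0 // rc_ge0 exprn_ge0.
by apply: (form_mixed_ge0 (m := m)) => //; lia.
Qed.

(* chi_tu - (1-t) tau omega = (1-t) (chi_0 - tau omega) + t chi_u is in Gamma. *)
Lemma mixed_path_ge (A B : 'M[C]_n) (t tau : R) m p : A^t* = A -> B^t* = B ->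
  (m < n)%N -> (p <= m)%N -> 0 <= t <= 1 -> 0 <= tau ->
  pt_Gamma m.+1 W (A - rc tau *: W) -> pt_Gamma m.+1 W B ->
  form_ge0 W (mixed (rc (1 - t) *: A + rc t *: B) W p (n.-1 - p)
              - escale (rc ((1 - t) ^+ p * tau ^+ p)) (wpow (form11 W) n.-1)).
Proof.
move=> hA hB mn pm t01 tau0 gA gB.
have hA' : (A - rc tau *: W)^t* = A - rc tau *: W.
  by rewrite -scaleNr -rmorphN herm_add // herm_scale.
have -> : rc (1 - t) *: A + rc t *: B
  = (rc (1 - t) *: (A - rc tau *: W) + rc t *: B) + rc ((1 - t) * tau) *: W.
  by rewrite scalerBr scalerA -rmorphM [RHS]addrAC subrK.
have h0 : 0 <= (1 - t) * tau by rewrite mulr_ge0 // subr_ge0; case/andP: t01.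
rewrite -exprMn; apply: (mixed_shift_ge (herm_add (herm_scale (1 - t) hA') (herm_scale t hB)) mn pm h0).
exact: (pt_Gamma_convex hA' hB mn t01 gA gB).
Qed.

(** By homogeneity t^l sigma_l(B) = sigma_l(t B), and t B + (1 - t) A differs from t B by an element
    of the cone, or by zero when t = 1. *)
Lemma mixed_path_le (A B : 'M[C]_n) (t : R) m l : A^t* = A -> B^t* = B ->
  (m <= n)%N -> (l <= m)%N -> 0 < t <= 1 ->
  pt_Gamma m W A -> pt_Gamma m W B ->
  top_ge0 W (escale (rc (t ^- l)) (mixed (rc (1 - t) *: A + rc t *: B) W l (n - l))
             - mixed B W l (n - l)).
Proof.
move=> hA hB mn lm /andP[t0 t1] gA gB.
have ln : (l <= n)%N by exact: leq_trans mn.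
have hZ : (rc (1 - t) *: A + rc t *: B)^t* = rc (1 - t) *: A + rc t *: B.
  by rewrite herm_add // herm_scale.
rewrite /top_ge0 over_volumeB over_volumeZ !(over_volume_mixed_hsig GW) //.
rewrite -rmorphM -rmorphB rc_ge0 frame_lin mulrA -mulrBl divr_ge0 // subr_ge0.
rewrite mulrC ler_pdivlMr ?exprn_gt0 // mulrC -hsig_scale.
move: gA gB => /(pt_GammaP GW hA mn) gA /(pt_GammaP GW hB mn) gB.
have [->|t1'] := eqVneq t 1; first by rewrite subrr rmorph0 scale0r add0r.
have t1'' : 0 < 1 - t by rewrite subr_gt0 lt_neqAle t1'.
rewrite addrC; exact: (hsig_mono (herm_scale t (frame_herm G hB))
  (herm_scale _ (frame_herm G hA)) lm (hgam_scale t0 gB) (hgam_scale t1'' gA)).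
Qed.

Lemma over_volume_solution (B : 'M[C]_n) (al : nat -> R) k : B^t* = B -> (k <= n)%N ->
  mixed B W k (n - k) = \sum_(0 <= l < k) escale (rc (al l)) (mixed B W l (n - l)) ->
  hsig (fr B) k / 'C(n, k)%:R = \sum_(0 <= l < k) al l * hsig (fr B) l / 'C(n, l)%:R.
Proof.
move=> hB kn /(congr1 (over_volume W)); rewrite (over_volume_mixed_hsig GW) //.
rewrite over_volume_sum => e.
apply: rc_inj; rewrite e rmorph_sum /=.
apply: eq_big_nat => l /andP[_ lk]; rewrite over_volumeZ (over_volume_mixed_hsig GW) //.
  by rewrite -rmorphM mulrA.
exact: leq_trans (ltnW lk) kn.
Qed.

Lemma over_volume_cone_diff (X : 'M[C]_n) (al : nat -> R) K (c : R) xi :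
  X^t* = X -> (K.+2 <= n)%N ->
  over_volume W (wedge
    (cone_form K.+2 al W X - escale (rc c) (mixed X W K (n.-1 - K))) (sqr10 xi))
  = rc (Lval n K.+2 al (hsig1 (fr X) (xi *m G^T))
        - c * (hsig1 (fr X) (xi *m G^T) K / (n%:R * 'C(n.-1, K)%:R))).
Proof.
move=> hX Kn; have Kn1 : (K <= n.-1)%N by lia.
rewrite wedgeBl over_volumeB wedgeZl over_volumeZ (over_volume_cone GW) //.
by rewrite (over_volume_sqr10_hsig1 GW) // -rmorphM -rmorphB.
Qed.

Lemma cone_path_gt (A B : 'M[C]_n) (al : nat -> R) K (t c : R) : A^t* = A -> B^t* = B ->
  (K.+2 <= n)%N -> 0 <= t <= 1 -> 0 <= c ->
  pt_Gamma K.+1 W A -> pt_Gamma K.+1 W B ->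
  (forall l, (l <= K)%N -> 0 <= al l) -> 0 < \sum_(0 <= l < K.+1) al l ->
  mixed B W K.+2 (n - K.+2)
    = \sum_(0 <= l < K.+2) escale (rc (al l)) (mixed B W l (n - l)) ->
  form_gt0 W (cone_form K.+2 al W A - escale (rc c) (mixed A W K (n.-1 - K))) ->
  form_gt0 W (cone_form K.+2 al W (rc (1 - t) *: A + rc t *: B)
    - escale (rc (c * (1 - t))) (mixed (rc (1 - t) *: A + rc t *: B) W K (n.-1 - K))).
Proof.
move=> hA hB Kn t01 c0 gA gB al0 als sol coneA xi xi0.
have Kn1 : (K <= n.-1)%N by lia.
have Kn2 : (K.+1 <= n)%N by lia.
have K2 : (1 < K.+2 <= n)%N by [].
set Z := rc (1 - t) *: A + rc t *: B.
have hZ : Z^t* = Z by rewrite herm_add // herm_scale.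
have gZ : pt_Gamma K.+1 W Z by exact: pt_Gamma_convex.
have xi0' := frame_xi_neq0 GW xi0.
pose d : R := n%:R * 'C(n.-1, K)%:R.
have d0 : 0 < d by rewrite mulr_gt0 ?ltr0n // bin_gt0.
rewrite over_volume_cone_diff // -/d rc_gt0 subr_gt0.
have pos (X : 'M[C]_n) : X^t* = X -> pt_Gamma K.+1 W X -> 0 < hsig1 (fr X) (xi *m G^T) K.
  move=> hX /(pt_GammaP GW hX Kn2) gX.
  by apply: (hsig1_gt0 (m := K)) => //; exact: frame_herm.
have := coneA xi xi0; rewrite over_volume_cone_diff // -/d rc_gt0 subr_gt0 => cA.
have gA' := (pt_GammaP GW hA Kn2).1 gA; have gB' := (pt_GammaP GW hB Kn2).1 gB.
have cB := ellipticity Kn (frame_herm G hB) gB' al0 als (over_volume_solution hB Kn sol) xi0'.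
have frZ : fr Z = rc (1 - t) *: fr A + rc t *: fr B by exact: frame_lin.
have gap := Lval_concave Kn (frame_herm G hA) (frame_herm G hB) t01 gA' gB' al0 xi0'.
rewrite -frZ in gap.
exact: (convex_quot_gt t01 d0 (pos A hA gA) (pos B hB gB) (pos Z hZ gZ) cA cB gap).
Qed.

Lemma form_gt0_trans (eta theta zeta : extform R n) :
  form_gt0 W (eta - theta) -> form_ge0 W (theta - zeta) -> form_gt0 W (eta - zeta).
Proof.
move=> h1 h2 xi xi0; have := ltr_wpDr (h2 xi) (h1 xi xi0).
by rewrite -over_volumeD !wedgeBl subrKA -wedgeBl.
Qed.

Lemma form_ge0Z (c : R) (eta theta : extform R n) : 0 <= c ->
  form_ge0 W (eta - theta) -> form_ge0 W (escale (rc c) eta - escale (rc c) theta).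
Proof.
move=> c0 h xi; rewrite wedgeBl !wedgeZl over_volumeB !over_volumeZ -mulrBr.
by rewrite -over_volumeB -wedgeBl mulr_ge0 // rc_ge0.
Qed.

End PointwiseForms.

(** * Uniformity of the cone condition *)

Local Open Scope classical_set_scope.
Local Open Scope ring_scope.
Local Open Scope sesquilinear_scope.

Lemma fin_pos_lower (R : realFieldType) (I : finType) (f : I -> R) :
  (forall i, 0 < f i) -> exists2 c, 0 < c & forall i, c < f i.
Proof.
move=> f0; have S0 : 0 <= \sum_i (f i)^-1 by apply: sumr_ge0 => i _; rewrite invr_ge0 ltW.
have S1 : 0 < 1 + \sum_i (f i)^-1 by rewrite ltr_pwDl.
(* The inverse of 1 plus the sum of inverses lies strictly below every value and, unlike a minimum,
   also makes sense for an empty index set. *)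
exists (1 + \sum_i (f i)^-1)^-1; rewrite ?invr_gt0 // => i.
rewrite -[ltRHS]invrK ltf_pV2 ?posrE ?invr_gt0 // (bigD1 i) //= addrCA ltrDl.
by rewrite ltr_pwDl // sumr_ge0 // => j _; rewrite invr_ge0 ltW.
Qed.

Lemma sqr_sum_le (K : numFieldType) n (x : 'I_n -> K) : (forall i, 0 <= x i) ->
  (\sum_i x i) ^+ 2 <= 2 * n%:R * \sum_i x i ^+ 2.
Proof.
move=> x0; rewrite expr2 mulr_suml.
have -> : 2 * n%:R * (\sum_i x i ^+ 2) = \sum_i \sum_j (x i ^+ 2 + x j ^+ 2).
  under [RHS]eq_bigr => i _ do rewrite big_split /= sumr_const card_ord.
  by rewrite big_split /= sumrMnl sumr_const card_ord; move: (\sum_i _) => S; rewrite -(mulr_natl S n); ring.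
apply: ler_sum => i _; rewrite mulr_sumr; apply: ler_sum => j _.
rewrite -subr_ge0; have -> : x i ^+ 2 + x j ^+ 2 - x i * x j
   = (x i - x j) ^+ 2 + x i * x j by ring.
apply: addr_ge0; last exact: mulr_ge0.
by rewrite real_exprn_even_ge0 // rpredB // ger0_real.
Qed.

(** * Quantitative positivity at a point *)

Section DiagonalBound.
Variables (R : realType) (n : nat).
Local Notation C := (Cplx R).

(** Bounds homogeneous of degree two in this norm hold for all covectors at once and take the place
    of compactness of the unit sphere. *)
Definition norm1 (xi : 'rV[C]_n) : C := \sum_a `|xi 0 a|.

Lemma norm1_ge0 xi : 0 <= norm1 xi.
Proof. by apply: sumr_ge0 => a _. Qed.

Lemma norm1_gt0 xi : xi != 0 -> 0 < norm1 xi.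
Proof.
move=> xi0; rewrite lt_def norm1_ge0 andbT; apply: contra xi0.
rewrite psumr_eq0 // => /allP h; apply/eqP/rowP => a; rewrite mxE.
by have := h a (mem_index_enum _); rewrite normr_eq0 => /eqP.
Qed.

Lemma norm1_mulmx (A : 'M[C]_n) : exists2 k : C, 0 < k &
  forall xi, norm1 (xi *m A) <= k * norm1 xi.
Proof.
exists (1 + \sum_b \sum_a `|A a b|).
  by rewrite ltr_pwDl // sumr_ge0 // => b _; rewrite sumr_ge0.
move=> xi; rewrite mulrDl mul1r; apply: ler_wpDl; first exact: norm1_ge0.
rewrite mulr_suml; apply: ler_sum => b _; rewrite mxE.
apply: le_trans (ler_norm_sum _ _ _) _; rewrite mulr_suml; apply: ler_sum => a _.
rewrite normrM mulrC ler_wpM2l // /norm1 (bigD1 a) //= lerDl.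
by apply: sumr_ge0.
Qed.

Lemma sum_sqr_lower (A : 'M[C]_n) : A \in unitmx -> exists2 c : R, 0 < c &
  forall xi : 'rV[C]_n, rc c * norm1 xi ^+ 2 <= \sum_a `|(xi *m A) 0 a| ^+ 2.
Proof.
move=> uA; have [k k0 hk] := norm1_mulmx (invmx A).
(* The factor 2 n comes from [sqr_sum_le]; [n.+1] in place of n keeps the constant positive also for
   n = 0. *)
have k2 : 0 < k ^+ 2 * (2 * n.+1%:R) by rewrite mulr_gt0 ?exprn_gt0 ?mulr_gt0 ?ltr0n.
have e : (k ^+ 2 * (2 * n.+1%:R))^-1 = rc (complex.Re (k ^+ 2 * (2 * n.+1%:R))^-1).
  by apply: real_rc; rewrite ger0_real // invr_ge0 ltW.
exists (complex.Re (k ^+ 2 * (2 * n.+1%:R))^-1); first by rewrite -rc_gt0 -e invr_gt0.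
move=> xi; rewrite -e mulrC ler_pdivrMr //.
have := hk (xi *m A); rewrite mulmxK // => h.
apply: (@le_trans _ _ ((k * norm1 (xi *m A)) ^+ 2)).
  by rewrite lerXn2r ?nnegrE ?mulr_ge0 ?norm1_ge0 // ltW.
rewrite exprMn [leRHS]mulrC -[leRHS]mulrA; apply: ler_wpM2l; first by rewrite exprn_ge0 // ltW.
apply: le_trans (sqr_sum_le _) _; first by move=> i; exact: normr_ge0.
apply: ler_wpM2r; first by apply: sumr_ge0 => a _; rewrite exprn_ge0.
by apply: ler_wpM2l => //; rewrite ler_nat.
Qed.

(** In an eigenbasis of A relative to the frame, the cone form and chi^(k-2) are both diagonal
    quadratic forms in the covector. Testing with the dual covectors makes every diagonal
    coefficient of the first positive, c is taken below all ratios of coefficients, and mu combines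
    the smallest remaining coefficient with the conditioning of the change of basis V. *)
Lemma cone_diag_bound (W G A : 'M[C]_n) (al : nat -> R) K :
  G *m W *m G^t* = 1%:M -> A^t* = A -> (K.+2 <= n)%N ->
  pt_Gamma K.+1 W A -> form_gt0 W (cone_form K.+2 al W A) ->
  exists c mu : R, [/\ 0 < c, 0 < mu & forall xi : 'rV[C]_n,
    rc mu * norm1 xi ^+ 2 <= over_volume W (wedge
      (cone_form K.+2 al W A - escale (rc c) (mixed A W K (n.-1 - K))) (sqr10 xi))].
Proof.
move=> GW hA Kn gA coneA.
have n0 : (0 < n)%N by lia.
have Kn1 : (K <= n.-1)%N by lia.
have Kn2 : (K.+1 <= n)%N by lia.
have K2 : (1 < K.+2 <= n)%N by [].
have [U hU [l e1 e2]] := spectral_pencil_adj (frame_herm G hA).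
pose V : 'M[C]_n := G^T *m U^T.
have uV : V \in unitmx.
  by rewrite unitmx_mul !unitmx_tr (frame_unit GW) unitarymx_unit.
pose d : R := n%:R * 'C(n.-1, K)%:R.
have d0 : 0 < d by rewrite mulr_gt0 ?ltr0n // bin_gt0.
pose s a j := esf l ([set: 'I_n] :\ a)%SET j.
have hsig1V xi j : hsig1 (G *m A *m G^t*) (xi *m G^T) j
    = \sum_a complex.Re (`|(xi *m V) 0 a| ^+ 2) * s a j.
  rewrite /hsig1 e2 /V mulmxA.
  under eq_bigr => a _ do rewrite norm_sqr_rc -rmorphM.
  by rewrite -rmorph_sum.
have LV xi : over_volume W (wedge (cone_form K.+2 al W A) (sqr10 xi))
    = \sum_a `|(xi *m V) 0 a| ^+ 2 * rc (Lval n K.+2 al (s a)).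
  rewrite (over_volume_cone GW) //.
  have -> : hsig1 (G *m A *m G^t*) (xi *m G^T)
      = fun j => \sum_a complex.Re (`|(xi *m V) 0 a| ^+ 2) * s a j by apply/funext => j.
  rewrite Lval_sum rmorph_sum; apply: eq_bigr => a _.
  by rewrite [in RHS]norm_sqr_rc -rmorphM.
have SV xi : over_volume W (wedge (mixed A W K (n.-1 - K)) (sqr10 xi))
    = \sum_a `|(xi *m V) 0 a| ^+ 2 * rc (s a K / d).
  rewrite (over_volume_sqr10_hsig1 GW) // hsig1V -/d mulr_suml rmorph_sum; apply: eq_bigr => a _.
  by rewrite [in RHS]norm_sqr_rc -rmorphM mulrA.
have L0 a : 0 < Lval n K.+2 al (s a).
  pose xi : 'rV[C]_n := delta_mx 0 a *m invmx V.
  have xV : xi *m V = delta_mx 0 a by rewrite mulmxKV.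
  have xi0 : xi != 0.
    apply/eqP => z; have := congr1 (fun v : 'rV[C]_n => v 0 a) xV.
    by rewrite z mul0mx !mxE !eqxx => /eqP; rewrite eq_sym oner_eq0.
  have := coneA xi xi0; rewrite LV xV (bigD1 a) //= big1 => [|b ba].
    by rewrite addr0 mxE !eqxx normr1 expr1n mul1r rc_gt0.
  by rewrite mxE (negbTE ba) andbF normr0 expr0n mul0r.
have S0 a : 0 < s a K / d.
  have gl : gam l K.+1 [set: _]%SET.
    move=> j jK; have := (pt_GammaP GW hA Kn2).1 gA j jK.
    by rewrite /hsig e1 coef_map.
  by rewrite divr_gt0 //; exact: (gamD1 (finset.in_setT a) gl (leqnn K)).
have [c c0 hc] := fin_pos_lower (fun a => divr_gt0 (L0 a) (S0 a)).
have D0 a : 0 < Lval n K.+2 al (s a) - c * (s a K / d).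
  by rewrite subr_gt0 -ltr_pdivlMr.
have [nu nu0 hnu] := fin_pos_lower D0.
have [b b0 hb] := sum_sqr_lower uV.
exists c, (nu * b); split => //; first by rewrite mulr_gt0.
move=> xi; rewrite wedgeBl over_volumeB wedgeZl over_volumeZ LV SV mulr_sumr -sumrB.
rewrite rmorphM -mulrA; apply: (@le_trans _ _ (rc nu * \sum_a `|(xi *m V) 0 a| ^+ 2)).
  by rewrite ler_wpM2l // rc_ge0 ltW.
rewrite mulr_sumr; apply: ler_sum => a _.
rewrite [rc c * _]mulrCA -mulrBr -rmorphM -rmorphB mulrC ler_wpM2l ?exprn_ge0 //.
by rewrite rc_le ltW.
Qed.

Lemma cone_form_real (W G A : 'M[C]_n) (al : nat -> R) K c xi :
  G *m W *m G^t* = 1%:M -> A^t* = A -> (K.+2 <= n)%N ->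
  exists x : R, over_volume W (wedge
      (cone_form K.+2 al W A - escale (rc c) (mixed A W K (n.-1 - K))) (sqr10 xi)) = rc x.
Proof.
move=> GW hA Kn; have n0 : (0 < n)%N by lia.
by eexists; apply: (over_volume_cone_diff GW).
Qed.

Lemma over_volume_sqr10_expand (W : 'M[C]_n) eta xi :
  over_volume W (wedge eta (sqr10 xi)) =
  \sum_a \sum_b xi 0 a * (xi 0 b)^* * over_volume W (wedge eta (form11 (delta_mx a b))).
Proof.
have e : sqr10 xi = \sum_a \sum_b escale (xi 0 a * (xi 0 b)^* ) (form11 (delta_mx a b)).
  rewrite /sqr10 [in LHS](matrix_sum_delta (_ *m _)) -eval_eF.
  have eF_sum (I : Type) (r : seq I) (F : I -> 'M[C]_n) :
      eF (\sum_(i <- r) F i) = \sum_(i <- r) eF (F i).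
    apply: (big_morph _ (@eF_add _ _)).
    by rewrite -(scale0r (0 : 'M[C]_n)) eF_scale rmorph0 mul0r.
  rewrite eF_sum eval_sum; apply: eq_bigr => a _; rewrite eF_sum eval_sum; apply: eq_bigr => b _.
  by rewrite eF_scale eval_scM eval_eF mxE big_ord1 !mxE.
rewrite e.
have wsum (I : Type) (r : seq I) (F : I -> extform R n) :
    wedge eta (\sum_(i <- r) F i) = \sum_(i <- r) wedge eta (F i).
  exact: (mulr_sumr (R := ealg R n)).
rewrite wsum over_volume_sum; apply: eq_bigr => a _; rewrite wsum over_volume_sum.
apply: eq_bigr => b _.
rewrite -over_volumeZ; congr over_volume.
rewrite escale_wedge [RHS]escale_wedge !wedgeA; congr wedge.
by rewrite [RHS]wedge_evenC // escale_even.
Qed.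

Lemma over_volume_sqr10_perturb (W W' : 'M[C]_n) eta eta' xi (e : C) : 0 <= e ->
  (forall a b, `|over_volume W (wedge eta (form11 (delta_mx a b)))
               - over_volume W' (wedge eta' (form11 (delta_mx a b)))| <= e) ->
  `|over_volume W (wedge eta (sqr10 xi)) - over_volume W' (wedge eta' (sqr10 xi))|
    <= e * norm1 xi ^+ 2.
Proof.
move=> e0 h; rewrite !over_volume_sqr10_expand -sumrB.
apply: le_trans (ler_norm_sum _ _ _) _.
rewrite /norm1 expr2 mulr_suml mulr_sumr; apply: ler_sum => a _.
rewrite -sumrB; apply: le_trans (ler_norm_sum _ _ _) _.
rewrite mulr_sumr mulr_sumr; apply: ler_sum => b _.
rewrite -mulrBr !normrM norm_conjC mulrC ler_wpM2r ?mulr_ge0 //.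
Qed.

End DiagonalBound.

Lemma norm_rc (R : realType) (x : R) : `|rc x| = rc `|x|.
Proof.
have [h|h] := leP 0 x; first by rewrite !ger0_norm ?rc_ge0.
have h' : rc x < 0 by move: h; rewrite -rc_lt rmorph0.
by rewrite (ltr0_norm h) (ltr0_norm h') rmorphN.
Qed.

Lemma gt0_rc (R : realType) (e : Cplx R) : 0 < e -> exists2 d : R, 0 < d & e = rc d.
Proof.
move=> e0; have eE : e = rc (complex.Re e) by apply/real_rc/gtr0_real.
by exists (complex.Re e) => //; rewrite -rc_gt0 -eE.
Qed.

Lemma rc_continuous (R : realType) : continuous (@rc R).
Proof.
move=> x; apply/cvgrPdist_lt => _ /gt0_rc[e e0 ->].
near=> y; rewrite -rmorphB norm_rc rc_lt.
by near: y; apply: (@cvgr_dist_lt _ R R).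
Unshelve. all: by end_near. Qed.

Section FieldContinuity.
Variables (K : numFieldType) (T : topologicalType) (z : T).
Implicit Types f g : T -> K.

Lemma for_continuousM f g : {for z, continuous f} -> {for z, continuous g} ->
  {for z, continuous (fun x => f x * g x)}.
Proof. exact: continuousM. Qed.

Lemma for_continuousB f g : {for z, continuous f} -> {for z, continuous g} ->
  {for z, continuous (fun x => f x - g x)}.
Proof. exact: continuousB. Qed.

Lemma for_continuousV f : f z != 0 -> {for z, continuous f} ->
  {for z, continuous (fun x => (f x)^-1)}.
Proof. exact: continuousV. Qed.

Lemma for_continuous_cst (c : K) : {for z, continuous ((fun=> c) : T -> K)}.
Proof. exact: cst_continuous. Qed.

Lemma for_continuous_sum (I : Type) (r : seq I) (P : pred I) (F : I -> T -> K) :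
  (forall i, P i -> {for z, continuous (F i)}) ->
  {for z, continuous (fun x => \sum_(i <- r | P i) F i x)}.
Proof.
move=> h; elim: r => [|i r IH].
  have -> : (fun x => \sum_(i <- [::] | P i) F i x) = (fun=> 0).
    by apply/funext => x; rewrite big_nil.
  exact: cst_continuous.
have -> : (fun x => \sum_(j <- i :: r | P j) F j x)
    = (fun x => if P i then F i x + \sum_(j <- r | P j) F j x else \sum_(j <- r | P j) F j x).
  by apply/funext => x; rewrite big_cons.
case: (boolP (P i)) => [/h hi|_]; last exact: IH.
exact: continuousD hi IH.
Qed.

Lemma for_continuous_dist_le f (e : K) : {for z, continuous f} -> 0 < e ->
  \forall x \near z, `|f x - f z| <= e.
Proof.
move=> /cvgrPdist_lt h /h; apply: filterS => x.
by rewrite distrC => /ltW.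
Qed.

End FieldContinuity.

(** * Continuity of forms and a locally uniform cone condition *)

Section FormContinuity.
Variables (R : realType) (n : nat) (T : topologicalType) (z0 : T).
Local Notation C := (Cplx R).
Local Notation cont f := ({for z0, continuous (f : T -> C)}).

Definition form_cont (eta : T -> extform R n) := forall S, cont (fun z => eta z S).
Definition mx_cont (A : T -> 'M[C]_n) := forall a b, cont (fun z => A z a b).

Lemma cont_sum (I : Type) (r : seq I) (P : pred I) (F : I -> T -> C) :
  (forall i, P i -> cont (F i)) -> cont (fun z => \sum_(i <- r | P i) F i z).
Proof. exact: (@for_continuous_sum (Cplx R)). Qed.

Lemma contM (f g : T -> C) : cont f -> cont g -> cont (fun z => f z * g z).
Proof. exact: (@for_continuousM (Cplx R)). Qed.

Lemma contB (f g : T -> C) : cont f -> cont g -> cont (fun z => f z - g z).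
Proof. exact: (@for_continuousB (Cplx R)). Qed.

Lemma contV (f : T -> C) : f z0 != 0 -> cont f -> cont (fun z => (f z)^-1).
Proof. exact: (@for_continuousV (Cplx R)). Qed.

Lemma cont_cst (c : C) : cont (fun=> c).
Proof. exact: (@for_continuous_cst (Cplx R)). Qed.

Lemma cont_ext (f g : T -> C) : f =1 g -> cont g -> cont f.
Proof. by move=> /funext ->. Qed.

Lemma form_cont_cst eta : form_cont (fun=> eta).
Proof. by move=> S; exact: cont_cst. Qed.

Lemma form_cont_scale (c : T -> C) eta : cont c -> form_cont eta ->
  form_cont (fun z => escale (c z) (eta z)).
Proof.
move=> hc he S; apply: (cont_ext (g := fun z => c z * eta z S)) => [z|].
  by rewrite ffunE.
exact: contM hc (he S).
Qed.

Lemma form_cont_wedge eta theta : form_cont eta -> form_cont theta ->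
  form_cont (fun z => wedge (eta z) (theta z)).
Proof.
move=> he ht S; apply: (cont_ext (g := fun z => \sum_(A : {set 'I_(n + n)} | A \subset S)
    (-1) ^+ inversions A (S :\: A)%SET * eta z A * theta z (S :\: A)%SET)) => [z|].
  by rewrite ffunE.
apply: cont_sum => A _; apply: contM (ht _); apply: contM (he _); exact: cont_cst.
Qed.

Lemma form_cont_sum (I : Type) (r : seq I) (P : pred I) (F : I -> T -> extform R n) :
  (forall i, P i -> form_cont (F i)) -> form_cont (fun z => \sum_(i <- r | P i) F i z).
Proof.
move=> h S; apply: (cont_ext (g := fun z => \sum_(i <- r | P i) F i z S)) => [z|].
  by rewrite sum_ffunE.
by apply: cont_sum => i /h.
Qed.

Lemma form_contB eta theta : form_cont eta -> form_cont theta ->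
  form_cont (fun z => eta z - theta z).
Proof.
move=> he ht S; apply: (cont_ext (g := fun z => eta z S - theta z S)) => [z|].
  by rewrite !ffunE.
exact: contB (he S) (ht S).
Qed.

Lemma form_cont_wpow eta p : form_cont eta -> form_cont (fun z => wpow (eta z) p).
Proof.
move=> he; elim: p => [|p IH]; first exact: form_cont_cst.
exact: form_cont_wedge.
Qed.

Lemma form_cont_form11 A : mx_cont A -> form_cont (fun z => form11 (A z)).
Proof.
move=> hA; apply: form_cont_scale; first exact: cont_cst.
apply: form_cont_sum => a _; apply: form_cont_sum => b _.
by apply: form_cont_scale => //; exact: form_cont_cst.
Qed.

Lemma form_cont_mixed A W p q : mx_cont A -> mx_cont W ->
  form_cont (fun z => mixed (A z) (W z) p q).
Proof.
by move=> hA hW; apply: form_cont_wedge; apply: form_cont_wpow; apply: form_cont_form11.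
Qed.

Lemma form_cont_cone k (al : nat -> T -> R) A W :
  (forall l, (l < k)%N -> {for z0, continuous (al l)}) -> mx_cont A -> mx_cont W ->
  form_cont (fun z => cone_form k (al^~ z) (W z) (A z)).
Proof.
move=> hal hA hW; apply: form_contB.
  by apply: form_cont_scale; [exact: cont_cst|exact: form_cont_mixed].
move=> S; apply: (cont_ext (g := fun z => (\sum_(1 <= l < k | (1 <= l < k)%N)
    escale (l%:R * rc (al l z)) (mixed (A z) (W z) l.-1 (n - l))) S)) => [z|].
  by rewrite big_nat.
move: S; apply: form_cont_sum => l /andP[_ lk].
apply: form_cont_scale; last exact: form_cont_mixed.
apply: contM; first exact: cont_cst.
by apply: continuous_comp; [exact: hal|exact: rc_continuous].
Qed.

Lemma over_volume_cont W eta : mx_cont W -> form_cont eta -> \det (W z0) != 0 ->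
  cont (fun z => over_volume (W z) (eta z)).
Proof.
move=> hW he d0; apply: contM; first exact: he.
apply: contV; last by apply: form_cont_wpow; exact: form_cont_form11.
by rewrite -eval_eF_exp eval_top top_eF_exp mulf_neq0 // kappa_neq0.
Qed.

Definition hermitian_at (W A : T -> 'M[C]_n) z :=
  [/\ (W z)^t* = W z, posdef (W z) & (A z)^t* = A z].

(** At z0 the quadratic form has margin mu for the constant c. Near z0 its finitely many matrix
    entries move by at most mu / 2, so half of the margin survives for all covectors simultaneously,
    with c unchanged. *)
Lemma cone_locally_uniform (W A : T -> 'M[C]_n) (al : nat -> T -> R) K :
  (K.+2 <= n)%N -> mx_cont W -> mx_cont A ->
  (forall l, (l < K.+2)%N -> {for z0, continuous (al l)}) ->
  (\forall z \near z0, hermitian_at W A z) ->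
  pt_Gamma K.+1 (W z0) (A z0) -> form_gt0 (W z0) (cone_form K.+2 (al^~ z0) (W z0) (A z0)) ->
  exists2 c : R, 0 < c & \forall z \near z0,
    form_gt0 (W z) (cone_form K.+2 (al^~ z) (W z) (A z)
                    - escale (rc c) (mixed (A z) (W z) K (n.-1 - K))).
Proof.
move=> Kn hW hA hal hherm g0 cone0.
have [hW0 pW0 hA0] := nbhs_singleton hherm.
have [G GW _] := frame_exists hW0 pW0.
have [c [mu [c0 mu0 bound]]] := cone_diag_bound GW hA0 Kn g0 cone0.
exists c => //.
pose eta z := cone_form K.+2 (al^~ z) (W z) (A z)
                    - escale (rc c) (mixed (A z) (W z) K (n.-1 - K)).
have heta : form_cont eta.
  apply: form_contB; first exact: form_cont_cone.
  by apply: form_cont_scale; [exact: cont_cst|exact: form_cont_mixed].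
have near_m : \forall z \near z0, forall ab : 'I_n * 'I_n,
    `|over_volume (W z) (wedge (eta z) (form11 (delta_mx ab.1 ab.2)))
      - over_volume (W z0) (wedge (eta z0) (form11 (delta_mx ab.1 ab.2)))| <= rc (mu / 2).
  apply: filter_forall => -[a b] /=.
  have cm : cont (fun z => over_volume (W z) (wedge (eta z) (form11 (delta_mx a b)))).
    have h1 := form_cont_wedge heta (@form_cont_cst (form11 (delta_mx a b))).
    exact: (over_volume_cont hW h1 (det_frame_neq0 GW)).
  have e0 : 0 < rc (mu / 2) by rewrite rc_gt0 divr_gt0.
  exact: (for_continuous_dist_le cm e0).
near=> z => xi xi0.
have [hWz pWz hAz] : hermitian_at W A z by near: z.
have hm : forall ab : 'I_n * 'I_n,
    `|over_volume (W z) (wedge (eta z) (form11 (delta_mx ab.1 ab.2)))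
      - over_volume (W z0) (wedge (eta z0) (form11 (delta_mx ab.1 ab.2)))| <= rc (mu / 2).
  by near: z.
have m0 : 0 <= rc (mu / 2) by rewrite rc_ge0 divr_ge0 // ltW.
have dist := over_volume_sqr10_perturb xi m0 (fun a b => hm (a, b)).
have [Gz GWz _] := frame_exists hWz pWz.
have [x ex] := cone_form_real (al^~ z) c xi GWz hAz Kn.
have [y ey] := cone_form_real (al^~ z0) c xi GW hA0 Kn.
have := bound xi; move: dist; rewrite -/(eta z0) -/(eta z).
rewrite [over_volume (W z) _]ex [over_volume (W z0) _]ey.
have := exprn_gt0 2 (norm1_gt0 xi0) => /gt0_rc[N N0 ->].
rewrite -rmorphB norm_rc -!rmorphM !rc_le rc_gt0 ler_norml => /andP[h1 _] h2.
by nra.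
Unshelve. all: by end_near. Qed.

End FormContinuity.

(** * The complex Hessian *)

Section Clairaut.
Variable R : realType.

Lemma mean_value (f df : R -> R) (h d : R) : 0 < h < d ->
  (forall s : R, `|s| < d -> is_derive s (1 : R) f (df s)) ->
  exists2 c, `|c| < d & f h - f 0 = df c * h.
Proof.
move=> /andP[h0 hd] der.
have inb s : s \in `[0, h] -> `|s| < d.
  by rewrite in_itv /= => /andP[s0 sh]; rewrite ger0_norm // (le_lt_trans sh).
have [||c hc e] := MVT (f := f) (df := df) h0.
- by move=> s hs; apply: der; apply: inb; apply: subset_itv_oo_cc.
- by apply: derivable_within_continuous => s hs; have [] := der s (inb s hs).
exists c; first by apply: inb; apply: subset_itv_oo_cc.
by rewrite e subr0.
Qed.

(** The mean value theorem, applied in s to the difference of g at heights h and 0 and then in t,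
    writes the second difference as h^2 times [gst] at an intermediate point. *)
Lemma second_difference (g gs gst : R -> R -> R) (d e L h : R) :
  (forall s t : R, `|s| < d -> `|t| < d -> is_derive s (1 : R) (g^~ t) (gs s t)) ->
  (forall s t : R, `|s| < d -> `|t| < d -> is_derive t (1 : R) (gs s) (gst s t)) ->
  (forall s t : R, `|s| < d -> `|t| < d -> `|gst s t - L| <= e) ->
  0 < h < d -> `|g h h - g h 0 - g 0 h + g 0 0 - h ^+ 2 * L| <= e * h ^+ 2.
Proof.
move=> hg hgs hgst /[dup] hd /andP[h0 hd'].
have d0 : `|0 : R| < d by rewrite normr0 (lt_trans h0).
have nh : `|h| < d by rewrite gtr0_norm.
have [s|c cd e1] := @mean_value (fun s => g s h - g s 0) (fun s => gs s h - gs s 0) h d hd.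
  by move=> sd; apply: is_deriveB; apply: hg.
have [t|b bd e2] := @mean_value (gs c) (gst c) h d hd; first exact: hgs.
have -> : g h h - g h 0 - g 0 h + g 0 0 - h ^+ 2 * L = (gst c b - L) * h ^+ 2.
  move: e1; rewrite e2 => e1.
  by have -> : g h h - g h 0 - g 0 h + g 0 0 = gst c b * h * h; [rewrite -e1|]; ring.
by rewrite normrM [`|h ^+ 2|]ger0_norm ?sqr_ge0 // ler_wpM2r ?sqr_ge0 // hgst.
Qed.

(** The second difference does not depend on the order of the variables, and divided by h^2 it
    approximates both mixed derivatives. The Hermitian symmetry of the complex Hessian rests on this
    exchange of iterated directional derivatives. *)
Lemma clairaut (g gs gt gst gts : R -> R -> R) (d : R) : 0 < d ->
  (forall s t : R, `|s| < d -> `|t| < d -> is_derive s (1 : R) (g^~ t) (gs s t)) ->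
  (forall s t : R, `|s| < d -> `|t| < d -> is_derive t (1 : R) (g s) (gt s t)) ->
  (forall s t : R, `|s| < d -> `|t| < d -> is_derive t (1 : R) (gs s) (gst s t)) ->
  (forall s t : R, `|s| < d -> `|t| < d -> is_derive s (1 : R) (gt^~ t) (gts s t)) ->
  (forall e, 0 < e -> exists2 r, 0 < r & forall s t : R, `|s| < r -> `|t| < r ->
     `|gst s t - gst 0 0| <= e) ->
  (forall e, 0 < e -> exists2 r, 0 < r & forall s t : R, `|s| < r -> `|t| < r ->
     `|gts s t - gts 0 0| <= e) ->
  gst 0 0 = gts 0 0.
Proof.
move=> d0 hs ht hst hts cst cts; apply/eqP; rewrite -subr_eq0 -normr_le0.
apply/ler_addgt0Pr => e e0; rewrite add0r.
have e2 : 0 < e / 2 by rewrite divr_gt0.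
have [r1 r10 h1] := cst _ e2; have [r2 r20 h2] := cts _ e2.
pose r := Num.min d (Num.min r1 r2).
have r0 : 0 < r by rewrite !lt_min d0 r10.
have rd x : `|x| < r -> [/\ `|x| < d, `|x| < r1 & `|x| < r2].
  by rewrite !lt_min => /and3P[].
have hr : 0 < r / 2 < r by rewrite divr_gt0 //= ltr_pdivrMr // mulr2n mulrDr mulr1 ltrDl.
have A : `|g (r / 2) (r / 2) - g (r / 2) 0 - g 0 (r / 2) + g 0 0 - (r / 2) ^+ 2 * gst 0 0|
    <= e / 2 * (r / 2) ^+ 2.
  apply: (second_difference (gs := gs) (gst := gst) _ _ _ hr) => s t /rd[sd s1 s2] /rd[td t1 t2].
  - exact: hs.
  - exact: hst.
  - exact: h1.
have B : `|g (r / 2) (r / 2) - g 0 (r / 2) - g (r / 2) 0 + g 0 0 - (r / 2) ^+ 2 * gts 0 0|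
    <= e / 2 * (r / 2) ^+ 2.
  apply: (second_difference (g := fun t s => g s t) (gs := fun t s => gt s t)
     (gst := fun t s => gts s t) _ _ _ hr) => s t /rd[sd s1 s2] /rd[td t1 t2].
  - exact: ht.
  - exact: hts.
  - exact: h2.
move: A B; rewrite [g (r / 2) (r / 2) - g 0 _ - _]addrAC.
have := exprn_gt0 2 (andP hr).1; move: ((r / 2) ^+ 2) (g _ _ - _ - _ + _) => q D q0 A B.
rewrite -(ler_pM2r q0) -[X in _ * X](gtr0_norm q0) -normrM.
have -> : (gst 0 0 - gts 0 0) * q = (D - q * gts 0 0) - (D - q * gst 0 0) by ring.
apply: le_trans (ler_normB _ _) _; apply: le_trans (lerD B A) _.
by rewrite -mulrDl -splitr.
Qed.

End Clairaut.

Lemma nbhs_box (K : numFieldType) (V : normedModType K) (x v w : V) (U : set V) :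
  nbhs x U -> exists2 e : K, 0 < e &
    forall a b : K, `|a| < e -> `|b| < e -> U (x + a *: v + b *: w).
Proof.
move=> /nbhs_normP[e /= e0 h].
have D0 : 0 < 1 + `|v| + `|w| by rewrite -addrA ltr_pwDl // addr_ge0.
exists (e / (1 + `|v| + `|w|)); first by rewrite divr_gt0.
move=> a b ae be; apply: h => /=.
rewrite -[x + _ + _]addrA opprD addrA subrr add0r normrN.
apply: le_lt_trans (ler_normD _ _) _; rewrite !normrZ.
set r := e / _ in ae be; have r0 : 0 < r by rewrite divr_gt0.
apply: (@le_lt_trans _ _ (r * (`|v| + `|w|))).
  by rewrite mulrDr lerD // ler_wpM2r // ltW.
have <- : r * (1 + `|v| + `|w|) = e by rewrite divfK // gt_eqF.
by rewrite ltr_pM2l // -addrA ltrDr.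
Qed.

Lemma is_derive_shift (R : realType) (F : R -> R) (s : R) :
  derivable (fun t => F (s + t)) 0 1 -> is_derive s (1 : R) F ('D_1 (fun t => F (s + t)) 0).
Proof.
have e : (fun h : R => h^-1 *: ((F \o shift s) (h *: (1 : R)) - F s))
  = (fun h : R => h^-1 *: (((fun t => F (s + t)) \o shift 0) (h *: (1 : R)) - F (s + 0))).
  by apply/funext => h /=; rewrite !addr0 [s + _]addrC.
by move=> h; split; rewrite /derivable /derive e.
Qed.

Section Directional.
Variables (R : realType) (n : nat).
Local Notation C := (Cplx R).
Local Notation E := 'rV[Cplx R]_n.
Implicit Types (f : E -> R) (x v w : E).

Lemma along_shift f x v s : along f (x + rc s *: v) v = (fun t => along f x v (s + t)).
Proof. by apply/funext => t; rewrite /along -addrA -scalerDl -rmorphD. Qed.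

Lemma is_derive_along f x v s : derivable (along f (x + rc s *: v) v) 0 1 ->
  is_derive s (1 : R) (along f x v) (rderive v f (x + rc s *: v)).
Proof.
by rewrite /rderive along_shift derive1E; exact: is_derive_shift.
Qed.

Lemma nbhs_real_box (U : set E) x v w : nbhs x U ->
  exists2 d : R, 0 < d & forall s t : R, `|s| < d -> `|t| < d -> U (x + rc s *: v + rc t *: w).
Proof.
move=> /(nbhs_box v w)[e /gt0_rc[d d0 ->] h].
by exists d => // s t sd td; apply: h; rewrite norm_rc rc_lt.
Qed.

Definition plane x v w (s t : R) : E := x + rc s *: v + rc t *: w.

Lemma plane00 x v w : plane x v w 0 0 = x.
Proof. by rewrite /plane rmorph0 !scale0r !addr0. Qed.

Lemma CkW k (U : set E) f : Ck k.+1 U f -> forall v,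
  (forall x, U x -> derivable (along f x v) 0 1) /\ Ck k U (rderive v f).
Proof. by case. Qed.

Lemma Ck_cont k (U : set E) f x : Ck k U f -> U x -> {for x, continuous f}.
Proof. by case: k => [|k] [h _]; apply: h. Qed.

Lemma rderiveC (U : set E) f x v w : open U -> U x -> Ck 2 U f ->
  rderive v (rderive w f) x = rderive w (rderive v f) x.
Proof.
move=> oU Ux Cf.
have nU : nbhs x U by exact: open_nbhs_nbhs.
have [d d0 box] := nbhs_real_box v w nU.
have [dv Cv] := CkW Cf v; have [dw Cw] := CkW Cf w.
have [dvw Cvw] := CkW Cv w; have [dwv Cwv] := CkW Cw v.
have p0 := plane00 x v w.
have near0 (F : E -> R) : {for x, continuous F} -> forall e, 0 < e ->
    exists2 r, 0 < r & forall s t : R, `|s| < r -> `|t| < r ->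
      `|F (plane x v w s t) - F (plane x v w 0 0)| <= e.
  move=> /cvgrPdist_lt cF e /cF h; have [r r0 hr] := nbhs_real_box v w h.
  exists r => [|s t sr tr]; first exact: r0.
  by have /ltW := hr s t sr tr; rewrite p0 distrC.
have alongv (F : E -> R) s t : derivable (along F (plane x v w s t) v) 0 1 ->
    is_derive s (1 : R) (fun s => F (plane x v w s t)) (rderive v F (plane x v w s t)).
  have -> : plane x v w s t = x + rc t *: w + rc s *: v by rewrite /plane addrAC.
  have -> : (fun s => F (plane x v w s t)) = along F (x + rc t *: w) v.
    by apply/funext => s'; rewrite /plane /along addrAC.
  exact: is_derive_along.
have alongw (F : E -> R) s t : derivable (along F (plane x v w s t) w) 0 1 ->
    is_derive t (1 : R) (fun t => F (plane x v w s t)) (rderive w F (plane x v w s t)).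
  exact: is_derive_along.
have H := @clairaut R (fun s t => f (plane x v w s t)) (fun s t => rderive v f (plane x v w s t))
    (fun s t => rderive w f (plane x v w s t))
    (fun s t => rderive w (rderive v f) (plane x v w s t))
    (fun s t => rderive v (rderive w f) (plane x v w s t)) d d0.
have h1 s t sd td := alongv f s t (dv _ (box s t sd td)).
have h2 s t sd td := alongw f s t (dw _ (box s t sd td)).
have h3 s t sd td := alongw _ s t (dvw _ (box s t sd td)).
have h4 s t sd td := alongv _ s t (dwv _ (box s t sd td)).
have h5 := near0 _ (Ck_cont Cvw Ux).
have h6 := near0 _ (Ck_cont Cwv Ux).
have key := H h1 h2 h3 h4 h5 h6.
exact: (etrans (esym (congr1 (rderive v (rderive w f)) p0))
  (etrans (esym key) (congr1 (rderive w (rderive v f)) p0))).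
Qed.

Lemma rderive_cst (c : R) v x : rderive v (fun=> c) x = 0.
Proof. exact: derive1_cst. Qed.

End Directional.

Lemma complex_second_order (K : numClosedFieldType) (p q r s : K) :
  ((2^-1 * p + 'i * (2^-1 * q)) - 'i * (2^-1 * r + 'i * (2^-1 * s))) / 2
  = (p + s + 'i * (q - r)) / 4.
Proof.
have -> : (2^-1 * p + 'i * (2^-1 * q)) - 'i * (2^-1 * r + 'i * (2^-1 * s))
  = 2^-1 * (p - 'i ^+ 2 * s + 'i * (q - r)) by ring.
by rewrite sqrCi mulN1r opprK; field.
Qed.

Lemma conj_rect4 (K : numClosedFieldType) (p q : K) : p^* = p -> q^* = q ->
  ((p + 'i * q) / 4)^* = (p + 'i * - q) / 4.
Proof.
by move=> hp hq; rewrite rmorphM rmorphD rmorphM /= conjCi hp hq fmorphV rmorph_nat mulNr mulrN.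
Qed.

Lemma scale_rect4 (K : numClosedFieldType) (t p q : K) :
  (t * p + 'i * (t * q)) / 4 = t * ((p + 'i * q) / 4).
Proof. ring. Qed.

Lemma continuous_scale (R : realType) (T : topologicalType) (f : T -> R) (x : T) t :
  {for x, continuous f} -> {for x, continuous (fun y => t * f y)}.
Proof. by move=> h; apply: continuousM => //; exact: cst_continuous. Qed.

(** * Hermitian symmetry and scaling of the complex Hessian *)

Section ComplexHessian.
Variables (R : realType) (n : nat).
Local Notation C := (Cplx R).
Local Notation E := 'rV[Cplx R]_n.
Implicit Types (f F G : E -> R) (x v w : E) (U : set E).

Lemma imag_unitE : 'i = complex.Complex 0 1 :> C.
Proof. exact/esym/complexiE. Qed.

Lemma Re_rect (a b : R) : complex.Re (rc a + 'i * rc b : C) = a.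
Proof. by rewrite imag_unitE /= mul0r mulr0 subr0 addr0. Qed.

Lemma Im_rect (a b : R) : complex.Im (rc a + 'i * rc b : C) = b.
Proof. by rewrite imag_unitE /= mul0r mul1r !add0r. Qed.

Lemma rderive_near v F G x : (\forall y \near x, F y = G y) -> rderive v F x = rderive v G x.
Proof.
move=> h; rewrite /rderive !derive1E; apply: near_eq_derive.
have [d d0 hd] := nbhs_real_box v 0 h.
near=> t; have := hd t 0; rewrite rmorph0 scale0r addr0 normr0; apply=> //.
Unshelve. all: by end_near. Qed.

Lemma derivable_near v F G x : (\forall y \near x, F y = G y) ->
  derivable (along F x v) 0 1 -> derivable (along G x v) 0 1.
Proof.
move=> h; apply: near_eq_derivable.
have [d d0 hd] := nbhs_real_box v 0 h.
near=> t; have := hd t 0; rewrite rmorph0 scale0r addr0 normr0; apply=> //.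
Unshelve. all: by end_near. Qed.

Lemma rderive_scale v F x t : derivable (along F x v) 0 1 ->
  rderive v (fun y => t * F y) x = t * rderive v F x.
Proof. by move=> h; rewrite /rderive !derive1E; exact: (deriveZ t h). Qed.

(** Functions here are total, while rules such as the derivative of a multiple t f are known only on
    U; the class has to be insensitive to values outside U for an induction on the order to go
    through. *)
Lemma Ck_eq k U F G : open U -> (forall y, U y -> F y = G y) -> Ck k U F -> Ck k U G.
Proof.
move=> oU; elim: k F G => [|k IH] F G FG [cF hF]; split=> //.
- move=> x Ux; have nU : \forall y \near x, F y = G y.
    by have := open_nbhs_nbhs (conj oU Ux); apply: filterS => y; exact: FG.
  have cFG : F @ x --> G x by rewrite -(FG x Ux); exact: cF.
  exact: cvg_trans (near_eq_cvg nU) cFG.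
- move=> x Ux; have nU : \forall y \near x, F y = G y.
    by have := open_nbhs_nbhs (conj oU Ux); apply: filterS => y; exact: FG.
  have cFG : F @ x --> G x by rewrite -(FG x Ux); exact: cF.
  exact: cvg_trans (near_eq_cvg nU) cFG.
move=> v; have [dF CF] := hF v.
have nU x : U x -> \forall y \near x, F y = G y.
  by move=> Ux; have := open_nbhs_nbhs (conj oU Ux); apply: filterS => y; exact: FG.
split=> [x Ux|]; first exact: derivable_near (nU x Ux) (dF x Ux).
by apply: IH CF => y Uy; apply: rderive_near; exact: nU.
Qed.

Lemma cderive_rect v f g x :
  cderive v (fun y => rc (f y) + 'i * rc (g y)) x = rc (rderive v f x) + 'i * rc (rderive v g x).
Proof.
rewrite /cderive.
have -> : (fun y => complex.Re (rc (f y) + 'i * rc (g y) : C)) = f.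
  by apply/funext => y; exact: Re_rect.
have -> : (fun y => complex.Im (rc (f y) + 'i * rc (g y) : C)) = g.
  by apply/funext => y; exact: Im_rect.
by [].
Qed.

Lemma cderive_rc v f x : cderive v (fun y => rc (f y)) x = rc (rderive v f x).
Proof.
have -> : (fun y => rc (f y)) = (fun y => rc (f y) + 'i * rc 0).
  by apply/funext => y; rewrite rmorph0 mulr0 addr0.
by rewrite (cderive_rect v f (fun=> 0)) rderive_cst rmorph0 mulr0 addr0.
Qed.

Definition D2 f x v w := rderive v (rderive w f) x.
Definition unit_dir (c : 'I_n) : E := delta_mx 0 c.

Lemma chess_entry U f x a b : open U -> U x -> Ck 2 U f ->
  chess f x a b =
  (rc (D2 f x (unit_dir a) (unit_dir b) + D2 f x ('i *: unit_dir a) ('i *: unit_dir b))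
   + 'i * rc (D2 f x (unit_dir a) ('i *: unit_dir b) - D2 f x ('i *: unit_dir a) (unit_dir b))) / 4.
Proof.
move=> oU Ux Cf; rewrite mxE.
have C1 v w : derivable (along (rderive w f) x v) 0 1.
  by have [_ C1] := CkW Cf w; have [+ _] := CkW C1 v; exact.
have dzbarE : d_zbar b (fun y => rc (f y)) =
    (fun y => rc (2^-1 * rderive (unit_dir b) f y) + 'i * rc (2^-1 * rderive ('i *: unit_dir b) f y)).
  apply/funext => y; rewrite /d_zbar !cderive_rc -/(unit_dir b).
  move: (rderive _ _ _) (rderive _ _ _) => p q.
  by rewrite !rmorphM fmorphV rmorph_nat; ring.
have dE v : cderive v (d_zbar b (fun y => rc (f y))) x =
    rc (2^-1 * D2 f x v (unit_dir b)) + 'i * rc (2^-1 * D2 f x v ('i *: unit_dir b)).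
  have pair (p p' q q' : R) : p = p' -> q = q' -> rc p + 'i * rc q = rc p' + 'i * rc q' :> C.
    by move=> -> ->.
  rewrite dzbarE; apply: etrans (cderive_rect _ _ _ _) _.
  exact: (pair _ _ _ _ (rderive_scale _ (C1 v (unit_dir b))) (rderive_scale _ (C1 v ('i *: unit_dir b)))).
rewrite /d_z (dE (unit_dir a)) (dE ('i *: unit_dir a)).
move: (D2 f x (unit_dir a) (unit_dir b)) (D2 f x (unit_dir a) ('i *: unit_dir b)) => p q.
move: (D2 f x ('i *: unit_dir a) (unit_dir b)) (D2 f x ('i *: unit_dir a) ('i *: unit_dir b)) => r s.
by rewrite !(rmorphM (@rc R)) fmorphV rmorph_nat rmorphD rmorphB; exact: complex_second_order.
Qed.

(** When second derivatives commute, the real part in [chess_entry] is symmetric in a and b and the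
    imaginary part antisymmetric. *)
Lemma chess_herm U f x : open U -> U x -> Ck 2 U f -> (chess f x)^t* = chess f x.
Proof.
move=> oU Ux Cf; apply/matrixP => a b.
rewrite 2!mxE (chess_entry b a oU Ux Cf) (chess_entry a b oU Ux Cf).
have sym v w : D2 f x v w = D2 f x w v by exact: rderiveC oU Ux Cf.
rewrite (sym (unit_dir b) (unit_dir a)) (sym ('i *: unit_dir b) ('i *: unit_dir a)).
rewrite (sym (unit_dir b) ('i *: unit_dir a)) (sym ('i *: unit_dir b) (unit_dir a)).
move: (D2 f x (unit_dir a) (unit_dir b)) (D2 f x (unit_dir a) ('i *: unit_dir b)) => p q.
move: (D2 f x ('i *: unit_dir a) (unit_dir b)) (D2 f x ('i *: unit_dir a) ('i *: unit_dir b)) => r s.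
apply: etrans (conj_rect4 (conj_rc _) (conj_rc _)) _.
by rewrite -rmorphN opprB.
Qed.

Lemma Ck_scale k U f t : open U -> Ck k U f -> Ck k U (fun y => t * f y).
Proof.
move=> oU; elim: k f => [|k IH] f [cf hf].
  by split=> // x Ux; apply: continuous_scale; exact: cf.
split=> [x Ux|v]; first by apply: continuous_scale; exact: cf.
have [dv Cv] := hf v; split=> [x Ux|].
  have -> : along (fun y => t * f y) x v = t \*: along f x v by apply/funext.
  exact: derivableZ (dv x Ux).
by apply: Ck_eq (IH _ Cv) => // y Uy; rewrite rderive_scale //; exact: dv.
Qed.

Lemma chess_scale U f x t : open U -> U x -> Ck 2 U f ->
  chess (fun y => t * f y) x = rc t *: chess f x.
Proof.
move=> oU Ux Cf; apply/matrixP => a b.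
apply: etrans (chess_entry a b oU Ux (Ck_scale t oU Cf)) _.
rewrite [RHS]mxE (chess_entry a b oU Ux Cf).
have econst v w : D2 (fun y => t * f y) x v w = t * D2 f x v w.
  have [dw Cw] := CkW Cf w; have [dvw _] := CkW Cw v.
  rewrite /D2 -(rderive_scale t (dvw x Ux)); apply: rderive_near.
  have := open_nbhs_nbhs (conj oU Ux); apply: filterS => y Uy.
  by rewrite rderive_scale //; exact: dw.
apply: etrans _ (scale_rect4 _ _ _); rewrite !econst.
move: (D2 f x (unit_dir a) (unit_dir b)) (D2 f x (unit_dir a) ('i *: unit_dir b)) => p q.
move: (D2 f x ('i *: unit_dir a) (unit_dir b)) (D2 f x ('i *: unit_dir a) ('i *: unit_dir b)) => r s.
by rewrite -mulrDr -mulrBr (rmorphM (@rc R) t (p + s)) (rmorphM (@rc R) t (q - r)).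
Qed.

End ComplexHessian.

(** * Conclusion *)

Section ChangeOfFrame.
Variables (R : realType) (n : nat).
Local Notation C := (Cplx R).

(** If G is a frame for W then G J is a frame for W', and both reduce A and A' to the same matrix;
    the covector xi of the second chart becomes xi J^T in the first. *)
Lemma cone_change_chart (W W' A A' J : 'M[C]_n) (al : nat -> R) K (c : R) :
  (K.+2 <= n)%N -> W^t* = W -> posdef W -> A^t* = A -> A'^t* = A' ->
  W = J *m W' *m J^t* -> A = J *m A' *m J^t* ->
  form_gt0 W (cone_form K.+2 al W A - escale (rc c) (mixed A W K (n.-1 - K))) ->
  form_gt0 W' (cone_form K.+2 al W' A' - escale (rc c) (mixed A' W' K (n.-1 - K))).
Proof.
move=> Kn hW pW hA hA' eW eA h xi xi0.
have n0 : (0 < n)%N by lia.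
have [G GW _] := frame_exists hW pW.
have GJ (X : 'M[C]_n) : (G *m J) *m X *m (G *m J)^t* = G *m (J *m X *m J^t*) *m G^t*.
  by rewrite trmx_mul map_mxM !mulmxA.
have GW' : (G *m J) *m W' *m (G *m J)^t* = 1%:M by rewrite GJ -eW.
have xiJ : xi *m (G *m J)^T = xi *m J^T *m G^T by rewrite trmx_mul mulmxA.
have xi1 : xi *m J^T != 0.
  have := frame_xi_neq0 GW' xi0; rewrite xiJ; apply: contra => /eqP->.
  by rewrite mul0mx.
rewrite (over_volume_cone_diff GW') // GJ -eA xiJ.
by rewrite -(over_volume_cone_diff GW) //; exact: h.
Qed.

Lemma cone_le (W A : 'M[C]_n) (al : nat -> R) K (c c' : R) :
  (K.+2 <= n)%N -> W^t* = W -> posdef W -> A^t* = A -> pt_Gamma K.+1 W A -> c <= c' ->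
  form_gt0 W (cone_form K.+2 al W A - escale (rc c') (mixed A W K (n.-1 - K))) ->
  form_gt0 W (cone_form K.+2 al W A - escale (rc c) (mixed A W K (n.-1 - K))).
Proof.
move=> Kn hW pW hA gA cc h; have n0 : (0 < n)%N by lia.
have [G GW _] := frame_exists hW pW.
move=> xi xi0; have := h xi xi0; rewrite !wedgeBl !over_volumeB !wedgeZl !over_volumeZ.
have Kn1 : (K < n)%N by lia.
have ge0 := form_mixed_ge0 GW n0 xi hA Kn1 (leqnn K) gA.
rewrite !subr_gt0; apply: le_lt_trans.
by rewrite ler_wpM2r // rc_le.
Qed.

End ChangeOfFrame.

(** * From charts to the compact manifold *)

Section Assembly.
Variables (R : realType) (n : nat) (M : topologicalType) (X : complex_atlas R n M).
Local Notation C := (Cplx R).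
Variables (omega chi0 : field11 X).
Hypotheses (omega_kahler : kahler_form omega) (chi0_form : real_form11 chi0).

Lemma herm_of (A : 'M[C]_n) : A \is hermsymmx -> A^t* = A.
Proof. by move=> /is_hermitianmxP; rewrite expr0 scale1r => <-. Qed.

Lemma omega_herm i z : dom X i z -> (omega i z)^t* = omega i z.
Proof. by case: omega_kahler => -[h _ _] _ _ _ dz; apply/herm_of/h. Qed.

Lemma omega_posdef i z : dom X i z -> posdef (omega i z).
Proof.
move=> dz v v0; case: omega_kahler => _ h _ _.
by have := h i z v dz v0; rewrite map_trmx.
Qed.

Lemma chi0_herm i z : dom X i z -> (chi0 i z)^t* = chi0 i z.
Proof. by case: chi0_form => h _ _ dz; apply/herm_of/h. Qed.

Lemma coord_dom i z : dom X i z -> (coord X i @` dom X i) (coord X i z).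
Proof. by move=> dz; exists z. Qed.

Lemma deform_herm u i z : C2 X u -> dom X i z -> (deform chi0 u i z)^t* = deform chi0 u i z.
Proof.
move=> Cu dz; have h := chess_herm (@image_open _ _ _ X i) (coord_dom dz) (Cu i).
exact: (herm_add (chi0_herm dz) h).
Qed.

Lemma deform_path u t i z : C2 X u -> dom X i z ->
  deform chi0 (fun y => t * u y) i z = rc (1 - t) *: chi0 i z + rc t *: deform chi0 u i z.
Proof.
move=> Cu dz; rewrite /deform.
have -> : chess ((fun y => t * u y) \o param X i) (coord X i z)
    = rc t *: chess (u \o param X i) (coord X i z).
  exact: (chess_scale t (@image_open _ _ _ X i) (coord_dom dz) (Cu i)).
by rewrite rmorphB rmorph1 scalerBl scale1r scalerDr addrA subrK.
Qed.

Variables (K : nat) (alpha : nat -> M -> R).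
Hypotheses (Kn : (K.+2 <= n)%N) (M_compact : compact [set: M])
  (alpha_cont : forall l, (l < K.+2)%N -> continuous (alpha l))
  (chi0_Gamma : Gamma omega K.+1 chi0)
  (chi0_cone : forall i z, dom X i z ->
     form_gt0 (omega i z) (cone_form K.+2 (alpha^~ z) (omega i z) (chi0 i z))).

Definition cone_bound (c : R) (z : M) := forall i, dom X i z ->
  form_gt0 (omega i z) (cone_form K.+2 (alpha^~ z) (omega i z) (chi0 i z)
    - escale (rc c) (mixed (chi0 i z) (omega i z) K (n.-1 - K))).

Lemma cone_bound_chart i z c : dom X i z ->
  form_gt0 (omega i z) (cone_form K.+2 (alpha^~ z) (omega i z) (chi0 i z)
    - escale (rc c) (mixed (chi0 i z) (omega i z) K (n.-1 - K))) -> cone_bound c z.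
Proof.
move=> di h j dj.
case: omega_kahler => -[_ _ jw] _ _ _; case: chi0_form => _ _ jc.
apply: (cone_change_chart Kn (omega_herm di) (omega_posdef di) (chi0_herm di) (chi0_herm dj) _ _ h).
- by rewrite (jw i j z di dj) /= map_trmx.
- by rewrite (jc i j z di dj) /= map_trmx.
Qed.

Lemma cone_bound_near (z0 : M) :
  \forall z \near nbhs z0 & c \near (0 : R)^'+, cone_bound c z.
Proof.
have [i di] := @dom_cover _ _ _ X z0.
have nd : \forall z \near z0, dom X i z by apply: open_nbhs_nbhs; split => //; exact: dom_open.
case: (omega_kahler) => -[_ cw _] _ _ _; case: (chi0_form) => _ cc _.
have hherm : \forall z \near z0, hermitian_at (omega i) (chi0 i) z.
  apply: filterS nd => z dz.
  by split; [exact: omega_herm|exact: omega_posdef|exact: chi0_herm].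
have [c0 c00 nc] := cone_locally_uniform Kn (fun a b => cw i z0 a b di) (fun a b => cc i z0 a b di)
  (fun l lk => alpha_cont lk (x := z0)) hherm (chi0_Gamma di) (chi0_cone di).
(* Near covering asks for all small constants simultaneously: the bound with [c0] at the points z
   near [z0] passes to every c <= c0 by [cone_le], and to the other charts at z by
   [cone_bound_chart]. *)
exists ([set z | dom X i z /\ form_gt0 (omega i z)
    (cone_form K.+2 (alpha^~ z) (omega i z) (chi0 i z)
    - escale (rc c0) (mixed (chi0 i z) (omega i z) K (n.-1 - K)))], [set c | c <= c0]).
  split => /=; first by apply: filterI nd nc.
  exact: nbhs_right_le.
move=> [z c] /= [[dz hz] cle]; apply: (cone_bound_chart dz).
exact: (cone_le Kn (omega_herm dz) (omega_posdef dz) (chi0_herm dz) (chi0_Gamma dz) cle hz).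
Qed.

Lemma cone_bound_uniform : exists2 c : R, 0 < c & forall z, cone_bound c z.
Proof.
have h : \forall c \near (0 : R)^'+, [set: M] `<=` cone_bound c.
  apply: (compact_near_coveringP _).1 M_compact _ _ _ _ _ => z _; exact: cone_bound_near.
have [c [c0 hc]] := filter_ex (filterI (nbhs_right_gt (0 : R)) h).
by exists c => // z; exact: hc.
Qed.

End Assembly.

Theorem lemma3p1 (R : realType) (n k : nat) (M : topologicalType)
    (X : complex_atlas R n M) (omega chi0 : field11 X)
    (alpha : nat -> M -> R) (tau : R)
    (hn : (2 <= n)%N) (hk : (2 <= k <= n)%N)
    (M_hausdorff : hausdorff_space M) (M_compact : compact [set: M])
    (omega_kahler : kahler_form omega)
    (alpha_cont : forall l, (l < k)%N -> continuous (alpha l))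
    (alpha_ge0 : forall l z, (l <= k - 2)%N -> 0 <= alpha l z)
    (alpha_sum : forall z, 0 < \sum_(0 <= l < k.-1) alpha l z)
    (chi0_form : real_form11 chi0)
    (chi0_Gamma : Gamma omega k.-1 chi0)
    (tau_gt0 : 0 < tau)
    (chi0_tau : Gamma omega k.-1 (fun i z => chi0 i z - rc tau *: omega i z))
    (omega_tau : Gamma omega k.-1 (fun i z => omega i z - rc tau *: chi0 i z)) :
  (forall u : M -> R, C2 X u -> Gamma omega k.-1 (deform chi0 u) ->
    (forall (t : R) l, 0 <= t <= 1 -> (1 <= l <= k.-1)%N ->
      forall i z, dom X i z ->
        let chi_tu := deform chi0 (fun y => t * u y) i z in
        form_ge0 (omega i z)
          (mixed chi_tu (omega i z) l.-1 (n - l)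
           - escale (rc ((1 - t) ^+ l.-1 * tau ^+ l.-1))
               (wpow (form11 (omega i z)) n.-1)))
    /\
    (forall (t : R) l, 0 < t <= 1 -> (1 <= l <= k.-1)%N ->
      forall i z, dom X i z ->
        let chi_u := deform chi0 u i z in
        let chi_tu := deform chi0 (fun y => t * u y) i z in
        top_ge0 (omega i z)
          (escale (rc (t ^- l)) (mixed chi_tu (omega i z) l (n - l))
           - mixed chi_u (omega i z) l (n - l))))
  /\
  (cone_witness omega k alpha chi0 chi0 ->
    exists C : R, 0 < C /\
    forall u : M -> R, C2 X u -> Gamma omega k.-1 (deform chi0 u) ->
      solution omega k alpha chi0 u ->
      forall t : R, 0 <= t <= 1 ->
      forall i z, dom X i z ->
        let chi_tu := deform chi0 (fun y => t * u y) i z in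
        let L := cone_form k (alpha^~ z) (omega i z) chi_tu in
        form_gt0 (omega i z)
          (L - escale (rc (C * (1 - t))) (mixed chi_tu (omega i z) (k - 2) (n - k + 1)))
        /\
        form_gt0 (omega i z)
          (L - escale (rc (C * tau ^+ (k - 2) * (1 - t) ^+ k.-1))
                 (wpow (form11 (omega i z)) n.-1))).
Proof.
have [K eK] : exists K, k = K.+2.
  by case/andP: hk => k2 _; exists (k - 2)%N; rewrite -addn2 subnK.
subst k; case/andP: hk => _ Kn.
have n0 : (0 < n)%N by exact: leq_trans Kn.
have Km : (K < n)%N by exact: leq_trans (leqnSn _) Kn.
have sh i z : dom X i z -> exists G : 'M[Cplx R]_n, G *m omega i z *m G^t* = 1%:M.
  by move=> dz; have [G GW _] := frame_exists (omega_herm omega_kahler dz)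
       (omega_posdef omega_kahler dz); exists G.
split.
  move=> u Cu gu; split=> t l t01 /andP[l1 lk] i z dz.
    have [G GW] := sh i z dz.
    rewrite /= (deform_path chi0 t Cu dz).
    have -> : (n - l = n.-1 - l.-1)%N by lia.
    have lK : (l.-1 <= K)%N by lia.
    exact: (mixed_path_ge GW n0 (omega_herm omega_kahler dz) (chi0_herm chi0_form dz)
      (deform_herm chi0_form Cu dz) Km lK t01 (ltW tau_gt0) (chi0_tau i z dz) (gu i z dz)).
  have [G GW] := sh i z dz.
  rewrite /= (deform_path chi0 t Cu dz).
  exact: (mixed_path_le GW (chi0_herm chi0_form dz) (deform_herm chi0_form Cu dz)
    (ltnW Kn) lk t01 (chi0_Gamma i z dz) (gu i z dz)).
move=> [_ _ chi0_cone].
(* C is fixed before u and t appear, from the data at chi_0 and compactness; this is the asserted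
   uniformity. *)
have [C C0 hC] := cone_bound_uniform omega_kahler chi0_form Kn M_compact alpha_cont
  chi0_Gamma chi0_cone.
exists C; split=> // u Cu gu sol t t01 i z dz chi_tu L.
have [G GW] := sh i z dz.
have hA := chi0_herm chi0_form dz.
have hB := deform_herm chi0_form Cu dz.
have al0 l : (l <= K)%N -> 0 <= alpha l z by move=> lK; apply: alpha_ge0; rewrite subn2.
(* The exponent completing the degree of an (n-1,n-1)-form is written [n.-1 - K] in the pointwise
   results. *)
have e1 : (n - K.+2 + 1 = n.-1 - K)%N by lia.
have key : form_gt0 (omega i z)
    (L - escale (rc (C * (1 - t))) (mixed chi_tu (omega i z) K (n.-1 - K))).
  rewrite /L /chi_tu (deform_path chi0 t Cu dz).
  exact: (cone_path_gt GW n0 hA hB Kn t01 (ltW C0) (chi0_Gamma i z dz) (gu i z dz) al0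
    (alpha_sum z) (sol i z dz) (hC z i dz)).
rewrite subn2 e1 /=; split; first exact: key.
apply: (form_gt0_trans key).
(* Part (1) with l = k - 1, multiplied by C (1 - t) >= 0: the extra factor raises the power of 1 - t
   from k - 2 to k - 1. *)
have ge : form_ge0 (omega i z) (mixed chi_tu (omega i z) K (n.-1 - K)
    - escale (rc ((1 - t) ^+ K * tau ^+ K)) (wpow (form11 (omega i z)) n.-1)).
  rewrite /chi_tu (deform_path chi0 t Cu dz).
  exact: (mixed_path_ge GW n0 (omega_herm omega_kahler dz) hA hB Km (leqnn K) t01
    (ltW tau_gt0) (chi0_tau i z dz) (gu i z dz)).
have c0 : 0 <= C * (1 - t).
  by case/andP: t01 => _ t1; rewrite mulr_ge0 ?subr_ge0 // ltW.
have := form_ge0Z c0 ge.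
have -> : escale (rc (C * (1 - t))) (escale (rc ((1 - t) ^+ K * tau ^+ K)) (wpow (form11 (omega i z)) n.-1))
   = escale (rc (C * tau ^+ K * (1 - t) ^+ K.+1)) (wpow (form11 (omega i z)) n.-1).
  apply/ffunP => S; rewrite !ffunE mulrA -rmorphM; congr (rc _ * _).
  by rewrite exprS; ring.
by [].
Qed.
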